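(* Let $f\in L_2(\Omega)$ be given. Consider the normal-normal continuous mixed formulation: find $\boldsymbol M\in H_{\mathit{nn}}(\mathrm{dDiv},\mathcal T;\mathbb S)$, $u\in L_2(\Omega)$, and $\psi\in H^{3/2}_0(\mathcal S)$ such that \[ (\mathcal C^{-1}\boldsymbol M,\boldsymbol{\delta M})-(u,\operatorname{div}\operatorname{\mathbf{div}}\boldsymbol{\delta M})_{\mathcal T}-\langle\psi,\boldsymbol{\delta M}\rangle_{\mathcal S}=0, \] \[ -(\operatorname{div}\operatorname{\mathbf{div}}\boldsymbol M,\delta u)_{\mathcal T}-\langle\delta\psi,\boldsymbol M\rangle_{\mathcal S}=-(f,\delta u) \] holds for any $\boldsymbol{\delta M}\in H_{\mathit{nn}}(\mathrm{dDiv},\mathcal T;\mathbb S)$, $\delta u\in L_2(\Omega)$, and $\delta\psi\in H^{3/2}_0(\mathcal S)$. This problem is well posed (it has exactly one solution, depending continuously on $f$). Its solution $(\boldsymbol M,u,\psi)$ satisfies \[ \|\boldsymbol M\|_{\mathrm{dDiv},\mathcal T}+\|u\|+\|\psi\|_{3/2,\mathcal S}\le C\|f\| \] with a constant $C$ that is independent of $f$ and $\mathcal T$. Furthermore, $u\in H^2_0(\Omega)$, $\boldsymbol M=\mathcal C D^2u\in H(\mathrm{dDiv},\Omega;\mathbb S)$, $\psi=\gamma_{2,1}(u)$, and $u$, $\boldsymbol M$ solve the Kirchhoff–Love problem \[ \operatorname{div}\operatorname{\mathbf{div}}\boldsymbol M=f,\quad \boldsymbol M=\mathcal C D^2u\ \text{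 in }\Omega,\qquad u=\partial_nu=0\ \text{ on }\Gamma. \]
   Context: $\Omega\subset\mathbb R^2$ is a bounded, simply connected Lipschitz polygon with boundary $\Gamma=\partial\Omega$; $\partial_n$ is the exterior normal derivative. $\mathbb S$ is the space of symmetric $2\times2$ real matrices; $\mathcal C$ is a symmetric, (uniformly) positive definite $L_\infty$ tensor field on $\Omega$, acting pointwise as a linear map $\mathbb S\to\mathbb S$, with pointwise inverse $\mathcal C^{-1}$. $D^2$ is the Hessian and $\operatorname{\mathbf{div}}$ the row-wise divergence of tensors. $(\cdot,\cdot)$, $\|\cdot\|$ are the $L_2(\Omega)$ inner product and norm. $\|v\|_2^2:=\|v\|^2+\|D^2v\|^2$ on $H^2(\Omega)$. For a domain $\omega$, $H(\mathrm{dDiv},\omega;\mathbb S):=\{\boldsymbol M\in L_2(\omega;\mathbb S):\operatorname{div}\operatorname{\mathbf{div}}\boldsymbol M\in L_2(\omega)\}$ with $\|\boldsymbol M\|_{\mathrm{dDiv},\omega}^2:=\|\boldsymbol M\|_{L_2(\omega)}^2+\|\operatorname{div}\operatorname{\mathbf{div}}\boldsymbol M\|_{L_2(\omega)}^2$. $H^2_0(\Omega)$ is the subspace of $H^2(\Omega)$ with vanishing trace and normal derivative on $\Gamma$. $\mathcal T$ is a regular (conforming) mesh of shape-regular triangles $T$ covering $\Omega$, with skeleton $\mathcal S=\bigcup_{T\in\mathcal T}\partial T$. $(\cdot,\cdot)_{\mathcal T}$ is the sum of elementwise $L_2$ inner products, with differential operators taken elementwise. $H(\mathrm{dDiv},\mathcal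 T;\mathbb S):=\prod_{T\in\mathcal T}H(\mathrm{dDiv},T;\mathbb S)$ (piecewise tensor functions), with $\|\boldsymbol M\|_{\mathrm{dDiv},\mathcal T}^2=\sum_T\|\boldsymbol M\|_{\mathrm{dDiv},T}^2$; $H^1_0(\mathcal T):=\prod_{T\in\mathcal T}H^1_0(T)$. For $v\in H^2(\Omega)$ and $\boldsymbol Q\in H(\mathrm{dDiv},\mathcal T;\mathbb S)$ set $\langle\gamma_2(v),\boldsymbol Q\rangle_{\mathcal S}:=(D^2v,\boldsymbol Q)-(v,\operatorname{div}\operatorname{\mathbf{div}}\boldsymbol Q)_{\mathcal T}$, and $H_{\mathit{nn}}(\mathrm{dDiv},\mathcal T;\mathbb S):=\{\boldsymbol Q\in H(\mathrm{dDiv},\mathcal T;\mathbb S):\langle\gamma_2(v),\boldsymbol Q\rangle_{\mathcal S}=0\ \forall v\in H^2_0(\Omega)\cap H^1_0(\mathcal T)\}$, with norm $\|\cdot\|_{\mathrm{dDiv},\mathcal T}$. Trace operator $\gamma_{2,1}:H^2(\Omega)\to H_{\mathit{nn}}(\mathrm{dDiv},\mathcal T;\mathbb S)^*$, $\langle\gamma_{2,1}(v),\boldsymbol Q\rangle_{\mathcal S}:=(D^2v,\boldsymbol Q)-(v,\operatorname{div}\operatorname{\mathbf{div}}\boldsymbol Q)_{\mathcal T}$. Trace space $H^{3/2}_0(\mathcal S):=\gamma_{2,1}(H^2_0(\Omega))$ with norm $\|\psi\|_{3/2,\mathcal S}:=\inf\{\|v\|_2: v\in H^2(\Omega),\ \gamma_{2,1}(v)=\psi\}$;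 $\langle\psi,\boldsymbol Q\rangle_{\mathcal S}$ is the action of the functional $\psi$ on $\boldsymbol Q\in H_{\mathit{nn}}(\mathrm{dDiv},\mathcal T;\mathbb S)$. *)

(* Defs.v *)
From HB Require Import structures.
From mathcomp Require Import all_boot all_order all_algebra.
From mathcomp Require Import all_classical all_reals all_analysis.

Set Implicit Arguments.
Unset Strict Implicit.
Unset Printing Implicit Defensive.
Import Order.TTheory GRing.Theory Num.Theory.
Import numFieldNormedType.Exports.
Local Open Scope classical_set_scope.
Local Open Scope ring_scope.

(* Elements of Lebesgue and Sobolev spaces over a set D are represented by
   functions on the whole plane, of which only the values on D matter, up to
   null sets. *)

Section Lebesgue.
Context (R : realType) (d : measure_display) (X : measurableType d).
Variable mu : {measure set X -> \bar R}.
Implicit Types (D : set X) (f g : X -> R).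

Definition in_L2 D f : Prop := f \_ D \in Lfun mu 2%:E.

Definition in_Linfty D f : Prop := f \_ D \in Lfun mu +oo%E.

Definition inner D f g : R := (\int[mu]_(x in D) (f x * g x))%R.

Definition norm2 D f : R := Num.sqrt (inner D f f).

Definition ae_in D (P : X -> Prop) : Prop := {ae mu, forall x, D x -> P x}.

End Lebesgue.

Section Plane.
Variable R : realType.
Local Notation R2 := (R * R)%type.
Local Notation I01 := [set` `[0%R : R, 1%R]].
Implicit Types (D Omega : set R2) (x y a b : R2) (v g f u : R2 -> R).

Definition area :
    {measure set (measurableTypeR R * measurableTypeR R)%type -> \bar R} :=
  (lebesgue_measure \x lebesgue_measure)%E.

Definition length : {measure set (measurableTypeR R) -> \bar R} :=
  lebesgue_measure.

Definition sqnorm x : R := x.1 ^+ 2 + x.2 ^+ 2.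

Definition frontier D : set R2 := closure D `\` interior D.

Definition seg a b (t : R) : R2 := a + t *: (b - a).

Definition segment a b : set R2 := seg a b @` I01.

(* Near each boundary point the domain lies, in a suitably rotated orthonormal
   coordinate system, strictly above the graph of a Lipschitz function. *)
Definition lipschitz_boundary D : Prop :=
  forall x, frontier D x ->
  exists (c s : R) (h : R -> R),
    [/\ c ^+ 2 + s ^+ 2 = 1, lipschitz h &
        \forall y \near x,
          D y <-> h (c * y.1 + s * y.2) < c * y.2 - s * y.1].

Definition polygonal D : Prop :=
  exists E : seq (R2 * R2),
    frontier D = [set x | exists2 e, e \in E & segment e.1 e.2 x].

Definition simply_connected D : Prop :=
  forall gamma : R -> R2,
    {within I01, continuous gamma} ->
    (forall t, I01 t -> D (gamma t)) ->
    gamma 0 = gamma 1 ->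
  exists H : R2 -> R2,
    [/\ {within I01 `*` I01, continuous H},
        forall z, (I01 `*` I01) z -> D (H z),
        forall t, I01 t -> H (0, t) = gamma t,
        forall s, I01 s -> H (s, 0) = H (s, 1) &
        exists c, forall t, I01 t -> H (1, t) = c].

Definition lipschitz_polygon Omega : Prop :=
  [/\ [/\ Omega !=set0, open Omega, connected Omega & bounded_set Omega],
      simply_connected Omega, polygonal Omega & lipschitz_boundary Omega].

Definition basis_vec (i : 'I_2) : R2 := ((i == 0)%:R, (i == 1)%:R).

Definition partials (s : seq 'I_2) (phi : R2 -> R) : R2 -> R :=
  foldr (fun i (psi : R2 -> R) x => 'D_(basis_vec i) psi x) phi s.

Definition smooth (phi : R2 -> R) : Prop :=
  forall s : seq 'I_2, continuous (partials s phi) /\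
    forall x i, derivable (partials s phi) x (basis_vec i).

Definition test_function D (phi : R2 -> R) : Prop :=
  smooth phi /\
  exists K : set R2, [/\ compact K, K `<=` D & forall x, ~ K x -> phi x = 0].

Definition is_wderiv D (s : seq 'I_2) v g : Prop :=
  in_L2 area D g /\
  forall phi, test_function D phi ->
    inner area D v (partials s phi) = (-1) ^+ size s * inner area D g phi.

(* A choice of a weak derivative in L_2(D); the zero function if none exists. *)
Definition wderiv D (s : seq 'I_2) v : R2 -> R :=
  xget (fun=> 0) [set g | is_wderiv D s v g].

Definition Hk (k : nat) D v : Prop :=
  in_L2 area D v /\
  forall s : seq 'I_2, (size s <= k)%N -> exists g, is_wderiv D s v g.

Definition hessian D v (x : R2) : 'M[R]_2 :=
  \matrix_(i, j) wderiv D [:: i; j] v x.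

(* g is the trace of v \in H^1(D) on the boundary of D: the restriction
   operator to the boundary, extended by H^1(D)-continuity from smooth
   functions, maps v to g.  For a polygonal D, convergence in L_2 of the
   boundary is convergence in L_2 of each nondegenerate boundary segment. *)
Definition is_trace D v g : Prop :=
  exists phi : nat -> R2 -> R,
  [/\ forall n, smooth (phi n),
      (fun n => norm2 area D (fun x => phi n x - v x)) @ \oo --> (0 : R),
      forall i, (fun n => norm2 area D
         (fun x => partials [:: i] (phi n) x - wderiv D [:: i] v x))
           @ \oo --> (0 : R) &
      forall a b, a != b -> segment a b `<=` frontier D ->
        in_L2 length I01 (g \o seg a b) /\
        (fun n => norm2 length I01
           (fun t => phi n (seg a b t) - g (seg a b t))) @ \oo --> (0 : R)].

(* The normal derivative of v \in H^2(D) is n . g, with g the trace of the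
   gradient of v.  On a boundary segment [a, b] the exterior unit normal n is a
   nonzero multiple of (b.2 - a.2, a.1 - b.1). *)
Definition zero_normal_derivative D v : Prop :=
  exists g : 'I_2 -> R2 -> R,
  (forall i, is_trace D (wderiv D [:: i] v) (g i)) /\
  forall a b, a != b -> segment a b `<=` frontier D ->
    ae_in length I01 (fun t =>
      (b.2 - a.2) * g 0 (seg a b t) + (a.1 - b.1) * g 1 (seg a b t) = 0).

Definition H10 D v : Prop := Hk 1 D v /\ is_trace D v (fun=> 0).

Definition H20 D v : Prop :=
  [/\ Hk 2 D v, is_trace D v (fun=> 0) & zero_normal_derivative D v].

Local Notation tensor := 'M[R]_2.
Local Notation field := (R2 -> tensor).
Implicit Types (A B : tensor) (M Q : field).

Definition is_sym A : Prop := A^T = A.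

Definition ddot A B : R := \sum_i \sum_j A i j * B i j.

Definition tinner D M Q : R := (\int[area]_(x in D) ddot (M x) (Q x))%R.

Definition tnorm D M : R := Num.sqrt (tinner D M M).

Definition in_L2S D M : Prop :=
  ae_in area D (fun x => is_sym (M x)) /\
  forall i j, in_L2 area D (fun x => M x i j).

(* g is the distributional div div M on D. *)
Definition is_ddiv D M g : Prop :=
  in_L2 area D g /\
  forall phi, test_function D phi ->
    tinner D M (fun x => \matrix_(i, j) partials [:: i; j] phi x)
      = inner area D g phi.

Definition ddiv D M : R2 -> R := xget (fun=> 0) [set g | is_ddiv D M g].

Definition HdDiv D M : Prop := in_L2S D M /\ exists g, is_ddiv D M g.

(* C x is given as a linear map on all matrices, of which only the
   restriction to symmetric ones matters. *)
Definition elasticity_tensor Omega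
    (C : R2 -> {linear 'M[R]_2 -> 'M[R]_2}) : Prop :=
  [/\ forall x A, Omega x -> is_sym A -> is_sym (C x A),
      forall A i j, is_sym A -> in_Linfty area Omega (fun x => C x A i j),
      ae_in area Omega (fun x => forall A B, is_sym A -> is_sym B ->
        ddot (C x A) B = ddot A (C x B)) &
      exists2 alpha : R, 0 < alpha &
        ae_in area Omega (fun x => forall A, is_sym A ->
          alpha * ddot A A <= ddot (C x A) A)].

(* The inverse of L : S -> S, S being the space of symmetric matrices. *)
Definition sym_inverse (L : tensor -> tensor) (A : tensor) : tensor :=
  xget 0 [set B | is_sym B /\ L B = A].

(* Convex hull of the vertices p k with k \in K; all of the closed triangle for
   K = setT. *)
Definition face (p : 'I_3 -> R2) (K : set 'I_3) : set R2 :=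
  [set x | exists l : 'I_3 -> R,
     [/\ forall k, 0 <= l k, forall k, ~ K k -> l k = 0,
         \sum_k l k = 1 & x = \sum_k l k *: p k]].

Definition open_triangle (p : 'I_3 -> R2) : set R2 :=
  [set x | exists l : 'I_3 -> R,
     [/\ forall k, 0 < l k, \sum_k l k = 1 & x = \sum_k l k *: p k]].

Definition triangle_area (p : 'I_3 -> R2) : R :=
  `|((p 1).1 - (p 0).1) * ((p 2).2 - (p 0).2)
    - ((p 2).1 - (p 0).1) * ((p 1).2 - (p 0).2)| / 2.

(* Conformity: distinct closed triangles meet exactly in the convex hull of
   their common vertices, i.e. in nothing, in a common vertex or in a common
   edge. *)
Definition regular_mesh Omega (n : nat) (T : 'I_n -> 'I_3 -> R2) : Prop :=
  [/\ forall i, 0 < triangle_area (T i),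
      forall i j, i != j -> range (T i) <> range (T j),
      forall i j, i != j ->
        face (T i) setT `&` face (T j) setT
          = face (T i) [set k | range (T j) (T i k)] &
      closure Omega = \bigcup_i face (T i) setT].

Definition shape_regular (kappa : R) (n : nat) (T : 'I_n -> 'I_3 -> R2) :
    Prop :=
  forall i k l, sqnorm (T i k - T i l) <= kappa * triangle_area (T i).

Section Mesh.
Variables (Omega : set R2) (n : nat) (T : 'I_n -> 'I_3 -> R2).
Local Notation elt i := (open_triangle (T i)).

Definition HdDivT Q : Prop := in_L2S Omega Q /\ forall i, HdDiv (elt i) Q.

Definition normdDivT Q : R :=
  Num.sqrt (\sum_i (tnorm (elt i) Q ^+ 2
                    + norm2 area (elt i) (ddiv (elt i) Q) ^+ 2)).

(* (v, div div Q)_T, with div div taken elementwise *)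
Definition inner_ddivT v Q : R :=
  \sum_i inner area (elt i) v (ddiv (elt i) Q).

Definition trace_pairing v Q : R :=
  tinner Omega (hessian Omega v) Q - inner_ddivT v Q.

Definition Hnn Q : Prop :=
  HdDivT Q /\
  forall v, H20 Omega v -> (forall i, H10 (elt i) v) -> trace_pairing v Q = 0.

(* Functionals on Hnn are represented by maps on all tensor fields, of which
   only the values on Hnn matter. *)
Local Notation functional := (field -> R).
Implicit Types psi : functional.

Definition eq_dual psi psi' : Prop := forall Q, Hnn Q -> psi Q = psi' Q.

Definition gamma21 v : functional := trace_pairing v.

Definition H32_0 psi : Prop := exists2 v, H20 Omega v & eq_dual psi (gamma21 v).

Definition normH2 v : R :=
  Num.sqrt (norm2 area Omega v ^+ 2 + tnorm Omega (hessian Omega v) ^+ 2).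

Definition norm32 psi : R :=
  inf [set normH2 v | v in [set v | Hk 2 Omega v /\ eq_dual (gamma21 v) psi]].

Definition mixed_solution (C : R2 -> {linear 'M[R]_2 -> 'M[R]_2}) f
    M u psi : Prop :=
  [/\ Hnn M, in_L2 area Omega u, H32_0 psi,
      forall dM, Hnn dM ->
        tinner Omega (fun x => sym_inverse (C x) (M x)) dM
          - inner_ddivT u dM - psi dM = 0 &
      forall du dpsi, in_L2 area Omega du -> H32_0 dpsi ->
        - inner_ddivT du M - dpsi M = - inner area Omega f du].

End Mesh.

Definition kirchhoff_love Omega (C : R2 -> {linear 'M[R]_2 -> 'M[R]_2}) f
    u M : Prop :=
  [/\ HdDiv Omega M /\ H20 Omega u,
      ae_in area Omega (fun x => ddiv Omega M x = f x) &
      ae_in area Omega (fun x => M x = C x (hessian Omega u x))].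

End Plane.

(* Main.v *)
(** The primal problem: find [u] in [H20] with [(C D^2 u, D^2 w) = (f, w)] for
    all [w] in [H20].  It is solved by the Riesz representation theorem, as
    [|D^2 u|] is a norm on [H20] (Green's formula gives the Poincare
    inequalities), for which [H20] is complete (by a trace inequality on the
    Lipschitz boundary, zero boundary values survive [L2] limits).  The flux
    [C D^2 u] has divergence [div div C D^2 u = f] and is annihilated by
    [gamma21 v] for every [v] in [H20], whence [(C D^2 u, u, gamma21 u)] solves
    the mixed problem, with bounds that do not see the mesh.

    Conversely let [(M, u, psi)] solve the mixed problem.  By the second
    equation [M] is annihilated by all [gamma21 v] and [div div M = f], so that
    [(D^2 v, M) = (f, v)] for all [v] in [H20].  Testing the first equation with
    the flux [C D^2 z] of the primal solution [z] for an arbitrary datum [g]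
    kills [psi] and yields [(u, g) = (D^2 z, M) = (f, z)]; the primal solution
    [uf] satisfies [(uf, g) = (f, z)] too, so [u = uf].  Testing it with [M] as
    well gives [(C^-1 M - D^2 u, M - C D^2 u) = 0], that is [M = C D^2 u], and
    then the first equation reads [psi = gamma21 u]. *)

(* The divergence theorem is replaced by an inequality. On almost every horizontal line the domain
   is a finite union of intervals that end on boundary segments, so the integral of a partial
   derivative of a [C1] function is at most a constant times the integrals of its modulus over these
   segments. Wherever Green's formula is needed, one factor has zero boundary values, so that the
   bound vanishes or tends to 0 along the smooth approximations, and neither normals nor
   orientations enter. The Lipschitz boundary serves twice: for the trace inequality, and to show
   that the interior of the closure of the domain lies in the domain, which keeps the open elements
   of a mesh inside it. Limits are taken along sequences whose increments decay like 2^-k, since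
   these converge almost everywhere; every completeness statement, up to the Riesz representation,
   asks only for such sequences. Fields such as the pointwise inverse of the tensor are choices that
   may be irregular on null sets; they are replaced by measurable representatives, with Cramer's
   rule supplying the inverse. *)
Require Import Defs.
From HB Require Import structures.
From mathcomp Require Import all_boot all_order all_algebra.
From mathcomp Require Import all_classical all_reals all_analysis.
From mathcomp Require Import measurable_realfun.
From mathcomp Require Import ring lra.

Set Implicit Arguments.
Unset Strict Implicit.
Unset Printing Implicit Defensive.
Import Order.TTheory GRing.Theory Num.Theory.
Import numFieldNormedType.Exports.
Local Open Scope classical_set_scope.
Local Open Scope ring_scope.

(** * Square integrable functions *)

Section SquareIntegrable.
Context (R : realType) (d : measure_display) (X : measurableType d).
Variables (mu : {measure set X -> \bar R}) (D : set X).
Hypothesis mD : measurable D.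
Implicit Types (f g h : X -> R).
Local Notation L2 := (in_L2 mu D).
Local Notation ip := (inner mu D).
Local Notation nm := (norm2 mu D).

Lemma in_L2P f : L2 f <->
  measurable_fun D f /\ (\int[mu]_(x in D) ((f x) ^+ 2)%:E < +oo)%E.
Proof.
have E : (\int[mu]_(x in D) ((f x) ^+ 2)%:E = \int[mu]_x (((f \_ D) x) ^+ 2)%:E)%E.
  rewrite integral_mkcond; apply: eq_integral => x _.
  by rewrite /patch; case: ifP => //; rewrite expr0n.
split=> [fL|[mf fi]].
  have mf : measurable_fun setT (f \_ D).
    by move: fL => /andP[]; rewrite inE.
  split; first exact/(measurable_restrictT f mD).
  have := Lfun2_integrable_sqr fL; move=> /integrableP[_].
  rewrite E; under eq_integral do rewrite gee0_abs ?lee_fin ?sqr_ge0//.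
  by [].
have mf' : measurable_fun setT (f \_ D) by exact/(measurable_restrictT f mD).
rewrite /in_L2; apply/andP; split; rewrite inE//=.
rewrite /finite_norm.
rewrite unlock /= poweR_lty//.
move: fi; rewrite E; congr (_ < _)%E; apply: eq_integral => x _.
by rewrite powR_mulrn// real_normK ?num_real.
Qed.

Lemma in_L2_measurable f : L2 f -> measurable_fun D f.
Proof. by move=> /in_L2P[]. Qed.

Lemma in_L2_integrable_mul f g : L2 f -> L2 g ->
  mu.-integrable D (EFin \o (fun x => f x * g x)).
Proof.
move=> Lf Lg; have := Lfun2_mul_Lfun1 Lf Lg.
move=> /Lfun1_integrable fgi.
apply/(integrable_mkcond _ mD); apply: eq_integrable fgi => // x _ /=.
by rewrite /patch/=; case: ifP => _; rewrite ?mulr0.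
Qed.

Lemma in_L2_sqr_integrable f : L2 f ->
  mu.-integrable D (EFin \o (fun x => f x ^+ 2)).
Proof. by move=> Lf; exact: in_L2_integrable_mul. Qed.

Lemma integrable_sqr_in_L2 f : measurable_fun D f ->
  mu.-integrable D (EFin \o (fun x => f x ^+ 2)) -> L2 f.
Proof.
move=> mf /integrableP[_ fi]; apply/in_L2P; split => //.
apply: le_lt_trans fi; rewrite le_eqVlt; apply/orP; left; apply/eqP.
by apply: eq_integral => x _; rewrite /= ger0_norm// sqr_ge0.
Qed.

Lemma in_L2_dominated f g : measurable_fun D f -> L2 g ->
  {ae mu, forall x, D x -> `|f x| <= `|g x|} -> L2 f.
Proof.
move=> mf /in_L2P[mg gi] fg; apply/in_L2P; split => //.
apply: le_lt_trans gi; apply: ae_ge0_le_integral => //.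
- by move=> x _; rewrite lee_fin sqr_ge0.
- exact/measurable_EFinP/measurable_funX.
- by move=> x _; rewrite lee_fin sqr_ge0.
- exact/measurable_EFinP/measurable_funX.
- apply: filterS fg => x fgx /fgx le_fg; rewrite lee_fin.
  by rewrite -[f x ^+ 2]real_normK ?num_real// -[g x ^+ 2]real_normK ?num_real// lerXn2r// nnegrE.
Qed.

Lemma in_L2_0 : L2 (fun=> 0).
Proof.
apply/in_L2P; split; first exact: measurable_cst.
by under eq_integral do rewrite expr0n/=; rewrite integral0 ltry.
Qed.

Lemma in_L2D f g : L2 f -> L2 g -> L2 (fun x => f x + g x).
Proof.
move=> Lf Lg; apply: integrable_sqr_in_L2.
  by apply: measurable_funD; exact: in_L2_measurable.
have E : EFin \o (fun x => (f x + g x) ^+ 2) =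
  ((EFin \o (fun x => f x ^+ 2)) \+ (EFin \o (fun x => g x ^+ 2))) \+
  (fun x => 2%:E * (f x * g x)%:E)%E.
  by apply/funext => x /=; rewrite -EFinM -!EFinD; congr EFin; ring.
rewrite E; apply: integrableD => //; first apply: integrableD => //.
- exact: in_L2_sqr_integrable.
- exact: in_L2_sqr_integrable.
- by apply: integrableZl => //; exact: in_L2_integrable_mul.
Qed.

Lemma in_L2Z (a : R) f : L2 f -> L2 (fun x => a * f x).
Proof.
move=> Lf; apply: integrable_sqr_in_L2.
  by apply: measurable_funM => //; exact: in_L2_measurable.
have E : EFin \o (fun x => (a * f x) ^+ 2) =
   (fun x => (a ^+ 2)%:E * (f x ^+ 2)%:E)%E.
  by apply/funext => x /=; rewrite -EFinM exprMn.
by rewrite E; apply: integrableZl => //; exact: in_L2_sqr_integrable.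
Qed.

Lemma in_L2N f : L2 f -> L2 (fun x => - f x).
Proof.
by move=> /(in_L2Z (-1)); under eq_fun do rewrite mulN1r.
Qed.

Lemma in_L2B f g : L2 f -> L2 g -> L2 (fun x => f x - g x).
Proof. by move=> Lf /in_L2N; exact: in_L2D. Qed.

Lemma in_L2_sum (I : Type) (r : seq I) (F : I -> X -> R) :
  (forall i, L2 (F i)) -> L2 (fun x => \sum_(i <- r) F i x).
Proof.
move=> LF; elim: r => [|i r IH].
  by under eq_fun do rewrite big_nil; exact: in_L2_0.
by under eq_fun do rewrite big_cons; exact: in_L2D.
Qed.

Lemma innerC f g : ip f g = ip g f.
Proof. by apply: eq_Rintegral => x _; rewrite mulrC. Qed.

Lemma innerDl f g h : L2 f -> L2 g -> L2 h ->
  ip (fun x => f x + g x) h = ip f h + ip g h.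
Proof.
move=> Lf Lg Lh; rewrite /inner -RintegralD//; try exact: in_L2_integrable_mul.
by apply: eq_Rintegral => x _; rewrite mulrDl.
Qed.

Lemma innerZl (a : R) f h : L2 f -> L2 h -> ip (fun x => a * f x) h = a * ip f h.
Proof.
move=> Lf Lh; rewrite /inner -RintegralZl//; last exact: in_L2_integrable_mul.
by apply: eq_Rintegral => x _; rewrite mulrA.
Qed.

Lemma innerNl f h : L2 f -> L2 h -> ip (fun x => - f x) h = - ip f h.
Proof.
move=> Lf Lh; rewrite -mulN1r -innerZl//; congr inner.
by apply/funext => x; rewrite mulN1r.
Qed.

Lemma innerBl f g h : L2 f -> L2 g -> L2 h ->
  ip (fun x => f x - g x) h = ip f h - ip g h.
Proof. by move=> Lf Lg Lh; rewrite innerDl ?innerNl//; exact: in_L2N. Qed.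

Lemma innerDr f g h : L2 f -> L2 g -> L2 h ->
  ip h (fun x => f x + g x) = ip h f + ip h g.
Proof. by move=> *; rewrite innerC innerDl// !(innerC h). Qed.

Lemma innerZr (a : R) f h : L2 f -> L2 h -> ip h (fun x => a * f x) = a * ip h f.
Proof. by move=> *; rewrite innerC innerZl// (innerC h). Qed.

Lemma innerBr f g h : L2 f -> L2 g -> L2 h ->
  ip h (fun x => f x - g x) = ip h f - ip h g.
Proof. by move=> *; rewrite innerC innerBl// !(innerC h). Qed.

Lemma inner0l f : ip (fun=> 0) f = 0.
Proof.
transitivity (\int[mu]_(x in D) (0 : R))%R; last by rewrite Rintegral_cst// mul0r.
by apply: eq_Rintegral => x _; rewrite mul0r.
Qed.

Lemma inner0r f : ip f (fun=> 0) = 0.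
Proof. by rewrite innerC inner0l. Qed.

Lemma inner_ge0 f : 0 <= ip f f.
Proof. by apply: Rintegral_ge0 => x _; rewrite -expr2 sqr_ge0. Qed.

Lemma norm2_ge0 f : 0 <= nm f. Proof. exact: sqrtr_ge0. Qed.

Lemma norm2_sqr f : nm f ^+ 2 = ip f f.
Proof. by rewrite sqr_sqrtr// inner_ge0. Qed.

Lemma norm2_0 : nm (fun=> 0) = 0.
Proof. by rewrite /norm2 inner0l sqrtr0. Qed.

Lemma ae_eq_Rintegral (F G : X -> R) : measurable_fun D F -> measurable_fun D G ->
  {ae mu, forall x, D x -> F x = G x} ->
  (\int[mu]_(x in D) F x = \int[mu]_(x in D) G x)%R.
Proof.
move=> mF mG FG; rewrite /Rintegral; congr fine; apply: ae_eq_integral => //.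
- exact/measurable_EFinP.
- exact/measurable_EFinP.
- by apply: filterS FG => x FGx Dx /=; rewrite FGx.
Qed.

Lemma eq_inner f f' g g' : (forall x, D x -> f x = f' x) ->
  (forall x, D x -> g x = g' x) -> ip f g = ip f' g'.
Proof.
move=> ff gg; apply: eq_Rintegral => x; rewrite inE => Dx.
by rewrite ff ?gg.
Qed.

Lemma ae_eq_inner f f' g g' : measurable_fun D f -> measurable_fun D f' ->
  measurable_fun D g -> measurable_fun D g' ->
  {ae mu, forall x, D x -> f x = f' x} -> {ae mu, forall x, D x -> g x = g' x} ->
  ip f g = ip f' g'.
Proof.
move=> mf mf' mg mg' ff gg; apply: ae_eq_Rintegral; try exact: measurable_funM.
by apply: filterS2 ff gg => x ff gg Dx; rewrite ff// gg.
Qed.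

Lemma ae_eq_norm2 f g : measurable_fun D f -> measurable_fun D g ->
  {ae mu, forall x, D x -> f x = g x} -> nm f = nm g.
Proof. by move=> mf mg fg; rewrite /norm2; congr Num.sqrt; exact: ae_eq_inner. Qed.

Lemma eq_norm2 f g : (forall x, D x -> f x = g x) -> nm f = nm g.
Proof. by move=> fg; rewrite /norm2; congr Num.sqrt; exact: eq_inner. Qed.

Lemma norm2N f : nm (fun x => - f x) = nm f.
Proof.
rewrite /norm2; congr Num.sqrt; apply: eq_Rintegral => x _.
by rewrite mulrNN.
Qed.

Lemma norm2_distC f g : nm (fun x => f x - g x) = nm (fun x => g x - f x).
Proof. by rewrite -norm2N; apply: eq_norm2 => x _; rewrite opprB. Qed.

Lemma norm2Z (a : R) f : L2 f -> nm (fun x => a * f x) = `|a| * nm f.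
Proof.
move=> Lf; rewrite /norm2 innerZl// ?innerZr//; last exact: in_L2Z.
by rewrite mulrA -expr2 sqrtrM ?sqr_ge0// sqrtr_sqr.
Qed.

(** The squared norm of f - t g is a nonnegative quadratic polynomial in t, evaluated at its vertex.
    If g has norm zero the polynomial is affine and must be constant. *)
Lemma inner_CS_sqr f g : L2 f -> L2 g -> ip f g ^+ 2 <= ip f f * ip g g.
Proof.
move=> Lf Lg.
have H t : 0 <= ip f f - 2 * t * ip f g + t ^+ 2 * ip g g.
  have Lt : L2 (fun x => t * g x) by exact: in_L2Z.
  have := inner_ge0 (fun x => f x - t * g x).
  rewrite innerBl//; last exact: in_L2B.
  rewrite !innerBr// !innerZl// !innerZr// (innerC g f).
  by congr (_ <= _); ring.
have [g0|g0] := eqVneq (ip g g) 0; last first.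
  have gp : 0 < ip g g by rewrite lt_def g0 inner_ge0.
  have := H (ip f g / ip g g).
  rewrite -subr_ge0 => h.
  have := mulr_ge0 (ltW gp) h.
  suff -> : ip g g * (ip f f - 2 * (ip f g / ip g g) * ip f g +
    (ip f g / ip g g) ^+ 2 * ip g g - 0) = ip f f * ip g g - ip f g ^+ 2.
    by rewrite subr_ge0.
  by field.
rewrite g0 mulr0.
suff -> : ip f g = 0 by rewrite expr0n.
apply/eqP/negP => /negP fg0.
(* At this t the affine polynomial takes the value -1. *)
have := H ((ip f f + 1) / (2 * ip f g)).
rewrite g0 mulr0 addr0.
have -> : 2 * ((ip f f + 1) / (2 * ip f g)) * ip f g = ip f f + 1 by field.
by lra.
Qed.

Lemma inner_CS f g : L2 f -> L2 g -> `|ip f g| <= nm f * nm g.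
Proof.
move=> Lf Lg; rewrite -(@ler_pXn2r _ 2)// ?nnegrE ?mulr_ge0 ?norm2_ge0//.
by rewrite exprMn !norm2_sqr real_normK ?num_real// inner_CS_sqr.
Qed.

Lemma norm2D f g : L2 f -> L2 g -> nm (fun x => f x + g x) <= nm f + nm g.
Proof.
move=> Lf Lg; rewrite -(@ler_pXn2r _ 2)// ?nnegrE ?addr_ge0 ?norm2_ge0//.
rewrite norm2_sqr innerDl//; last exact: in_L2D.
rewrite !innerDr// (innerC g f) sqrrD !norm2_sqr.
have := le_trans (ler_norm _) (inner_CS Lf Lg); lra.
Qed.

Lemma norm2_triangle f g h : L2 f -> L2 g -> L2 h ->
  nm (fun x => f x - h x) <= nm (fun x => f x - g x) + nm (fun x => g x - h x).
Proof.
move=> Lf Lg Lh; apply: le_trans (norm2D (in_L2B Lf Lg) (in_L2B Lg Lh)).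
by rewrite le_eqVlt; apply/orP; left; apply/eqP/eq_norm2 => x _; ring.
Qed.

Lemma norm2_le_diff f g : L2 f -> L2 g -> nm f <= nm g + nm (fun x => f x - g x).
Proof.
move=> Lf Lg; apply: le_trans (norm2D Lg (in_L2B Lf Lg)).
by rewrite le_eqVlt; apply/orP; left; apply/eqP/eq_norm2 => x _; ring.
Qed.

Lemma norm2_dist f g : L2 f -> L2 g -> `|nm f - nm g| <= nm (fun x => f x - g x).
Proof.
move=> Lf Lg; have := norm2_le_diff Lf Lg; have := norm2_le_diff Lg Lf.
by rewrite (norm2_distC g f) ler_norml; lra.
Qed.

Lemma integral_sqr_norm2 f : L2 f ->
  (\int[mu]_(x in D) ((f x) ^+ 2)%:E = (nm f ^+ 2)%:E)%E.
Proof.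
move=> Lf; rewrite norm2_sqr /inner /Rintegral fineK//.
by apply: integrable_fin_num => //; exact: in_L2_sqr_integrable.
Qed.

Lemma norm2_eq0 f : L2 f -> nm f = 0 -> {ae mu, forall x, D x -> f x = 0}.
Proof.
move=> Lf f0; have := integral_sqr_norm2 Lf; rewrite f0 expr0n/= => E.
have mf2 : measurable_fun D (fun x => ((f x) ^+ 2)%:E).
  exact/measurable_EFinP/measurable_funX/in_L2_measurable.
have : (\int[mu]_(x in D) `|((f x) ^+ 2)%:E| = 0)%E.
  apply: etrans E; apply: eq_integral => x _.
  by rewrite gee0_abs// lee_fin sqr_ge0.
move/(ae_eq_integral_abs mu mD mf2); apply: filterS => x H /H/= [].
by move/eqP; rewrite sqrf_eq0 => /eqP.
Qed.

Lemma norm2_le_ae f g : L2 f -> L2 g ->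
  {ae mu, forall x, D x -> `|f x| <= `|g x|} -> nm f <= nm g.
Proof.
move=> Lf Lg fg; rewrite -(@ler_pXn2r _ 2)// ?nnegrE ?norm2_ge0//.
rewrite -lee_fin -!integral_sqr_norm2//; apply: ae_ge0_le_integral => //.
- by move=> x _; rewrite lee_fin sqr_ge0.
- exact/measurable_EFinP/measurable_funX/in_L2_measurable.
- by move=> x _; rewrite lee_fin sqr_ge0.
- exact/measurable_EFinP/measurable_funX/in_L2_measurable.
- apply: filterS fg => x fgx /fgx le_fg; rewrite lee_fin.
  by rewrite -[f x ^+ 2]real_normK ?num_real// -[g x ^+ 2]real_normK ?num_real// lerXn2r// nnegrE.
Qed.

(* Complete along fast Cauchy sequences; the limsup makes the pointwise limit
   measurable although the Borel measure at hand need not be complete. *)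
Section FastCauchy.
Variables (u : nat -> X -> R) (K : R).
Hypothesis Lu : forall n, L2 (u n).
Hypothesis uK : forall n, nm (fun x => u n.+1 x - u n x) <= K * (2^-1) ^+ n.

Definition plim (v : nat -> X -> R) (x : X) : R :=
  fine (limn_esup (fun n => (v n x)%:E)).

(** Pointwise total variation of the sequence up to index n; where it stays bounded, the sequence
    converges. *)
Let v (n : nat) (x : X) : R := \sum_(k < n) `|u k.+1 x - u k x|.

Lemma Lv n : L2 (v n).
Proof.
apply: in_L2_sum => k; apply: in_L2_dominated (in_L2B (Lu k.+1) (Lu k)) _.
  by apply: measurableT_comp => //; apply: measurable_funB; exact: in_L2_measurable.
by apply/nearW => x _; rewrite normr_id.
Qed.

Lemma K0 : 0 <= K.
Proof. by have := le_trans (norm2_ge0 _) (uK 0); rewrite expr0 mulr1. Qed.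

Lemma vK n : nm (v n) <= 2 * K.
Proof.
(* The exact partial sum of the geometric series makes the induction close; the bare bound 2 K would
   not. *)
suff : nm (v n) <= 2 * K * (1 - (2^-1) ^+ n).
  have e0 : 0 <= (2^-1 : R) ^+ n by rewrite exprn_ge0// invr_ge0.
  have := mulr_ge0 K0 e0; lra.
elim: n => [|n IH].
  rewrite (eq_norm2 (g := fun=> 0)) ?norm2_0 ?expr0 ?subrr ?mulr0//.
  by move=> x _; rewrite /v big_ord0.
have -> : nm (v n.+1) = nm (fun x => v n x + `|u n.+1 x - u n x|).
  by apply: eq_norm2 => x _; rewrite /v big_ord_recr.
have Ln : L2 (fun x => `|u n.+1 x - u n x|).
  apply: in_L2_dominated (in_L2B (Lu n.+1) (Lu n)) _.
    by apply: measurableT_comp => //; apply: measurable_funB; exact: in_L2_measurable.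
  by apply/nearW => x _; rewrite normr_id.
apply: le_trans (norm2D (Lv n) Ln) _.
have : nm (fun x => `|u n.+1 x - u n x|) <= K * (2^-1) ^+ n.
  apply: le_trans (uK n); apply: norm2_le_ae => //; first exact: in_L2B.
  by apply/nearW => x _; rewrite normr_id.
rewrite exprS; move: IH; set e := _ ^+ n => IH IH2.
by rewrite (le_trans (lerD IH IH2))// le_eqVlt; apply/orP; left; apply/eqP; field.
Qed.

(** Monotone convergence for the squares of the [v n] bounds the integral of their limit by (2 K)^2.
    The limit is thus finite almost everywhere, and there the telescoping series of increments
    converges absolutely. *)
Lemma vcvg : {ae mu, forall x, D x -> cvgn (fun n => u n x)}.
Proof.
have mv2 n : measurable_fun D (fun x => (v n x ^+ 2)%:E).
  exact/measurable_EFinP/measurable_funX/in_L2_measurable/Lv.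
have vnd x : {homo v ^~ x : n m / (n <= m)%N >-> n <= m}.
  apply/nondecreasing_seqP => n; rewrite /v big_ord_recr/= lerDl.
  exact: normr_ge0.
have v0 n x : 0 <= v n x by apply: sumr_ge0 => *.
have nd2 x : D x -> {homo (fun n => (v n x ^+ 2)%:E) : n m / (n <= m)%N >-> (n <= m)%E}.
  by move=> Dx n m nm; rewrite lee_fin lerXn2r ?nnegrE//; exact: vnd.
have E := @monotone_convergence _ _ _ mu D mD (fun n x => (v n x ^+ 2)%:E) mv2
  (fun n x _ => ltac:(by rewrite lee_fin sqr_ge0)) nd2.
have lim_lty : (\int[mu]_(x in D) limn (fun n => (v n x ^+ 2)%:E) < +oo)%E.
  rewrite E; apply: le_lt_trans (ltry ((2 * K) ^+ 2)); apply: lime_le.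
    apply: ereal_nondecreasing_is_cvgn => n m nm; apply: ge0_le_integral => //.
    - by move=> x _; rewrite lee_fin sqr_ge0.
    - by move=> x Dx; exact: nd2.
  apply: nearW => n; rewrite integral_sqr_norm2; last exact: Lv.
  rewrite lee_fin lerXn2r ?nnegrE ?norm2_ge0//; last exact: vK.
  by rewrite mulr_ge0// K0.
have : mu.-integrable D (fun x => limn (fun n => (v n x ^+ 2)%:E)).
  apply/integrableP; split.
    apply: (emeasurable_fun_cvg (fun n x => (v n x ^+ 2)%:E)) => // x Dx.
    by apply: ereal_nondecreasing_is_cvgn; exact: nd2.
  apply: le_lt_trans lim_lty; rewrite le_eqVlt; apply/orP; left; apply/eqP.
  apply: eq_integral => x; rewrite inE => Dx; rewrite gee0_abs//.
  apply: lime_ge; first by apply: ereal_nondecreasing_is_cvgn; exact: nd2.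
  by apply: nearW => n; rewrite lee_fin sqr_ge0.
move/(integrable_ae mD); apply: filterS => x fx Dx.
have lfin := fx Dx.
have bnd n : v n x ^+ 2 <= fine (limn (fun n => (v n x ^+ 2)%:E)).
  rewrite -lee_fin fineK//; apply: lime_ge.
    by apply: ereal_nondecreasing_is_cvgn; exact: nd2.
  by exists n => // m /= nm; exact: nd2.
have vbnd n : v n x <= 1 + fine (limn (fun n => (v n x ^+ 2)%:E)).
  have := bnd n; have := sqr_ge0 (v n x - 1); set l := fine _; lra || nra.
have ncv : cvgn [normed series (fun k => u k.+1 x - u k x)].
  rewrite (_ : [normed series _] = v ^~ x); last first.
    by apply/funext => n; rewrite /v -(big_mkord xpredT (fun k => `|u k.+1 x - u k x|)).
  apply: nondecreasing_is_cvgn; first exact: vnd.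
  by exists (1 + fine (limn (fun n => (v n x ^+ 2)%:E))) => _ [n _ <-].
have := normed_cvg ncv; rewrite (_ : series _ = fun n => u n x - u 0%N x); last first.
  by apply/funext => n; rewrite seriesEnat/= telescope_sumr.
move=> /cvg_ex[l Hl]; apply/cvg_ex; exists (l + u 0%N x).
have -> : (fun n => u n x) = (fun n => (u n x - u 0%N x) + u 0%N x).
  by apply/funext => n; rewrite subrK.
by apply: cvgD => //; exact: cvg_cst.
Qed.

Lemma plim_cvg_ae : {ae mu, forall x, D x -> u n x @[n --> \oo] --> plim u x}.
Proof.
apply: filterS vcvg => x cx /cx /cvg_ex[l Hl].
rewrite /plim (_ : limn_esup _ = l%:E)//.
have : (fun n => (u n x)%:E) @ \oo --> l%:E.
  by apply/cvg_EFin; [exact: nearW|exact: Hl].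
by move/cvg_limn_einf_sup => [].
Qed.

Lemma uK2 n k : nm (fun x => u (n + k)%N x - u n x) <= 2 * K * (2^-1) ^+ n.
Proof.
suff : nm (fun x => u (n + k)%N x - u n x) <= 2 * K * (2^-1) ^+ n * (1 - (2^-1) ^+ k).
  have e0 : 0 <= (2^-1 : R) ^+ n by rewrite exprn_ge0// invr_ge0.
  have f0 : 0 <= (2^-1 : R) ^+ k by rewrite exprn_ge0// invr_ge0.
  have := mulr_ge0 (mulr_ge0 K0 e0) f0; lra.
elim: k => [|k IH].
  rewrite (eq_norm2 (g := fun=> 0)) ?norm2_0 ?expr0 ?subrr ?mulr0//.
  by move=> x _; rewrite addn0 subrr.
apply: le_trans (norm2_triangle (Lu _) (Lu (n + k)%N) (Lu _)) _.
have := uK (n + k)%N; rewrite addnS => /lerD /(_ IH) /le_trans; apply.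
by rewrite exprS exprD le_eqVlt; apply/orP; left; apply/eqP; field.
Qed.

Lemma measurable_plim : measurable_fun D (plim u).
Proof.
apply: (@measurableT_comp _ _ _ _ _ _ fine) => //.
apply: measurable_fun_limn_esup => n.
exact/measurable_EFinP/in_L2_measurable.
Qed.

(** Fatou's lemma for the squares of u (m + k) - u m, which tend almost everywhere to the square of
    plim u - u m as k grows. The same estimate gives the membership in L2. *)
Lemma plim_L2 n : L2 (plim u) /\ nm (fun x => plim u x - u n x) <= 2 * K * (2^-1) ^+ n.
Proof.
have H m : (\int[mu]_(x in D) ((plim u x - u m x) ^+ 2)%:E <=
      ((2 * K * (2^-1) ^+ m) ^+ 2)%:E)%E.
  pose F k x := ((u (m + k)%N x - u m x) ^+ 2)%:E.
  have mF k : measurable_fun D (F k).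
    by apply/measurable_EFinP/measurable_funX/measurable_funB; exact: in_L2_measurable.
  have F0 k x : D x -> (0 <= F k x)%E by rewrite lee_fin sqr_ge0.
  have fat := fatou mu mD mF F0.
  apply: le_trans (_ : _ <= \int[mu]_(x in D) limn_einf (F ^~ x))%E _.
    rewrite le_eqVlt; apply/orP; left; apply/eqP.
    apply: ge0_ae_eq_integral => //.
    - apply/measurable_EFinP/measurable_funX/measurable_funB.
        exact: measurable_plim.
      exact: in_L2_measurable.
    - under eq_fun do rewrite /limn_einf.
      apply: measurableT_comp => //; apply: measurable_fun_limn_esup => k /=.
      apply/measurable_EFinP/measurable_funN/measurable_funX/measurable_funB; exact: in_L2_measurable.
    - by move=> x _; rewrite lee_fin sqr_ge0.
    - move=> x Dx; have : (0 <= limn_einf (fun=> 0%E : \bar R))%E.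
        by rewrite (cvg_limn_einf_sup (cvg_cst 0%E)).1.
      move/le_trans; apply; rewrite !limn_einf_lim.
      apply: lee_lim; [exact: is_cvg_einfs|exact: is_cvg_einfs|].
      apply: nearW => k; apply: le_ereal_inf_tmp => _ [i ki <-].
      apply: le_trans (F0 i x Dx); apply: ereal_inf_lbound.
      by exists i.
    - apply: filterS plim_cvg_ae => x H Dx.
      have {}H := H Dx.
      have : F ^~ x @ \oo --> ((plim u x - u m x) ^+ 2)%:E.
        apply/cvg_EFin; first exact: nearW.
        rewrite /F /comp /=.
        under eq_fun do rewrite expr2.
        rewrite expr2.
        have H2 : (fun k => u (m + k)%N x - u m x) @ \oo --> plim u x - u m x.
          apply: cvgB; last exact: cvg_cst.
          under eq_fun do rewrite addnC.
          by move: H; rewrite -(cvg_shiftn m).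
        exact: cvgM.
      by move/cvg_limn_einf_sup => [].
  apply: le_trans fat _.
  have -> : ((2 * K * (2^-1) ^+ m) ^+ 2)%:E =
     limn_einf (fun=> ((2 * K * (2^-1) ^+ m) ^+ 2)%:E).
    by rewrite (cvg_limn_einf_sup (cvg_cst _)).1.
  rewrite !limn_einf_lim.
  apply: lee_lim; [exact: is_cvg_einfs|exact: is_cvg_einfs|].
  apply: nearW => k; apply: le_ereal_inf_tmp => _ [i ki <-].
  apply: le_trans (_ : (\int[mu]_(x in D) F i x <= _)%E).
    by apply: ereal_inf_lbound; exists i.
  rewrite integral_sqr_norm2; last exact: in_L2B.
  rewrite lee_fin lerXn2r ?nnegrE ?norm2_ge0//; last exact: uK2.
  exact: (le_trans (norm2_ge0 _) (uK2 m 0)).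
have Ld m : L2 (fun x => plim u x - u m x).
  apply/in_L2P; split.
    apply: measurable_funB; first exact: measurable_plim.
    exact: in_L2_measurable.
  exact: le_lt_trans (H m) (ltry _).
split.
  have := in_L2D (Ld n) (Lu n).
  by under eq_fun do rewrite subrK.
rewrite -(@ler_pXn2r _ 2)// ?nnegrE ?norm2_ge0//.
  by rewrite -lee_fin -integral_sqr_norm2//; exact: H.
exact: (le_trans (norm2_ge0 _) (uK2 n 0)).
Qed.

End FastCauchy.

End SquareIntegrable.

(** * Smooth functions and integration by slices in the plane *)

Section PlaneTopology.
Variable R : realType.
Local Notation R2 := (R * R)%type.
Local Notation mR2 := (measurableTypeR R * measurableTypeR R)%type.
Implicit Types (D : set R2) (phi psi : R2 -> R).

(** Measurability refers to the product sigma algebra. An open set is the countable union of those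
    squares with rational centre and side 2 / (k + 1) that it contains. *)
Lemma open_measurable_plane (U : set R2) : open U -> measurable (U : set mR2).
Proof.
move=> oU.
pose box (q : rat * rat * nat) : set R2 :=
  ball (ratr q.1.1 : R) q.2.+1%:R^-1 `*` ball (ratr q.1.2 : R) q.2.+1%:R^-1.
pose F q := if pselect (box q `<=` U) then box q else set0.
have -> : U = \bigcup_q F q.
  apply/seteqP; split; last first.
    by move=> x [q _]; rewrite /F; case: pselect => // qU /qU.
  move=> x Ux; have [e /= e0 xe] : nbhs_ball x U by apply/nbhs_ballP; exact: oU.
  have [n ne] : exists n : nat, n.+1%:R^-1 < e / 2 :> R.
    have [n _ Hn] := near_infty_natSinv_lt (PosNum (divr_gt0 e0 (ltr0n _ 2))).
    by exists n; apply: (Hn n) => /=.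
  have n0 : 0 < n.+1%:R^-1 :> R by rewrite invr_gt0.
  set d := n.+1%:R^-1 : R in ne n0 *.
  have near_rat (y : R) : exists q : rat, `|ratr q - y| < d.
    have [|q /[!in_itv]/= /andP[q1 q2]] := @rat_in_itvoo R (y - d) y.
      by rewrite ltrBlDr ltrDl.
    by exists q; rewrite ltr_norml; apply/andP; split; lra.
  have [q1 xq1] := near_rat x.1; have [q2 xq2] := near_rat x.2.
  exists (q1, q2, n) => //; rewrite /F; case: pselect => /= [_|[]]; first by split.
  move=> y [/= y1 y2]; apply: xe.
  move: y1 y2; rewrite /ball/= -/d => y1 y2.
  move: xq1 xq2 y1 y2 ne; rewrite !ltr_norml => /andP[? ?] /andP[? ?] /andP[? ?] /andP[? ?] ?.
  by split; rewrite /= /ball/= ltr_norml; apply/andP; split; lra.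
apply: countable_bigcupT_measurable; first exact: countableP.
move=> q; rewrite /F; case: pselect => _ //=.
by apply: measurableX; exact: measurable_ball.
Qed.

Lemma closed_measurable_plane (A : set R2) : closed A -> measurable (A : set mR2).
Proof.
by move=> cA; rewrite -(setCK A); apply: measurableC; apply: open_measurable_plane;
  rewrite openC.
Qed.

Lemma continuous_measurable_plane phi : continuous phi ->
  measurable_fun setT (phi : mR2 -> R).
Proof.
move=> cphi; apply: (measurability _ (RGenOpens.measurableE R)).
move=> _ [_ [a [b ->]] <-]; rewrite setTI; apply: open_measurable_plane.
by apply: open_comp => //= x _; exact: cphi.
Qed.

Lemma bounded_set_box D : bounded_set D ->
  exists2 B : R, 0 < B & forall x, D x -> `|x.1| <= B /\ `|x.2| <= B.
Proof.
move=> [M [_ HM]]; exists (`|M| + 1); first by rewrite ltr_wpDl.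
move=> x Dx; have : `|x| <= `|M| + 1.
  by apply: HM Dx; rewrite (le_lt_trans (ler_norm M))// ltrDl.
by rewrite prod_normE/= ge_max => /andP[].
Qed.

Lemma compact_box (B : R) : compact ([set` `[-B, B]] `*` [set` `[-B, B]] : set R2).
Proof. by apply: compact_setX; exact: segment_compact. Qed.

Lemma continuous_bounded_on D phi : bounded_set D -> continuous phi ->
  exists2 M : R, 0 < M & forall x, D x -> `|phi x| <= M.
Proof.
move=> /bounded_set_box[B B0 HB] cphi.
have [||c _ Hc] := @compact_EVT_max R2 R (fun x => `|phi x|)
    ([set` `[-B, B]] `*` [set` `[-B, B]]) _ (@compact_box B).
- by exists (0, 0); split; rewrite /= in_itv/=; lra.
- apply: continuous_subspaceT => x; apply: continuous_comp; first exact: cphi.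
  exact: norm_continuous.
exists (`|phi c| + 1); first by rewrite ltr_wpDl.
move=> x /HB [x1 x2]; apply: le_trans (Hc x _) _; last by rewrite lerDl.
rewrite inE; split; rewrite /= in_itv/=; first by rewrite -ler_norml.
by rewrite -ler_norml.
Qed.

Lemma area_box (a b c e : R) : a <= b -> c <= e ->
  area R ([set` `[a, b]] `*` [set` `[c, e]]) = ((b - a) * (e - c))%:E.
Proof.
move=> ab ce.
have -> : (area R (`[a, b] `*` `[c, e]) = lebesgue_measure `[a, b] * lebesgue_measure `[c, e])%E.
  exact: product_measure1E.
by rewrite !lebesgue_measure_itv/= !lte_fin; case: ltgtP ab => // ab _; case: ltgtP ce => // ce _;
  rewrite ?EFinB -?EFinB -?EFinM ?ab ?ce ?subrr ?mul0r ?mulr0// ?mule0 ?mul0e.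
Qed.

Lemma area_bounded D : measurable (D : set mR2) -> bounded_set D ->
  (area R D < +oo)%E.
Proof.
move=> mD /bounded_set_box[B B0 HB].
apply: (@le_lt_trans _ _ (area R ([set` `[-B, B]] `*` [set` `[-B, B]]))).
  apply: le_measure; rewrite ?inE//; first exact: measurableX.
  by move=> x /HB[x1 x2]; split; rewrite /= in_itv/= -ler_norml.
by rewrite area_box ?ltry//; lra.
Qed.

Lemma continuous_in_L2 D phi : measurable (D : set mR2) -> bounded_set D ->
  continuous phi -> in_L2 (area R) D phi.
Proof.
move=> mD bD cphi; have [M M0 HM] := continuous_bounded_on bD cphi.
apply/in_L2P => //; split.
  by apply: measurable_funTS; exact: continuous_measurable_plane.
apply: (@le_lt_trans _ _ (\int[area R]_(x in D) (cst (M ^+ 2)%:E x))%E).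
  apply: ge0_le_integral => //=.
  - by move=> x _; rewrite lee_fin sqr_ge0.
  - apply/measurable_EFinP/measurable_funX/measurable_funTS.
    exact: continuous_measurable_plane.
  - move=> x Dx; rewrite lee_fin -real_normK ?num_real//.
    by rewrite lerXn2r ?nnegrE//; [exact: ltW|exact: HM].
by rewrite integral_cst// lte_mul_pinfty// ?lee_fin ?sqr_ge0// area_bounded.
Qed.

Lemma continuous_in_L2_I01 (f : R -> R) : continuous f ->
  in_L2 (length R) [set` `[0, 1]] f.
Proof.
move=> cf; have mf : measurable_fun setT (f : measurableTypeR R -> R).
  exact: continuous_measurable_fun.
have [||c _ Hc] := @compact_EVT_max R R (fun x => `|f x|) [set` `[0, 1]] _ (@segment_compact _ _ _).
- by exists 0; rewrite /= in_itv/=; lra.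
- apply: continuous_subspaceT => x; apply: continuous_comp; first exact: cf.
  exact: norm_continuous.
apply/in_L2P => //; split; first exact: measurable_funTS.
apply: (@le_lt_trans _ _ (\int[length R]_(x in [set` `[0%R, 1%R]]) (cst (`|f c| ^+ 2)%:E x))%E).
  apply: ge0_le_integral => //=.
  - by move=> x _; rewrite lee_fin sqr_ge0.
  - by apply/measurable_EFinP/measurable_funX/measurable_funTS.
  - move=> x Dx; rewrite lee_fin -[f x ^+ 2]real_normK ?num_real//.
    by rewrite lerXn2r ?nnegrE//; apply: Hc; rewrite inE.
rewrite integral_cst//= /length lebesgue_measure_itv/= lte_fin ltr01.
by rewrite -EFinB -EFinM ltry.
Qed.

End PlaneTopology.

(** * Functions with continuous first partial derivatives *)

Section Smoothness.
Variable R : realType.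
Local Notation R2 := (R * R)%type.
Local Notation e_ := (basis_vec R).
Implicit Types (phi psi : R2 -> R) (v : R2) (s : seq 'I_2).

(* Everything done with smooth functions uses only this much regularity. *)
Definition C1 phi : Prop :=
  continuous phi /\
  forall i, (forall x, derivable phi x (e_ i)) /\ continuous (partials [:: i] phi).

Lemma smooth_C1 phi : smooth phi -> C1 phi.
Proof.
move=> sphi; split; first by have [] := sphi [::].
move=> i; split; first by have [_ /(_ _ i)] := sphi [::].
by have [] := sphi [:: i].
Qed.

Lemma partials_cat s s' phi : partials s (partials s' phi) = partials (s ++ s') phi.
Proof. by rewrite /partials foldr_cat. Qed.

Lemma smooth_partials s phi : smooth phi -> smooth (partials s phi).
Proof. by move=> sphi s'; rewrite partials_cat. Qed.

Lemma partials_lincomb (a b : R) phi psi : smooth phi -> smooth psi ->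
  forall s, partials s (fun x => a * phi x + b * psi x) =
            (fun x => a * partials s phi x + b * partials s psi x).
Proof.
move=> sphi spsi; elim => [//|i s IH].
apply/funext => x; rewrite /= -/(partials s) IH.
have [_ dphi] := sphi s; have [_ dpsi] := spsi s.
have -> : (fun y => a * partials s phi y + b * partials s psi y) =
  (a *: partials s phi) + (b *: partials s psi) by [].
by rewrite deriveD ?deriveZ//; apply: derivableZ.
Qed.

Lemma smooth_lincomb (a b : R) phi psi : smooth phi -> smooth psi ->
  smooth (fun x => a * phi x + b * psi x).
Proof.
move=> sphi spsi s; rewrite partials_lincomb//.
have [cphi dphi] := sphi s; have [cpsi dpsi] := spsi s; split.
  move=> x; apply: cvgD; apply: cvgM; try exact: cvg_cst.
    exact: cphi.
  exact: cpsi.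
move=> x i.
have -> : (fun y => a * partials s phi y + b * partials s psi y) =
  (a *: partials s phi) + (b *: partials s psi) by [].
by apply: derivableD; apply: derivableZ.
Qed.

Lemma smooth0 : smooth (fun=> 0 : R).
Proof.
have E s : partials s (fun=> 0 : R) = (fun=> 0).
  elim: s => [//|i s IH]; rewrite /= -/(partials s) IH; apply/funext => x.
  exact: derive_cst.
by move=> s; rewrite E; split; [exact: cst_continuous|move=> *; exact: derivable_cst].
Qed.

Lemma C1M phi psi : C1 phi -> C1 psi -> C1 (fun x => phi x * psi x).
Proof.
move=> [cphi dphi] [cpsi dpsi]; split; first by move=> x; apply: cvgM; [exact: cphi|exact: cpsi].
move=> i; have [d1 c1] := dphi i; have [d2 c2] := dpsi i; split.
  by move=> x; apply: derivableM.
have -> : partials [:: i] (fun x => phi x * psi x) =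
  (fun x => phi x * partials [:: i] psi x + psi x * partials [:: i] phi x).
  by apply/funext => x; rewrite /= (deriveM (d1 x) (d2 x)).
move=> x; apply: cvgD; apply: cvgM; [exact: cphi|exact: c2|exact: cpsi|exact: c1].
Qed.

Lemma partialM phi psi i x : C1 phi -> C1 psi ->
  partials [:: i] (fun x => phi x * psi x) x =
  phi x * partials [:: i] psi x + psi x * partials [:: i] phi x.
Proof.
move=> [_ dphi] [_ dpsi]; have [d1 _] := dphi i; have [d2 _] := dpsi i.
by rewrite /= (deriveM (d1 x) (d2 x)).
Qed.

Lemma is_derive_line phi (x v : R2) t : derivable phi (x + t *: v) v ->
  is_derive t 1 (fun u => phi (x + u *: v)) ('D_v phi (x + t *: v)).
Proof.
move=> d.
have E : (fun h => h^-1 *: (((fun u => phi (x + u *: v)) \o shift t) (h *: 1) - phi (x + t *: v)))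
   = (fun h => h^-1 *: ((phi \o shift (x + t *: v)) (h *: v) - phi (x + t *: v))).
  apply/funext => h /=; congr (_ *: (phi _ - _)).
  by rewrite [h *: 1]mulr1 scalerDl addrCA addrA.
split; first by rewrite /derivable E.
by rewrite /derive E.
Qed.

Lemma C1_fst : C1 (fun x : R2 => x.1).
Proof.
split; first by move=> x; exact: cvg_fst.
move=> i.
have H (x : R2) : is_derive x (e_ i) (fun x : R2 => x.1) (e_ i).1.
  have E : (fun h => h^-1 *: (((fun x : R2 => x.1) \o shift x) (h *: e_ i) - x.1)) @ 0^' --> (e_ i).1.
    apply/cvgrPdist_le => e e0; near=> h.
    rewrite /= addrK /GRing.scale/= mulrA mulVf ?mul1r ?subrr ?normr0 ?ltW//.
    by near: h; exact: nbhs_dnbhs_neq.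
  by split; [apply/cvg_ex; exists (e_ i).1|apply/cvg_lim].
split; first by move=> x; have [] := H x.
have -> : partials [:: i] (fun x : R2 => x.1) = (fun=> (e_ i).1).
  by apply/funext => x; have [_ <-] := H x.
exact: cst_continuous.
Unshelve. all: by end_near.
Qed.

Lemma mean_value_between (g g' : R -> R) (a b : R) :
  (forall x : R, is_derive x 1 g (g' x)) ->
  exists c, [/\ `|c - a| <= `|b - a| & g b - g a = g' c * (b - a)].
Proof.
move=> dg; have cg : continuous g.
  move=> x; apply: differentiable_continuous; apply/derivable1_diffP.
  by have [] := dg x.
case: (leP a b) => ab.
  have [|c /[!in_itv]/= /andP[c1 c2] E] := @MVT_segment R g g' a b ab (fun x _ => dg x).
    exact: continuous_subspaceT.
  by exists c; split => //; rewrite !ger0_norm ?subr_ge0// lerB.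
have [|c /[!in_itv]/= /andP[c1 c2] E] := @MVT_segment R g g' b a (ltW ab) (fun x _ => dg x).
  exact: continuous_subspaceT.
exists c; split; last by lra.
by rewrite !ler0_norm ?subr_le0// ?(ltW ab)//; lra.
Qed.

Lemma basis_vec0 : e_ 0 = (1, 0).
Proof. by rewrite /basis_vec; congr pair. Qed.

Lemma basis_vec1 : e_ 1 = (0, 1).
Proof. by rewrite /basis_vec; congr pair. Qed.

Lemma is_derive_slice0 phi (u y : R) : C1 phi ->
  is_derive u 1 (fun w => phi (w, y)) (partials [:: 0] phi (u, y)).
Proof.
move=> [_ dphi]; have [d0 _] := dphi 0.
have E (w : R) : (w, y) = (0, y) + w *: e_ 0.
  rewrite basis_vec0 (_ : _ + _ = (0 + w * 1, y + w * 0))//.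
  by rewrite mulr1 mulr0 add0r addr0.
rewrite (_ : (fun w => _) = (fun w => phi ((0, y) + w *: e_ 0))); last first.
  by apply/funext => w; rewrite -E.
by rewrite {1}E; exact: is_derive_line.
Qed.

Lemma is_derive_slice1 phi (x u : R) : C1 phi ->
  is_derive u 1 (fun w => phi (x, w)) (partials [:: 1] phi (x, u)).
Proof.
move=> [_ dphi]; have [d0 _] := dphi 1.
have E (w : R) : (x, w) = (x, 0) + w *: e_ 1.
  rewrite basis_vec1 (_ : _ + _ = (x + w * 0, 0 + w * 1))//.
  by rewrite mulr1 mulr0 add0r addr0.
rewrite (_ : (fun w => _) = (fun w => phi ((x, 0) + w *: e_ 1))); last first.
  by apply/funext => w; rewrite -E.
by rewrite {1}E; exact: is_derive_line.
Qed.

(** The hypothesis only speaks of the two basis directions. The increment along v is split into a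
    horizontal and a vertical one, the mean value theorem applies to each, and continuity of the
    partial derivatives gives the limit. *)
Lemma C1_is_derive phi (x v : R2) : C1 phi ->
  is_derive x v phi (v.1 * partials [:: 0] phi x + v.2 * partials [:: 1] phi x).
Proof.
move=> Cphi; have [cphi dphi] := Cphi.
have [d0 c0] := dphi 0; have [d1 c1] := dphi 1.
have H : (fun h => h^-1 *: ((phi \o shift x) (h *: v) - phi x)) @ 0^' -->
     v.1 * partials [:: 0] phi x + v.2 * partials [:: 1] phi x.
  apply/cvgrPdist_le => e e0.
  pose e' := e / (`|v.1| + `|v.2| + 1).
  have v0 : 0 < `|v.1| + `|v.2| + 1 by rewrite ltr_wpDl// addr_ge0.
  have e'0 : 0 < e' by rewrite divr_gt0.
  move/cvgrPdist_lt: (c0 x) => /(_ _ e'0) /nbhs_ballP[r0 r00 Hr0].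
  move/cvgrPdist_lt: (c1 x) => /(_ _ e'0) /nbhs_ballP[r1 r10 Hr1].
  near=> h.
  have h0 : h != 0 by near: h; exact: nbhs_dnbhs_neq.
  have hr : `|h| * (`|v.1| + `|v.2| + 1) < Num.min r0 r1.
    rewrite -ltr_pdivlMr//; near: h; apply: dnbhs0_lt.
    by rewrite divr_gt0// lt_min r00 r10.
  have H0 (u : R) := is_derive_slice0 u (x.2 + h * v.2) Cphi.
  have H1 (u : R) := is_derive_slice1 x.1 u Cphi.
  have [a [aB Ea]] := mean_value_between x.1 (x.1 + h * v.1) H0.
  have [b [bB Eb]] := mean_value_between x.2 (x.2 + h * v.2) H1.
  have E : (phi \o shift x) (h *: v) - phi x =
     h * (v.1 * partials [:: 0] phi (a, x.2 + h * v.2) + v.2 * partials [:: 1] phi (x.1, b)).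
    have -> : (phi \o shift x) (h *: v) = phi (x.1 + h * v.1, x.2 + h * v.2).
      by rewrite /=; congr (phi _); congr (_, _); rewrite addrC.
    rewrite -(subrKA (phi (x.1, x.2 + h * v.2))) Ea.
    have -> : phi x = phi (x.1, x.2) by rewrite -surjective_pairing.
    by rewrite Eb; ring.
  rewrite E /GRing.scale/= mulrA mulVf// mul1r.
  have B0 : `|partials [:: 0] phi x - partials [:: 0] phi (a, x.2 + h * v.2)| < e'.
    apply: Hr0; rewrite /ball/=; split; rewrite /ball/=.
      rewrite distrC (le_lt_trans aB)// addrAC subrr add0r normrM.
      apply: le_lt_trans (lt_le_trans hr _); last by rewrite ge_min lexx.
      by rewrite ler_wpM2l//; have := normr_ge0 v.2; lra.
    rewrite opprD addrA subrr add0r normrN normrM.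
    apply: le_lt_trans (lt_le_trans hr _); last by rewrite ge_min lexx.
    by rewrite ler_wpM2l//; have := normr_ge0 v.1; lra.
  have B1 : `|partials [:: 1] phi x - partials [:: 1] phi (x.1, b)| < e'.
    apply: Hr1; rewrite /ball/=; split; rewrite /ball/=; first by rewrite subrr normr0.
    rewrite distrC (le_lt_trans bB)// addrAC subrr add0r normrM.
    apply: le_lt_trans (lt_le_trans hr _); last by rewrite ge_min lexx orbT.
    by rewrite ler_wpM2l//; have := normr_ge0 v.1; lra.
  rewrite opprD addrACA -!mulrBr (le_trans (ler_normD _ _))// !normrM.
  apply: (@le_trans _ _ (`|v.1| * e' + `|v.2| * e')).
    by apply: lerD; rewrite ler_wpM2l// ltW.
  have : e' * (`|v.1| + `|v.2| + 1) = e by rewrite /e' divfK// gt_eqF.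
  by move: e'0; lra.
by split; [apply/cvg_ex; eexists; exact: H|exact/cvg_lim].
Unshelve. all: by end_near.
Qed.

Lemma C1_is_derive_line phi (x v : R2) (t : R) : C1 phi ->
  is_derive t 1 (fun u => phi (x + u *: v))
    (v.1 * partials [:: 0] phi (x + t *: v) + v.2 * partials [:: 1] phi (x + t *: v)).
Proof.
move=> cphi; have [d E] := C1_is_derive (x + t *: v) v cphi.
by rewrite -E; exact: is_derive_line.
Qed.

End Smoothness.

(** * Bounded open subsets of the line with finite frontier *)

Section LineSlices.
Variable R : realType.
Local Notation mu := (@lebesgue_measure R).
Implicit Types (U : set R) (F f : R -> R) (s : seq R).

(** Away from the frontier U is both open and closed relative to the interval, and intervals are
    connected. *)
Lemma clopen_interval_dichotomy U (i : interval R) : open U ->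
  (forall x, x \in i -> closure U x -> U x) ->
  [set` i] `<=` U \/ [set` i] `&` U = set0.
Proof.
move=> oU iU; have [->|/set0P ne] := eqVneq ([set` i] `&` U) set0; first by right.
left; have /connected_intervalP ci : is_interval [set` i] by exact: interval_is_interval.
have <- : [set` i] `&` U = [set` i].
  apply: ci => //; first by exists U.
  exists (closure U); first exact: closed_closure.
  apply/seteqP; split=> x [ix] => [Ux|cUx]; split => //; first exact: subset_closure.
  exact: iU.
exact: subIsetr.
Qed.

Section FiniteFrontier.
Variables (U : set R) (B : R) (F f : R -> R).
Hypothesis oU : open U.
Hypothesis UB : forall x, U x -> `|x| <= B.
Hypothesis dF : forall x : R, is_derive x 1 F (f x).
Hypothesis cf : continuous f.

Let g := f \_ U.

Lemma integrable_on_bounded_open : mu.-integrable setT (EFin \o g).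
Proof.
have mU : measurable (U : set (measurableTypeR R)) by exact: open_measurable.
have : mu.-integrable [set` `[-B, B]] (EFin \o f).
  apply: continuous_compact_integrable; first exact: segment_compact.
  exact: continuous_subspaceT.
move=> ii; have UI : U `<=` [set` `[-B, B]].
  by move=> x /UB; rewrite /= in_itv/= ler_norml.
have : mu.-integrable U (EFin \o f) by apply: integrableS ii.
move/(integrable_mkcond _ mU); apply: eq_integrable => // x _.
by rewrite /g /= restrict_EFin.
Qed.
Let ig := integrable_on_bounded_open.

Let igS (i : interval R) : mu.-integrable [set` i] (EFin \o g).
Proof. by apply: integrableS ig. Qed.

Lemma Rintegral_derivative (p q : R) : p <= q ->
  (\int[mu]_(x in `[p, q]) f x)%R = F q - F p.
Proof.
rewrite le_eqVlt => /predU1P[->|pq].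
  by rewrite set_itv1 Rintegral_set1 subrr.
rewrite /Rintegral (@continuous_FTC2 _ _ F)//.
- exact: continuous_subspaceT.
- have cF : continuous F.
    move=> x; apply: differentiable_continuous; apply/derivable1_diffP.
    by have [] := dF x.
  split; first by move=> x _; have [] := dF x.
    by apply: cvg_at_right_filter; exact: cF.
  by apply: cvg_at_left_filter; exact: cF.
- by move=> x _; rewrite derive1E; have [_ ->] := dF x.
Qed.

(** Without frontier points strictly between p and q, the gap lies inside U, where the integral is F
    q - F p, or misses U, where it is 0. Only the bound common to both cases is kept, so it need not
    be known which one occurs. *)
Lemma integral_gap (p q : R) : p <= q ->
  (forall x, p < x < q -> closure U x -> U x) ->
  `|\int[mu]_(x in `]p, q]) g x|%R <= `|F p| + `|F q|.
Proof.
move=> pq gap.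
have -> : (\int[mu]_(x in `]p, q]) g x = \int[mu]_(x in `]p, q[) g x)%R.
  by rewrite Rintegral_itv_bndo_bndc.
have [|sub|dis] := @clopen_interval_dichotomy U `]p, q[ oU.
- by move=> x; rewrite in_itv/=; exact: gap.
- have -> : (\int[mu]_(x in `]p, q[) g x = \int[mu]_(x in `]p, q[) f x)%R.
    by apply: eq_Rintegral => x /set_mem /sub Ux; rewrite /g patchE mem_set.
  have fi (b b' : bool) : mu.-integrable [set` Interval (BSide b p) (BSide b' q)] (EFin \o f).
    have : mu.-integrable [set` `[p, q]] (EFin \o f).
      apply: continuous_compact_integrable; first exact: segment_compact.
      exact: continuous_subspaceT.
    apply: integrableS => // x /=; rewrite !in_itv/= => /andP[].
    by case: b b' => -[] /= H1 H2; rewrite ?(ltW H1) ?(ltW H2) ?H1 ?H2.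
  rewrite Rintegral_itv_bndo_bndc// Rintegral_itv_obnd_cbnd// Rintegral_derivative//.
  by rewrite [leRHS]addrC ler_normB.
- have -> : (\int[mu]_(x in `]p, q[) g x = \int[mu]_(x in `]p, q[) (0 : R))%R.
    apply: eq_Rintegral => x /set_mem xpq; rewrite /g patchE memNset// => Ux.
    by have : ([set` `]p, q[] `&` U) x by []; rewrite dis.
  by rewrite Rintegral_cst// mul0r normr0 addr_ge0.
Qed.

(** A half line cannot lie inside the bounded set U, so it misses U. *)
Lemma integral_unbounded_gap (p : R) :
  (forall x, p < x -> closure U x -> U x) ->
  (\int[mu]_(x in `]p, +oo[) g x)%R = 0.
Proof.
move=> gap; have [|sub|dis] := @clopen_interval_dichotomy U `]p, +oo[ oU.
- by move=> x; rewrite in_itv/= andbT; exact: gap.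
- have := UB (sub (`|p| + `|B| + 1) _).
  rewrite /= in_itv/= andbT => H; exfalso.
  have := H ltac:(have := ler_norm p; have := normr_ge0 B; lra).
  have := ler_norm B; have := ler_norm (`|p| + `|B| + 1).
  by have := normr_ge0 p; lra.
- have -> : (\int[mu]_(x in `]p, +oo[) g x = \int[mu]_(x in `]p, +oo[) (0 : R))%R.
    apply: eq_Rintegral => x /set_mem xpq; rewrite /g patchE memNset// => Ux.
    by have : ([set` `]p, +oo[] `&` U) x by []; rewrite dis.
  by rewrite Rintegral_cst// mul0r.
Qed.

(** Every point of the sorted list closes one gap and opens the next, hence the factor 2; the
    starting point p bounds a single gap. *)
Lemma integral_gaps s : forall p : R, path <=%R p s ->
  (forall x, p < x -> closure U x -> ~ U x -> x \in s) ->
  `|\int[mu]_(x in `]p, +oo[) g x|%R <= `|F p| + 2 * \sum_(q <- s) `|F q|.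
Proof.
elim: s => [|q s IH] p /=.
  move=> _ fr; rewrite integral_unbounded_gap ?normr0 ?big_nil ?mulr0 ?addr0//.
  by move=> x px cx; apply: contrapT => nU; have := fr _ px cx nU; rewrite in_nil.
move=> /andP[pq qs] fr.
have frq x : q < x -> closure U x -> ~ U x -> x \in s.
  move=> qx cx nU; have := fr _ (le_lt_trans pq qx) cx nU.
  by rewrite in_cons => /orP[/eqP xq|//]; rewrite xq ltxx in qx.
have := IH _ qs frq.
rewrite -(@Rintegral_itvB _ _ (BRight p) +oo%O q)//.
set a := (\int[mu]_(_ in `]p, +oo[) _)%R; set b := (\int[mu]_(_ in _) _)%R.
have : `|b| <= `|F p| + `|F q|.
  apply: integral_gap => // x /andP[px xq] cx; apply: contrapT => nU.
  have := fr _ px cx nU; rewrite in_cons => /orP[/eqP xq'|xs].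
    by rewrite xq' ltxx in xq.
  by have := order_path_min (@le_trans _ _) qs => /allP /(_ _ xs); rewrite leNgt xq.
rewrite big_cons; set S := \sum_(_ <- _) _.
by have := ler_normD (a - b) b; rewrite subrK; lra.
Qed.

(** The list only has to contain the frontier: further or repeated points merely enlarge the bound.
    Sorting it exhibits the gaps. *)
Lemma integral_finite_frontier s :
  (forall x, closure U x -> ~ U x -> x \in s) ->
  `|\int[mu]_(x in U) f x|%R <= 2 * \sum_(q <- s) `|F q|.
Proof.
move=> fr; rewrite Rintegral_mkcond -/g.
have -> : \sum_(q <- s) `|F q| = \sum_(q <- sort <=%R s) `|F q|.
  by apply: perm_big; rewrite perm_sym perm_sort.
have {}fr x : closure U x -> ~ U x -> x \in sort <=%R s by rewrite mem_sort; exact: fr.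
have := sort_sorted (@le_total _ R) s.
case: (sort _ _) fr => [|q s'] fr /=.
  (* No frontier points: U is the whole line or empty, and bounded, hence empty. *)
  rewrite big_nil mulr0 => _.
  rewrite (_ : setT = [set` `]-oo, +oo[ ]); last by rewrite set_itvE.
  have := @integral_unbounded_gap (- `|B| - 1) _.
  have := @clopen_interval_dichotomy U `]-oo, +oo[ oU.
  case=> [x _ cx|sub|dis _].
  - by apply: contrapT => nU; have := fr _ cx nU; rewrite in_nil.
  - have := UB (sub (`|B| + 1) _).
    rewrite /= in_itv/= => /(_ erefl) => H; exfalso; move: H.
    have := ler_norm B; have := ler_norm (`|B| + 1).
    by have := normr_ge0 B; lra.
  - have -> : (\int[mu]_(x in `]-oo, +oo[) g x = \int[mu]_(x in `]-oo, +oo[) (0 : R))%R.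
      apply: eq_Rintegral => x /set_mem xpq; rewrite /g patchE memNset// => Ux.
      by have : ([set` `]-oo, +oo[] `&` U) x by []; rewrite dis.
    by rewrite Rintegral_cst// mul0r normr0.
move=> qs.
have frq x : q < x -> closure U x -> ~ U x -> x \in s'.
  move=> qx cx nU; have := fr _ cx nU.
  by rewrite in_cons => /orP[/eqP xq|//]; rewrite xq ltxx in qx.
have := integral_gaps qs frq.
rewrite -(@Rintegral_itvB _ _ -oo%O +oo%O q)// set_itvE big_cons.
(* To the left of the smallest listed point U is empty, again by boundedness. *)
have -> : (\int[mu]_(x in `]-oo, q]) g x = 0)%R.
  rewrite -Rintegral_itv_bndo_bndc//.
  have [|sub|dis] := @clopen_interval_dichotomy U `]-oo, q[ oU.
  - move=> x; rewrite in_itv/= => xq cx; apply: contrapT => nU.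
    have := fr _ cx nU; rewrite in_cons => /orP[/eqP xq'|xs].
      by rewrite xq' ltxx in xq.
    by have := order_path_min (@le_trans _ _) qs => /allP /(_ _ xs); rewrite leNgt xq.
  - have := UB (sub (- (`|q| + `|B| + 1)) _).
    rewrite /= in_itv/= => H; exfalso.
    have := H ltac:(have := ler_norm (- q); rewrite normrN; have := normr_ge0 B; lra).
    rewrite normrN; have := ler_norm B; have := ler_norm (`|q| + `|B| + 1).
    by have := normr_ge0 q; lra.
  - have -> : (\int[mu]_(x in `]-oo, q[) g x = \int[mu]_(x in `]-oo, q[) (0 : R))%R.
      apply: eq_Rintegral => x /set_mem xpq; rewrite /g patchE memNset// => Ux.
      by have : ([set` `]-oo, q[] `&` U) x by []; rewrite dis.
    by rewrite Rintegral_cst// mul0r.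
rewrite subr0; set S := \sum_(_ <- _) _; have := normr_ge0 (F q).
by lra.
Qed.

End FiniteFrontier.

(** |a| times the image of Lebesgue measure under the affine map has the right value on half-open
    intervals, hence is Lebesgue measure by uniqueness. *)
Lemma ge0_integral_affine (a b : R) (h : R -> \bar R) : a != 0 ->
  measurable_fun setT (h : measurableTypeR R -> \bar R) -> (forall x, 0 <= h x)%E ->
  (\int[mu]_x h (a * x + b)%R = `|a|^-1%:E * \int[mu]_x h x)%E.
Proof.
move=> a0 mh h0.
pose phi : measurableTypeR R -> measurableTypeR R := fun x => a * x + b.
have mphi : measurable_fun setT phi.
  by apply: measurable_funD => //; apply: measurable_funM.
have na : 0 <= `|a| by [].
have [m1 Em1] : exists m1 : {measure set (measurableTypeR R) -> \bar R},
    m1 = pushforward mu phi :> (set _ -> _).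
  by unshelve eexists (pushforward mu phi : {measure set (measurableTypeR R) -> \bar R}).
pose m' := mscale (NngNum na) m1.
have E A : measurable A -> mu A = m' A.
  move=> mA; apply: (@lebesgue_measure_unique R m') => //= X [[c d] _ <-].
  rewrite /m' /mscale/= Em1 /pushforward.
  have [cd|dc] := ltP c d; last first.
    by rewrite set_itv_ge ?bnd_simp ?leNgt// -?leNgt// preimage_set0 !measure0 mule0.
  have [ap|an] := ltP 0 a.
    have -> : phi @^-1` `]c, d] = [set` `](c - b) / a, (d - b) / a]].
      apply/seteqP; split=> x /=; rewrite !in_itv/= /phi ltr_pdivrMr// ler_pdivlMr// mulrC;
        by rewrite ltrBlDr lerBrDr.
    rewrite !lebesgue_measure_itv/= !lte_fin cd ltr_pM2r ?invr_gt0// ltrD2r cd.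
    rewrite -!EFinB -EFinM gtr0_norm//; congr EFin; field.
    exact: lt0r_neq0.
  have {}an : a < 0 by rewrite lt_neqAle a0 an.
  have -> : phi @^-1` `]c, d] = [set` `[(d - b) / a, (c - b) / a[].
    apply/seteqP; split=> x /=; rewrite !in_itv/= /phi ltr_ndivlMr// ler_ndivrMr// mulrC;
      by rewrite ltrBlDr lerBrDr andbC.
  rewrite !lebesgue_measure_itv/= !lte_fin cd ltr_nM2r ?invr_lt0// ltrD2r cd.
  rewrite -!EFinB -EFinM ltr0_norm//; congr EFin; field.
  exact: ltr0_neq0.
have -> : (\int[mu]_x h x = \int[m']_x h x)%E.
  by apply: eq_measure_integral => A mA _; exact: E.
rewrite ge0_integral_mscale//= Em1 ge0_integral_pushforward// preimage_setT.
by rewrite muleA -EFinM mulVf ?mul1e// normr_eq0.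
Qed.

End LineSlices.

(** * Integrals of partial derivatives over a domain bounded by segments *)

Section PlaneSlices.
Variable R : realType.
Local Notation R2 := (R * R)%type.
Local Notation mR2 := (measurableTypeR R * measurableTypeR R)%type.
Local Notation mu := (@lebesgue_measure R).
Implicit Types (D : set R2) (E : seq (R2 * R2)).

Definition swap (z : R2) : R2 := (z.2, z.1).

Lemma measurable_swap : measurable_fun setT (swap : mR2 -> mR2).
Proof. by apply: measurable_fun_pair; [exact: measurable_snd|exact: measurable_fst]. Qed.

Lemma ge0_integral_swap (f : R2 -> \bar R) :
  measurable_fun setT (f : mR2 -> \bar R) -> (forall z, 0 <= f z)%E ->
  (\int[area R]_z f (swap z) = \int[area R]_z f z)%E.
Proof.
move=> mf f0.
have mfs : measurable_fun setT (f \o swap : mR2 -> \bar R).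
  exact: measurableT_comp measurable_swap.
exact: etrans (@fubini_tonelli1 _ _ _ _ R mu mu _ mfs (fun z => f0 _))
  (esym (@fubini_tonelli2 _ _ _ _ R mu mu _ mf f0)).
Qed.

Lemma continuous_swap : continuous swap.
Proof.
by move=> z; apply: (@cvg_pair _ _ _ _ (nbhs z.2) (nbhs z.1)); [exact: cvg_snd|exact: cvg_fst].
Qed.

(** For open D these points are the frontier. The interior is not mentioned, which eases the passage
    to the domain with exchanged coordinates. *)
Definition frontier_in D E : Prop :=
  forall z, closure D z -> ~ D z -> exists2 e, e \in E & segment e.1 e.2 z.

Lemma segE (a b : R2) (t : R) :
  seg a b t = (a.1 + t * (b.1 - a.1), a.2 + t * (b.2 - a.2)).
Proof. by []. Qed.

Lemma continuous_seg (a b : R2) : continuous (seg a b).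
Proof.
move=> t; rewrite /seg; apply: cvgD; first exact: cvg_cst.
by apply: cvgZr_tmp.
Qed.

(** A horizontal line meets a non-horizontal edge in at most one point, and the horizontal edges lie
    at finitely many heights, a null set. At all other heights the slice has a finite frontier and
    the one-dimensional bound applies. Integrated over the height, with the position on the edge as
    new variable, it yields the edge integrals with the height of the edge as Jacobian. *)
Lemma integral_slice0 D E (Phi : R2 -> R) : open D -> bounded_set D ->
  frontier_in D E -> C1 Phi ->
  `|\int[area R]_(z in D) partials [:: 0] Phi z|%R <=
    \sum_(e <- E) 2 * `|e.2.2 - e.1.2| *
      (\int[length R]_(t in [set` `[0%R, 1%R]]) `|Phi (seg e.1 e.2 t)|)%R.
Proof.
move=> oD bD frD CPhi; have [cPhi /(_ 0)[_ cPhi0]] := CPhi.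
have [B B0 DB] := bounded_set_box bD.
have mD := open_measurable_plane oD.
pose g : mR2 -> R := (partials [:: 0] Phi) \_ D.
have mg : measurable_fun setT g.
  apply/(measurable_restrictT _ mD); apply: measurable_funTS.
  exact: continuous_measurable_plane.
have ig : (area R).-integrable setT (EFin \o g).
  have [M M0 HM] := continuous_bounded_on bD cPhi0.
  have : (area R).-integrable D (EFin \o (partials [:: 0] Phi)).
    apply: measurable_bounded_integrable => //; first exact: area_bounded.
      by apply: measurable_funTS; exact: continuous_measurable_plane.
    exists M; split; first exact: num_real.
    by move=> N MN x Dx; apply: le_trans (ltW MN); exact: HM.
  move/(integrable_mkcond _ mD); apply: eq_integrable => // x _.
  by rewrite /g /= restrict_EFin.
(* [tau e y] is the parameter of the point of height y on the line through the edge e; [G e] is what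
   this point contributes to the bound of the slice. *)
pose tau (e : R2 * R2) (y : R) := (e.2.2 - e.1.2)^-1 * y + - (e.1.2 / (e.2.2 - e.1.2)).
pose h (e : R2 * R2) (t : R) : \bar R :=
  (`|Phi (seg e.1 e.2 t)| * \1_([set` `[0%R, 1%R]]) t)%:E.
pose G (e : R2 * R2) (y : R) : \bar R :=
  if e.2.2 == e.1.2 then 0%E else (2%:E * h e (tau e y))%E.
have mh e : measurable_fun setT (h e : measurableTypeR R -> \bar R).
  apply/measurable_EFinP; apply: measurable_funM; last exact: measurable_indic.
  apply: measurableT_comp => //; apply: continuous_measurable_fun => t.
  apply: continuous_comp; first exact: continuous_seg.
  exact: cPhi.
have h0 e t : (0 <= h e t)%E by rewrite lee_fin mulr_ge0// indicE.
have mtau e : measurable_fun setT (tau e : measurableTypeR R -> measurableTypeR R).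
  apply: continuous_measurable_fun => y; apply: cvgD; last exact: cvg_cst.
  by apply: cvgM; [exact: cvg_cst|exact: cvg_id].
have mG e : measurable_fun setT (G e : measurableTypeR R -> \bar R).
  rewrite /G; case: eqP => _; first exact: measurable_cst.
  by apply: measurable_funeM; apply: measurableT_comp (mh e) (mtau e).
have G0 e y : (0 <= G e y)%E by rewrite /G; case: eqP => // _; rewrite mule_ge0.
have iG e : (\int[mu]_y G e y = (2 * `|e.2.2 - e.1.2| *
      (\int[length R]_(t in [set` `[0%R, 1%R]]) `|Phi (seg e.1 e.2 t)|)%R)%:E)%E.
  rewrite /G; case: eqP => [->|/eqP ne].
    by rewrite integral0 subrr normr0 mulr0 mul0r.
  have d0 : e.2.2 - e.1.2 != 0 by rewrite subr_eq0.
  rewrite ge0_integralZl//; last exact: measurableT_comp (mh e) (mtau e).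
  rewrite (ge0_integral_affine _ _ (mh e) (h0 e)) ?invr_eq0//.
  rewrite normfV invrK muleA -EFinM [RHS]EFinM; congr mule.
  rewrite /Rintegral fineK.
    rewrite [RHS]integral_mkcond; apply: eq_integral => t _.
    rewrite /h patchE indicE; case: ifPn => tI; rewrite ?mulr1 ?mulr0//.
  apply: integrable_fin_num => //.
  apply: continuous_compact_integrable; first exact: segment_compact.
  apply: continuous_subspaceT => t; apply: continuous_comp; last exact: norm_continuous.
  apply: continuous_comp; first exact: continuous_seg.
  exact: cPhi.
have key (y : R) : (forall e, e \in E -> e.2.2 = e.1.2 -> y <> e.1.2) ->
  (`|\int[mu]_x (g (x, y))%:E| <= \sum_(e <- E) G e y)%E.
  move=> good.
  pose U : set R := [set x | D (x, y)].
  have cy : continuous (fun x : R => (x, y)).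
    by move=> x; apply: (@cvg_pair _ _ _ _ (nbhs x) (nbhs y)); [exact: cvg_id|exact: cvg_cst].
  have oU : open U by apply: open_comp => // x _; exact: cy.
  have UB x : U x -> `|x| <= B by move=> /DB[].
  (* Abscissae at which the line of height y crosses the non-horizontal edges. *)
  pose P := [seq (seg e.1 e.2 (tau e y)).1 | e <- E &
                (e.2.2 != e.1.2) && (tau e y \in `[0%R, 1%R])].
  have PU x : closure U x -> ~ U x -> x \in P.
    move=> cUx nUx.
    have cD : closure D (x, y).
      move=> A /cy /(cUx _)[x' [Ux' Ax']].
      by exists (x', y).
    have [e eE [t t01 Et]] := frD _ cD nUx.
    have ne : e.2.2 != e.1.2.
      apply/eqP => e2; apply: (good _ eE e2).
      by move: Et; rewrite segE e2 subrr mulr0 addr0 => -[_ ->].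
    have d0 : e.2.2 - e.1.2 != 0 by rewrite subr_eq0.
    have Ety : tau e y = t.
      by move: Et; rewrite segE => -[_ <-]; rewrite /tau; field.
    apply/mapP; exists e.
      by rewrite mem_filter eE ne Ety andbT.
    by rewrite Ety Et.
  have := @integral_finite_frontier R U B (fun x => Phi (x, y))
    (fun x => partials [:: 0] Phi (x, y)) oU UB (fun u => is_derive_slice0 u y CPhi) _ P PU.
  have cf : continuous (fun x => partials [:: 0] Phi (x, y)).
    by move=> x; apply: continuous_comp; [exact: cy|exact: cPhi0].
  move=> /(_ cf); rewrite -lee_fin => H.
  have DU x : ((x, y) \in D) = (x \in U) by apply/idP/idP; rewrite !in_setE.
  have Eg : (\int[mu]_x (g (x, y))%:E = \int[mu]_(x in U) (partials [:: 0] Phi (x, y))%:E)%E.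
    rewrite [RHS]integral_mkcond; apply: eq_integral => x _.
    rewrite /g !patchE.
    by rewrite DU; case: ifP.
  have ifin : (\int[mu]_x (g (x, y))%:E)%E \is a fin_num.
    apply: integrable_fin_num => //.
    have := @integrable_on_bounded_open R U B _ oU UB cf.
    by apply: eq_integrable => // x _ /=; rewrite /g !patchE DU.
  have E1 : (`|\int[mu]_x (g (x, y))%:E| =
     `|(\int[mu]_(x in U) partials [:: 0] Phi (x, y))%R|%:E)%E.
    by rewrite /Rintegral -Eg -abse_EFin fineK.
  rewrite E1; apply: le_trans H _.
  rewrite big_map big_filter /= mulr_sumr -sumEFin big_mkcond.
  apply: lee_sum => e _; rewrite /G; case: eqP => //= /eqP ne.
  case: ifPn => t01; last by rewrite mule_ge0.
  have d0 : e.2.2 - e.1.2 != 0 by rewrite subr_eq0.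
  rewrite /h indicE mem_set//= mulr1 -EFinM lee_fin.
  have -> : ((seg e.1 e.2 (tau e y)).1, y) = seg e.1 e.2 (tau e y).
    by rewrite segE; congr (_, _); rewrite /tau; field.
  by [].
rewrite -lee_fin -sumEFin.
have -> : (`|(\int[area R]_(z in D) partials [:: 0] Phi z)%R|%:E =
    `|\int[mu]_y \int[mu]_x (g (x, y))%:E|)%E.
  rewrite (integral21_prod_meas1 ig) Rintegral_mkcond -/g /Rintegral -abse_EFin fineK//.
  exact: integrable_fin_num.
have mF : measurable_fun setT (fun y : measurableTypeR R => \int[mu]_x (g (x, y))%:E)%E.
  exact: (measurable_fubini_G ig).
apply: le_trans (le_abse_integral _ _ mF) _ => //.
under [leRHS]eq_bigr do rewrite -iG.
rewrite -ge0_integral_sum//.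
apply: ae_ge0_le_integral => //.
- exact: measurableT_comp.
- by move=> y _; apply: sume_ge0.
- exact: emeasurable_sum.
(* The discarded heights, those of all starting points of edges, include the heights of the
   horizontal edges. *)
have null : mu [set` [seq e.1.2 | e <- E]] = 0%E.
  by apply: countable_lebesgue_measure0; apply: finite_set_countable; exact: finite_seq.
exists [set` [seq e.1.2 | e <- E]]; split => //.
  by apply: countable_measurable => //; apply: finite_set_countable; exact: finite_seq.
move=> y /= /not_implyP[_ H]; apply: contrapT => nin; apply: H; apply: key => e eE _ ye.
by apply: nin; apply/mapP; exists e.
Qed.

Lemma Rintegral_swap D (f : R2 -> R) : measurable (D : set mR2) ->
  (area R).-integrable D (EFin \o f) ->
  (\int[area R]_(z in swap @^-1` D) f (swap z) = \int[area R]_(z in D) f z)%R.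
Proof.
move=> mD /(integrable_mkcond _ mD) ig.
rewrite Rintegral_mkcond [RHS]Rintegral_mkcond.
pose g := f \_ D.
have {}ig : (area R).-integrable setT (EFin \o g).
  by move: ig; apply: eq_integrable => // x _; rewrite /g /= restrict_EFin.
have mg := measurable_int _ ig.
have igs : (area R).-integrable setT (EFin \o (g \o swap)).
  apply/integrableP; split; first exact: measurableT_comp mg measurable_swap.
  rewrite (ge0_integral_swap (f := fun z => `|(g z)%:E|%E)) //.
    by case/integrableP: ig.
  exact: measurableT_comp mg.
rewrite /Rintegral; congr fine.
have -> : (\int[area R]_x (((fun z => f (swap z)) \_ (swap @^-1` D)) x)%:E)%E =
  (\int[area R]_x (g (swap x))%:E)%E.
  by apply: eq_integral => x _; rewrite /g !patchE.
rewrite -(integral12_prod_meas1 igs).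
by rewrite -(integral21_prod_meas1 ig).
Qed.

Lemma swapK : involutive swap. Proof. by case. Qed.

Lemma closure_swap D z : closure (swap @^-1` D) z -> closure D (swap z).
Proof.
move=> cz A /continuous_swap /cz[w [Dw Aw]].
by exists (swap w).
Qed.

Lemma swap_line (x v : R2) (t : R) : swap (x + t *: v) = swap x + t *: swap v.
Proof. by []. Qed.

Lemma derivable_swap (phi : R2 -> R) (x v : R2) :
  derivable phi (swap x) (swap v) ->
  derivable (phi \o swap) x v /\ 'D_v (phi \o swap) x = 'D_(swap v) phi (swap x).
Proof.
move=> d.
have E : (fun h => h^-1 *: (((phi \o swap) \o shift x) (h *: v) - (phi \o swap) x))
   = (fun h => h^-1 *: ((phi \o shift (swap x)) (h *: swap v) - phi (swap x))).
  by apply/funext => h.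
split; first by rewrite /derivable E.
by rewrite /derive E.
Qed.

Lemma swap_basis : swap (basis_vec R 0) = basis_vec R 1 /\ swap (basis_vec R 1) = basis_vec R 0.
Proof. by rewrite basis_vec0 basis_vec1. Qed.

Definition ord2_swap (i : 'I_2) : 'I_2 := if i == 0 then 1 else 0.

Lemma swap_basis_vec i : swap (basis_vec R i) = basis_vec R (ord2_swap i).
Proof.
rewrite /ord2_swap; case: (eqVneq i 0) => [->|i0]; first by have [] := swap_basis.
have -> : i = 1 by apply/val_inj; case: i i0 => -[|[|]].
by have [] := swap_basis.
Qed.

Lemma C1_swap (phi : R2 -> R) : C1 phi -> C1 (phi \o swap).
Proof.
move=> [cphi dphi]; split.
  by move=> x; apply: continuous_comp; [exact: continuous_swap|exact: cphi].
move=> i; have [d c] := dphi (ord2_swap i).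
have H x := @derivable_swap phi x (basis_vec R i).
rewrite swap_basis_vec in H.
split; first by move=> x; have [] := H x (d _).
have -> : partials [:: i] (phi \o swap) = partials [:: ord2_swap i] phi \o swap.
  by apply/funext => x; have [_] := H x (d _).
by move=> x; apply: continuous_comp; [exact: continuous_swap|exact: c].
Qed.

Lemma bounded_swap D : bounded_set D -> bounded_set (swap @^-1` D).
Proof.
move=> /bounded_set_box[B B0 H]; exists B; split; first exact: num_real.
move=> M BM z /H[/= z1 z2]; rewrite prod_normE ge_max/=.
by rewrite (le_trans z1 (ltW BM)) (le_trans z2 (ltW BM)).
Qed.

Lemma C1_integrable D (f : R2 -> R) : measurable (D : set mR2) -> bounded_set D ->
  continuous f -> (area R).-integrable D (EFin \o f).
Proof.
move=> mD bD cf; have [M M0 HM] := continuous_bounded_on bD cf.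
apply: measurable_bounded_integrable => //; first exact: area_bounded.
  by apply: measurable_funTS; exact: continuous_measurable_plane.
exists M; split; first exact: num_real.
by move=> N MN x Dx; apply: le_trans (ltW MN); exact: HM.
Qed.

(** Exchanging the coordinates reduces vertical derivatives to horizontal ones. Degenerate edges
    have coefficient 0 and are dropped, which matters because a trace is controlled on nondegenerate
    segments only. *)
Lemma integral_partial_frontier D E : open D -> bounded_set D ->
  frontier_in D E ->
  exists2 K : R, 0 <= K & forall i (Phi : R2 -> R), C1 Phi ->
  `|\int[area R]_(z in D) partials [:: i] Phi z|%R <=
    K * \sum_(e <- E | e.1 != e.2)
      (\int[length R]_(t in [set` `[0%R, 1%R]]) `|Phi (seg e.1 e.2 t)|)%R.
Proof.
move=> oD bD frD; have mD := open_measurable_plane oD.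
pose K0 := \sum_(e <- E) (2 * `|e.2.2 - e.1.2| + 2 * `|e.2.1 - e.1.1|).
have K0e e : e \in E -> 2 * `|e.2.2 - e.1.2| <= K0 /\ 2 * `|e.2.1 - e.1.1| <= K0.
  move=> eE; rewrite /K0 (big_rem _ eE)/=.
  have : 0 <= \sum_(y <- rem e E) (2 * `|y.2.2 - y.1.2| + 2 * `|y.2.1 - y.1.1|).
    by apply: sumr_ge0 => y _; rewrite addr_ge0// mulr_ge0.
  have := normr_ge0 (e.2.2 - e.1.2); have := normr_ge0 (e.2.1 - e.1.1); split; lra.
exists K0; first by apply: sumr_ge0 => y _; rewrite addr_ge0// mulr_ge0.
have J0 (Phi : R2 -> R) (e : R2 * R2) :
    0 <= (\int[length R]_(t in [set` `[0%R, 1%R]]) `|Phi (seg e.1 e.2 t)|)%R.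
  by apply: Rintegral_ge0.
move=> i Phi CPhi; have [->|i0] := eqVneq i 0.
  apply: le_trans (integral_slice0 oD bD frD CPhi) _.
  rewrite mulr_sumr [leRHS]big_mkcond !big_seq; apply: ler_sum => e eE.
  case: eqP => [->|_] /=; first by rewrite subrr normr0 mulr0 mul0r.
  by rewrite ler_wpM2r//; have [] := K0e _ eE.
have {i i0}-> : i = 1 by apply/val_inj; case: i i0 => -[|[|]].
pose E' := [seq (swap e.1, swap e.2) | e <- E].
have frD' : frontier_in (swap @^-1` D) E'.
  move=> z cz nz; have [e eE [t t01 Et]] := frD _ (closure_swap cz) nz.
  exists (swap e.1, swap e.2); first by apply/mapP; exists e.
  exists t => //=; rewrite -(swapK z) -Et /seg swap_line.
  by [].
have oD' : open (swap @^-1` D) by apply: open_comp => // x _; exact: continuous_swap.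
have := integral_slice0 oD' (bounded_swap bD) frD' (C1_swap CPhi).
have -> : (\int[area R]_(z in swap @^-1` D) partials [:: 0] (Phi \o swap) z =
   \int[area R]_(z in D) partials [:: 1] Phi z)%R.
  rewrite -(@Rintegral_swap D (partials [:: 1] Phi))//; last first.
    by apply: C1_integrable => //; have [_ /(_ 1)[]] := CPhi.
move/le_trans; apply.
rewrite /E' big_map /= mulr_sumr [leRHS]big_mkcond !big_seq; apply: ler_sum => e eE.
have -> : (\int[length R]_(t in `[0%R, 1%R]) `|Phi (swap (seg (swap e.1) (swap e.2) t))|)%R =
  (\int[length R]_(t in `[0%R, 1%R]) `|Phi (seg e.1 e.2 t)|)%R.
  by apply: eq_Rintegral => t _; rewrite !segE.
case: eqP => [->|_] /=; first by rewrite subrr normr0 mulr0 mul0r.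
by rewrite ler_wpM2r//; have [] := K0e _ eE.
Qed.

End PlaneSlices.

(** * The trace inequality *)

Section LinearChange.
Variable R : realType.
Local Notation R2 := (R * R)%type.
Local Notation mR2 := (measurableTypeR R * measurableTypeR R)%type.
Local Notation mu := (@lebesgue_measure R).

Lemma cvg_sqr (T : Type) (F : set_system T) {FF : Filter F} (f : T -> R) (l : R) :
  f @ F --> l -> (fun x => f x ^+ 2) @ F --> l ^+ 2.
Proof.
by move=> fl; under eq_fun do rewrite expr2; rewrite expr2; exact: cvgM.
Qed.

Lemma continuous_affine2 (a b c : R) : continuous (fun z : R2 => a + z.1 * b + z.2 * c).
Proof.
move=> z; apply: cvgD.
  apply: cvgD; first exact: cvg_cst.
  by apply: cvgM; [exact: cvg_fst|exact: cvg_cst].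
by apply: cvgM; [exact: cvg_snd|exact: cvg_cst].
Qed.

Lemma measurable_plane (f g : R2 -> R) : continuous f -> continuous g ->
  measurable_fun setT ((fun z => (f z, g z)) : mR2 -> mR2).
Proof.
move=> cf cg; apply: measurable_fun_pair; exact: continuous_measurable_plane.
Qed.

(** Two one-variable substitutions between applications of Tonelli's theorem. If d has no first
    component the variables separate; otherwise the first coordinate replaces t, and the second one
    then replaces r. *)
Lemma ge0_integral_linear (a d e : R2) (F : R2 -> \bar R) :
  measurable_fun setT (F : mR2 -> \bar R) -> (forall z, 0 <= F z)%E ->
  d.1 * e.2 - d.2 * e.1 != 0 ->
  (\int[mu]_t \int[mu]_r F (a + t *: d + r *: e)%R =
    `|d.1 * e.2 - d.2 * e.1|^-1%:E * \int[area R]_z F z)%E.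
Proof.
case: a d e => [a1 a2] [d1 d2] [e1 e2] mF F0 /= D0.
have FE t r : F ((a1, a2) + t *: (d1, d2) + r *: (e1, e2)) =
  F (a1 + t * d1 + r * e1, a2 + t * d2 + r * e2) by [].
pose G (z : mR2) := F (a1 + z.1 * d1 + z.2 * e1, a2 + z.1 * d2 + z.2 * e2).
have mG : measurable_fun setT G.
  by apply: measurableT_comp mF _; apply: measurable_plane; exact: continuous_affine2.
have G0 z : (0 <= G z)%E by exact: F0.
under eq_integral do under eq_integral do rewrite FE.
rewrite -[LHS]/(\int[mu]_t \int[mu]_r G (t, r))%E (fubini_tonelli G mG G0) /G /=.
have mFx (u : R) : measurable_fun setT (fun w : measurableTypeR R => F (u, w)).
  exact: measurableT_comp mF (measurable_pair1 u).
have mH : measurable_fun setT (fun u : measurableTypeR R => \int[mu]_w F (u, w))%E.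
  exact: (@measurable_fun_fubini_tonelli_F _ _ _ _ R mu F mF F0).
have HE : (\int[mu]_u \int[mu]_w F (u, w) = \int[area R]_z F z)%E.
  exact: (esym (@fubini_tonelli1 _ _ _ _ R mu mu F mF F0)).
have [d10|d10] := eqVneq d1 0.
  move: D0; rewrite d10 mul0r sub0r oppr_eq0 mulf_eq0 negb_or => /andP[d20 e10].
  transitivity (\int[mu]_r (`|d2|^-1%:E * \int[mu]_w F ((e1 * r + a1)%R, w)))%E.
    apply: eq_integral => r _.
    rewrite -(@ge0_integral_affine _ d2 (a2 + r * e2) (fun w => F ((e1 * r + a1)%R, w)) d20 (mFx _))//.
    by apply: eq_integral => t _; congr (F (_, _)); ring.
  have mp : measurable_fun setT ((fun x => e1 * x + a1) : measurableTypeR R -> measurableTypeR R).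
    apply: continuous_measurable_fun => r; apply: cvgD; last exact: cvg_cst.
    by apply: cvgM; [exact: cvg_cst|exact: cvg_id].
  rewrite ge0_integralZl//=; last 2 first.
  - exact: measurableT_comp mH mp.
  - by move=> r _; apply: integral_ge0.
  rewrite (@ge0_integral_affine _ e1 a1 (fun u => \int[mu]_w F (u, w))%E e10 mH); last first.
    by move=> r; apply: integral_ge0.
  by rewrite HE muleA -EFinM normrN normrM invfM.
(* With u = a1 + t d1 + r e1 eliminated for t, the second coordinate reads l r + k u + m, and d1 l
   is the determinant. *)
pose k := d2 / d1; pose l := e2 - e1 * k; pose m := a2 - a1 * k.
have l0 : l != 0.
  apply: contra D0 => /eqP l0; apply/eqP.
  have -> : d1 * e2 - d2 * e1 = d1 * l by rewrite /l /k; field.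
  by rewrite l0 mulr0.
pose H (z : mR2) := F (z.1, l * z.2 + (k * z.1 + m)).
have mHH : measurable_fun setT H.
  apply: measurableT_comp mF _; apply: measurable_plane; first by move=> z; exact: cvg_fst.
  move=> z; apply: cvgD; first by apply: cvgM; [exact: cvg_cst|exact: cvg_snd].
  by apply: cvgD; [apply: cvgM; [exact: cvg_cst|exact: cvg_fst]|exact: cvg_cst].
have H0 z : (0 <= H z)%E by exact: F0.
have mHr (r : R) : measurable_fun setT (fun u : measurableTypeR R => H (u, r)).
  exact: measurableT_comp mHH (measurable_pair2 r).
transitivity (\int[mu]_r (`|d1|^-1%:E * \int[mu]_u H (u, r)))%E.
  apply: eq_integral => r _.
  rewrite -(@ge0_integral_affine _ d1 (a1 + r * e1) (fun u => H (u, r)) d10 (mHr r))//.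
  apply: eq_integral => t _; rewrite /H /=; congr (F (_, _)); first by ring.
  by rewrite /l /m /k; field.
rewrite ge0_integralZl//=; last 2 first.
- exact: (@measurable_fun_fubini_tonelli_G _ _ _ _ R mu H mHH H0).
- by move=> r _; apply: integral_ge0.
rewrite -(fubini_tonelli H mHH H0) /H /=.
under eq_integral => u _ do rewrite (ge0_integral_affine _ l0 (mFx _))//.
rewrite ge0_integralZl//=; last by move=> r _; apply: integral_ge0.
rewrite HE muleA -EFinM -invfM -normrM; congr ((`|_|^-1)%:E * _)%E.
by rewrite /l /k; field.
Qed.

End LinearChange.

Section TraceInequality.
Variable R : realType.
Local Notation R2 := (R * R)%type.
Local Notation mR2 := (measurableTypeR R * measurableTypeR R)%type.
Local Notation mu := (@lebesgue_measure R).
Implicit Types (D : set R2).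

Lemma frontierP D z : open D -> frontier D z -> closure D z /\ ~ D z.
Proof. by move=> /interior_id iD [cz nz]; split => //; rewrite -iD. Qed.

(* FTC for (1 - r / delta) psi(r)^2. *)
Lemma trace_inequality_1d (psi dpsi : R -> R) (delta : R) : 0 < delta ->
  (forall x : R, is_derive x 1 psi (dpsi x)) -> continuous dpsi ->
  psi 0 ^+ 2 <=
  (\int[mu]_(r in `[0, delta]) ((delta^-1 + 1) * psi r ^+ 2 + dpsi r ^+ 2))%R.
Proof.
move=> d0 dp cd.
have cp : continuous psi.
  move=> x; apply: differentiable_continuous; apply/derivable1_diffP.
  by have [] := dp x.
pose W (r : R) := (1 - delta^-1 * r) * (psi r * psi r).
pose dW (r : R) := (1 - delta^-1 * r) * (2 * (psi r * dpsi r)) - delta^-1 * (psi r * psi r).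
have HW (x : R) : is_derive x 1 W (dW x).
  have H1 : is_derive x 1 (fun r : R => 1 - delta^-1 * r) (0 - delta^-1 * 1).
    apply: is_deriveB.
  have H2 : is_derive x 1 (fun r : R => psi r * psi r) (psi x * dpsi x + psi x * dpsi x).
    exact: is_deriveM.
  have -> : dW x = (1 - delta^-1 * x) *: (psi x * dpsi x + psi x * dpsi x) +
      (psi x * psi x) *: (0 - delta^-1 * 1) by rewrite /dW /GRing.scale/=; ring.
  exact: is_deriveM H1 H2.
have cW : continuous dW.
  move=> x; apply: cvgB; apply: cvgM.
  - by apply: cvgB; [exact: cvg_cst|apply: cvgM; [exact: cvg_cst|exact: cvg_id]].
  - by apply: cvgM; [exact: cvg_cst|apply: cvgM; [exact: cp|exact: cd]].
  - exact: cvg_cst.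
  - by apply: cvgM; exact: cp.
have E := @Rintegral_derivative R W dW HW cW 0 delta (ltW d0).
have ci (f : R -> R) : continuous f -> mu.-integrable `[0, delta] (EFin \o f).
  move=> cf; apply: continuous_compact_integrable; first exact: segment_compact.
  exact: continuous_subspaceT.
have -> : psi 0 ^+ 2 = (\int[mu]_(r in `[0, delta]) (- 1 * dW r))%R.
  rewrite RintegralZl//; last exact: ci.
  by rewrite E /W mulVf ?gt_eqF// subrr mul0r mulr0 subr0 sub0r mulN1r opprK mul1r expr2.
apply: le_Rintegral => //.
- by apply: ci => x; apply: cvgM; [exact: cvg_cst|exact: cW].
- apply: ci => x; apply: cvgD; last by rewrite /=; apply: cvg_sqr; exact: cd.
  by apply: cvgM; [exact: cvg_cst|apply: cvg_sqr; exact: cp].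
- move=> r; rewrite /= in_itv/= => /andP[r0 rd]; rewrite /dW.
  set k := delta^-1 * r.
  have k0 : 0 <= k by rewrite mulr_ge0// invr_ge0 ltW.
  have k1 : k <= 1 by rewrite /k mulrC ler_pdivrMr// mul1r.
  set p := psi r; set q := dpsi r.
  have -> : - 1 * ((1 - k) * (2 * (p * q)) - delta^-1 * (p * p)) =
     delta^-1 * p ^+ 2 - (1 - k) * (2 * (p * q)) by ring.
  have pq1 : 0 <= (p + q) ^+ 2 by exact: sqr_ge0.
  have pp : 0 <= p ^+ 2 by exact: sqr_ge0.
  have qq : 0 <= q ^+ 2 by exact: sqr_ge0.
  have := mulr_ge0 (_ : 0 <= 1 - k) pq1; have := mulr_ge0 k0 pp; have := mulr_ge0 k0 qq.
  rewrite subr_ge0 => h1 h2 /(_ k1) h3.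
  by move: h1 h2 h3; rewrite !expr2; nra.
Qed.

Definition H1sqr D (phi : R2 -> R) : R :=
  norm2 (area R) D phi ^+ 2 + \sum_i norm2 (area R) D (partials [:: i] phi) ^+ 2.

Lemma sum_ord2 (F : 'I_2 -> R) : \sum_i F i = F 0 + F 1.
Proof. by rewrite big_ord_recl big_ord1; congr (_ + F _); apply/val_inj. Qed.

Lemma integral_weighted_sqr D (k : R) (p q r : R2 -> R) :
  measurable (D : set mR2) -> bounded_set D -> 0 <= k ->
  continuous p -> continuous q -> continuous r ->
  (\int[area R]_(z in D) (k * p z ^+ 2 + (q z ^+ 2 + r z ^+ 2))%:E =
   (k * norm2 (area R) D p ^+ 2 +
     (norm2 (area R) D q ^+ 2 + norm2 (area R) D r ^+ 2))%:E)%E.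
Proof.
move=> mD bD k0 cp cq cr.
have ms (f : R2 -> R) : continuous f -> measurable_fun D (fun z : mR2 => (f z ^+ 2)%:E).
  move=> cf; apply/measurable_EFinP/measurable_funX/measurable_funTS.
  exact: continuous_measurable_plane.
have mp := ms _ cp; have mq := ms _ cq; have mr := ms _ cr.
have s0 (f : R2 -> R) z : D z -> (0 <= (f z ^+ 2)%:E)%E by rewrite lee_fin sqr_ge0.
under eq_integral do rewrite EFinD EFinM EFinD.
rewrite ge0_integralD//; last 4 first.
- by move=> z Dz; apply: mule_ge0; [rewrite lee_fin|exact: s0].
- exact: measurable_funeM.
- by move=> z Dz; apply: adde_ge0; exact: s0.
- exact: emeasurable_funD.
rewrite ge0_integralZl//; last exact: s0.
rewrite ge0_integralD//; [|exact: s0|exact: s0].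
rewrite (integral_sqr_norm2 mD (continuous_in_L2 mD bD cp)).
rewrite (integral_sqr_norm2 mD (continuous_in_L2 mD bD cq)).
by rewrite (integral_sqr_norm2 mD (continuous_in_L2 mD bD cr)).
Qed.

(* A strip above the graph, swept by segments in the direction (-s, c). *)
Lemma local_trace_inequality D (a b : R2) (t0 : R) :
  open D -> bounded_set D -> lipschitz_boundary D ->
  a != b -> segment a b `<=` frontier D -> 0 <= t0 <= 1 ->
  exists eta K : R, [/\ 0 < eta, 0 <= K & forall phi, C1 phi ->
    (\int[mu]_(t in ([set` `[0, 1]] `&` [set` `]t0 - eta, t0 + eta[])%R) ((phi (seg a b t)) ^+ 2)%:E
      <= (K * H1sqr D phi)%:E)%E].
Proof.
move=> oD bD lD ab sD t01.
have mD := open_measurable_plane oD.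
pose d := b - a.
have x0F : frontier D (seg a b t0) by apply: sD; exists t0.
have [c [s [h [cs lh /nbhs_ballP[rho /= rho0 Hrho]]]]] := lD _ x0F.
have [L L0 HL] : exists2 L : R, 0 < L & forall x y, `|h x - h y| <= L * `|x - y|.
  move: lh => [L [Lr HL]]; exists (`|L| + 1); first by rewrite ltr_wpDl.
  move=> x y; have := HL (`|L| + 1) _ (x, y); apply; last by [].
  by rewrite (le_lt_trans (ler_norm L))// ltrDl.
(* The shift along the segment and the sweep away from it each cost at most [delta] per coordinate,
   so swept points stay within 2 rho / 3 of the centre, in the ball where D is described by the
   graph. *)
pose delta := rho / 3; pose eta := rho / (3 * (`|d.1| + `|d.2| + 1)).
have den0 : 0 < `|d.1| + `|d.2| + 1 by rewrite ltr_wpDl// addr_ge0.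
have delta0 : 0 < delta by rewrite divr_gt0.
have eta0 : 0 < eta by rewrite divr_gt0// mulr_gt0.
have etaE : eta * (`|d.1| + `|d.2| + 1) = delta.
  by rewrite /eta /delta invfM mulrA -mulrA mulVf ?mulr1// gt_eqF.
have csl : `|c| <= 1 /\ `|s| <= 1.
  split; rewrite -(@expr_le1 _ 2)// real_normK ?num_real// -cs.
    by rewrite lerDl sqr_ge0.
  by rewrite lerDr sqr_ge0.
have [c1 s1] := csl.
pose e : R2 := (- s, c).
have inball t r : `|t - t0| < eta -> 0 <= r <= delta ->
    ball (seg a b t0) rho (seg a b t + r *: e).
  move=> tt /andP[r0 rd].
  have td1 : `|(t0 - t) * d.1| <= delta.
    rewrite normrM distrC -etaE; apply: ler_pM => //; first exact: ltW.
    by have := normr_ge0 d.2; lra.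
  have td2 : `|(t0 - t) * d.2| <= delta.
    rewrite normrM distrC -etaE; apply: ler_pM => //; first exact: ltW.
    by have := normr_ge0 d.1; lra.
  have rs : `|r * s| <= delta by rewrite normrM -[delta]mulr1 ler_pM// ger0_norm.
  have rc : `|r * c| <= delta by rewrite normrM -[delta]mulr1 ler_pM// ger0_norm.
  have rr : 3 * delta = rho by rewrite /delta; field.
  split; rewrite /= /ball/= /GRing.scale/=.
    have -> : a.1 + t0 * (b.1 - a.1) - (a.1 + t * (b.1 - a.1) + r * - s) =
      (t0 - t) * d.1 + r * s by rewrite /d/=; ring.
    by apply: le_lt_trans (ler_normD _ _) _; lra.
  have -> : a.2 + t0 * (b.2 - a.2) - (a.2 + t * (b.2 - a.2) + r * c) =
      (t0 - t) * d.2 - r * c by rewrite /d/=; ring.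
  by apply: le_lt_trans (ler_normB _ _) _; lra.
pose R1 (z : R2) := c * z.1 + s * z.2.
pose R2_ (z : R2) := c * z.2 - s * z.1.
(* A frontier point near the centre lies on the graph: it is not in D, so not strictly above, and it
   is a limit of points of D, so by continuity of [h] not below. *)
have onG t : 0 <= t <= 1 -> `|t - t0| < eta -> h (R1 (seg a b t)) = R2_ (seg a b t).
  move=> tI tt; have [cz nz] := frontierP oD (sD _ (ex_intro2 _ _ t tI erefl)).
  set z := seg a b t in cz nz *.
  have zb : ball (seg a b t0) rho z.
    have := inball t 0 tt; rewrite scale0r addr0; apply.
    by rewrite lexx ltW.
  apply/eqP; rewrite eq_le; apply/andP; split; last first.
    by rewrite leNgt; apply/negP => /(Hrho _ zb).
  apply/ler_addgt0Pr => eps eps0.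
  pose ep := eps / (2 * (L + 1)).
  have ep0 : 0 < ep by rewrite divr_gt0// mulr_gt0//; lra.
  have nb : nbhs z (ball (seg a b t0) rho `&` ball z ep).
    apply: filterI; last exact: nbhsx_ballx.
    by apply: open_nbhs_nbhs; split => //; exact: ball_open.
  have [w [Dw [wb [w1 w2]]]] := cz _ nb.
  have /(Hrho _ wb) hw := Dw.
  move: w1 w2; rewrite /ball/= => w1 w2.
  have E1 : `|R1 z - R1 w| <= 2 * ep.
    have -> : R1 z - R1 w = c * (z.1 - w.1) + s * (z.2 - w.2) by rewrite /R1; ring.
    apply: le_trans (ler_normD _ _) _; rewrite !normrM.
    have := ler_pM (normr_ge0 c) (normr_ge0 (z.1 - w.1)) c1 (ltW w1).
    have := ler_pM (normr_ge0 s) (normr_ge0 (z.2 - w.2)) s1 (ltW w2).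
    by lra.
  have E2 : `|R2_ w - R2_ z| <= 2 * ep.
    rewrite distrC.
    have -> : R2_ z - R2_ w = c * (z.2 - w.2) + (- s) * (z.1 - w.1) by rewrite /R2_; ring.
    apply: le_trans (ler_normD _ _) _; rewrite !normrM normrN.
    have := ler_pM (normr_ge0 s) (normr_ge0 (z.1 - w.1)) s1 (ltW w1).
    have := ler_pM (normr_ge0 c) (normr_ge0 (z.2 - w.2)) c1 (ltW w2).
    by lra.
  have := HL (R1 z) (R1 w); have := ler_wpM2l (ltW L0) E1.
  have := ler_norm (h (R1 z) - h (R1 w)); have := ler_norm (R2_ w - R2_ z).
  have epE : ep * (2 * (L + 1)) = eps by rewrite /ep divfK// gt_eqF// mulr_gt0//; lra.
  have hw' : h (R1 w) < R2_ w by [].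
  by move: hw'; nra.
have strip t r : 0 <= t <= 1 -> `|t - t0| < eta -> 0 < r <= delta -> D (seg a b t + r *: e).
  move=> tI tt /andP[r0 rd].
  have bz : ball (seg a b t0) rho (seg a b t + r *: e).
    by apply: inball => //; rewrite ltW.
  apply/(Hrho _ bz).
  have -> : c * (seg a b t + r *: e).1 + s * (seg a b t + r *: e).2 = R1 (seg a b t).
    by rewrite /R1 /e/= /GRing.scale/=; ring.
  have -> : c * (seg a b t + r *: e).2 - s * (seg a b t + r *: e).1 = R2_ (seg a b t) + r.
    rewrite /R2_ /e/= /GRing.scale/= -[X in _ = _ + X]mulr1 -cs; ring.
  by rewrite onG// ltrDl.
(* The segment is not parallel to the sweeping direction. Otherwise two of its points would share
   the abscissa [R1], hence, lying on the graph, the ordinate [R2_] too, and the segment would be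
   degenerate. *)
have det0 : d.1 * e.2 - d.2 * e.1 != 0.
  have -> : d.1 * e.2 - d.2 * e.1 = R1 d by rewrite /R1 /e/=; ring.
  apply/negP => /eqP R10.
  have [t1 [t1I t1t t1n]] : exists t1, [/\ 0 <= t1 <= 1, `|t1 - t0| < eta & t1 != t0].
    pose mm := Num.min (eta / 2) (1 / 2).
    have mm0 : 0 < mm by rewrite /mm lt_min !divr_gt0.
    have mme : mm < eta by rewrite /mm gt_min; apply/orP; left; lra.
    have mm1 : mm <= 1 / 2 by rewrite /mm ge_min lexx orbT.
    have [th|th] := leP t0 (1 / 2).
      exists (t0 + mm); split; first by apply/andP; split; lra.
        by rewrite addrAC subrr add0r gtr0_norm.
      by rewrite -subr_eq0 addrAC subrr add0r gt_eqF.
    exists (t0 - mm); split; first by apply/andP; split; lra.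
      by rewrite addrAC subrr add0r normrN gtr0_norm.
    by rewrite -subr_eq0 addrAC subrr add0r oppr_eq0 gt_eqF.
  have t00 : `|t0 - t0| < eta by rewrite subrr normr0.
  have := onG t1 t1I t1t; have := onG t0 t01 t00.
  have -> : R1 (seg a b t1) = R1 (seg a b t0) + (t1 - t0) * R1 d.
    by rewrite /R1 !segE /d/=; ring.
  rewrite R10 mulr0 addr0 => -> E.
  have : (t1 - t0) * R2_ d = 0.
    have -> : (t1 - t0) * R2_ d = R2_ (seg a b t1) - R2_ (seg a b t0).
      by rewrite /R2_ !segE /d/=; ring.
    by rewrite E subrr.
  move/eqP; rewrite mulf_eq0 subr_eq0 (negbTE t1n)/= => /eqP R20.
  have d10 : d.1 = 0.
    have -> : d.1 = (c ^+ 2 + s ^+ 2) * d.1 by rewrite cs mul1r.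
    have -> : (c ^+ 2 + s ^+ 2) * d.1 = c * R1 d - s * R2_ d by rewrite /R1 /R2_; ring.
    by rewrite R10 R20 !mulr0 subrr.
  have d20 : d.2 = 0.
    have -> : d.2 = (c ^+ 2 + s ^+ 2) * d.2 by rewrite cs mul1r.
    have -> : (c ^+ 2 + s ^+ 2) * d.2 = s * R1 d + c * R2_ d by rewrite /R1 /R2_; ring.
    by rewrite R10 R20 !mulr0 addr0.
  case/eqP: ab; move: d10 d20; rewrite /d /=.
  move/eqP; rewrite subr_eq0 => /eqP b1 /eqP; rewrite subr_eq0 => /eqP b2.
  by rewrite (surjective_pairing a) (surjective_pairing b) b1 b2.
pose De := d.1 * e.2 - d.2 * e.1.
exists eta, (`|De|^-1 * (delta^-1 + 1)); split => //.
  by rewrite mulr_ge0// ?invr_ge0// addr_ge0// invr_ge0 ltW.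
move=> phi Cphi; have [cphi dphi] := Cphi.
have [_ c0] := dphi 0; have [_ cc1] := dphi 1.
pose F z := (delta^-1 + 1) * phi z ^+ 2 +
   (partials [:: 0] phi z ^+ 2 + partials [:: 1] phi z ^+ 2).
have k0 : 0 < delta^-1 + 1 by rewrite addr_gt0// invr_gt0.
have F0 z : 0 <= F z.
  by rewrite addr_ge0// ?addr_ge0 ?sqr_ge0// mulr_ge0 ?sqr_ge0// ltW.
have cF : continuous F.
  move=> z; apply: cvgD; last by apply: cvgD; apply: cvg_sqr; [exact: c0|exact: cc1].
  by apply: cvgM; [exact: cvg_cst|apply: cvg_sqr; exact: cphi].
pose FF (z : R2) : \bar R := ((F \_ D) z)%:E.
have FF0 z : (0 <= FF z)%E by rewrite lee_fin patchE; case: ifP => // _; exact: F0.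
have mFF : measurable_fun setT (FF : mR2 -> \bar R).
  apply/measurable_EFinP/(measurable_restrictT _ mD); apply: measurable_funTS.
  exact: continuous_measurable_plane.
have pt t : 0 <= t <= 1 -> `|t - t0| < eta ->
    ((phi (seg a b t) ^+ 2)%:E <= \int[mu]_r FF (a + t *: d + r *: e)%R)%E.
  move=> tI tt.
  have dpsi (r : R) := C1_is_derive_line (seg a b t) e r Cphi.
  have cline : continuous (fun r : R => seg a b t + r *: e).
    by move=> r; apply: cvgD; [exact: cvg_cst|exact: cvgZr_tmp].
  have := trace_inequality_1d delta0 dpsi.
  rewrite scale0r addr0 => H.
  set g := (X in Rintegral _ _ X) in H.
  have {}H : phi (seg a b t) ^+ 2 <= (\int[mu]_(x in `[0%R, delta]) g x)%R.
    apply: H => r; apply: cvgD; apply: cvgM; try exact: cvg_cst.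
      by apply: continuous_comp; [exact: cline|exact: c0].
    by apply: continuous_comp; [exact: cline|exact: cc1].
  have g0 r : 0 <= g r.
    by apply: addr_ge0; [apply: mulr_ge0; [exact: ltW|exact: sqr_ge0]|exact: sqr_ge0].
  have cg : continuous g.
    move=> r; rewrite /g; apply: cvgD.
      apply: cvgM; first exact: cvg_cst.
      by apply: cvg_sqr; apply: continuous_comp; [exact: cline|exact: cphi].
    apply: cvg_sqr; apply: cvgD; apply: cvgM; try exact: cvg_cst.
      by apply: continuous_comp; [exact: cline|exact: c0].
    by apply: continuous_comp; [exact: cline|exact: cc1].
  have gi : mu.-integrable `[0, delta] (EFin \o g).
    apply: continuous_compact_integrable; first exact: segment_compact.
    exact: continuous_subspaceT.
  rewrite -lee_fin /Rintegral fineK in H; last exact: integrable_fin_num.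
  apply: le_trans H _.
  have mg : measurable_fun setT (g : measurableTypeR R -> R) by exact: continuous_measurable_fun.
  rewrite -integral_itv_obnd_cbnd; last exact/measurable_EFinP/measurable_funTS.
  have mFl : measurable_fun setT (fun r : measurableTypeR R => FF (a + t *: d + r *: e)).
    pose lin (r : measurableTypeR R) : mR2 := (a.1 + t * d.1 + r * e.1, a.2 + t * d.2 + r * e.2).
    have mlin : measurable_fun setT lin.
      apply: measurable_fun_pair; apply: continuous_measurable_fun => r;
        by apply: cvgD; [exact: cvg_cst|apply: cvgM; [exact: cvg_id|exact: cvg_cst]].
    exact: measurableT_comp mFF mlin.
  apply: (@le_trans _ _ (\int[mu]_(r in `]0%R, delta]) FF (a + t *: d + r *: e)%R)%E).
    apply: ge0_le_integral => //=.
    - by move=> r _; rewrite lee_fin; exact: g0.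
    - exact/measurable_EFinP/measurable_funTS.
    - exact: measurable_funTS.
    - move=> r; rewrite in_itv/= => rI; rewrite /FF patchE mem_set; last first.
        exact: strip.
      rewrite lee_fin /g /F lerD2l -/(seg a b t).
      set p := partials [:: 0] phi _; set q := partials [:: 1] phi _.
      (* Lagrange's identity with c^2 + s^2 = 1: the derivative in the direction (-s, c) is at most
         the length of the gradient. *)
      have := sqr_ge0 (s * q + c * p).
      have -> : (s * q + c * p) ^+ 2 = (c ^+ 2 + s ^+ 2) * (p ^+ 2 + q ^+ 2) - (- s * p + c * q) ^+ 2 by ring.
      by rewrite cs mul1r /e/= subr_ge0.
  apply: ge0_subset_integral => //.
have := ge0_integral_linear a mFF FF0 det0; rewrite -/De => lin.
pose mG := (fun t => \int[mu]_r FF (a + t *: d + r *: e)%R)%E.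
have mmG : measurable_fun setT (mG : measurableTypeR R -> \bar R).
  pose G (z : mR2) := FF (a + z.1 *: d + z.2 *: e).
  apply: (measurable_fun_fubini_tonelli_F G) => //; last by move=> z; exact: FF0.
  have := @measurable_plane R (fun z => a.1 + z.1 * d.1 + z.2 * e.1) (fun z => a.2 + z.1 * d.2 + z.2 * e.2).
  move=> /(_ (@continuous_affine2 R _ _ _) (@continuous_affine2 R _ _ _)) ml.
  exact: measurableT_comp mFF ml.
have mJ : measurable ([set` `[0, 1]] `&` [set` `]t0 - eta, t0 + eta[] : set (measurableTypeR R)).
  exact: measurableI.
apply: (@le_trans _ _ (\int[mu]_(t in ([set` `[0, 1]] `&` [set` `]t0 - eta, t0 + eta[])%R) mG t)%E).
  apply: ge0_le_integral => //.
  - by move=> t _; rewrite lee_fin sqr_ge0.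
  - apply/measurable_EFinP/measurable_funTS.
    have cps : continuous (fun t : R => phi (seg a b t) ^+ 2).
      move=> t; apply: cvg_sqr.
      by apply: continuous_comp; [exact: continuous_seg|exact: cphi].
    exact: continuous_measurable_fun.
  - exact: measurable_funTS.
  - move=> t [/=]; rewrite !in_itv/= => tI /andP[tt1 tt2]; apply: pt => //.
    by rewrite ltr_norml; apply/andP; split; lra.
apply: (@le_trans _ _ (\int[mu]_t mG t)%E).
  by apply: ge0_subset_integral => // t _; apply: integral_ge0.
rewrite /mG lin.
have -> : (\int[area R]_z FF z = \int[area R]_(z in D) (F z)%:E)%E.
  by rewrite [RHS]integral_mkcond; apply: eq_integral => z _; rewrite /FF !patchE; case: ifP.
have EF := integral_weighted_sqr mD bD (ltW k0) cphi c0 cc1.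
rewrite -/F in EF.
rewrite EF -EFinM lee_fin -mulrA ler_wpM2l ?invr_ge0//.
rewrite /H1sqr sum_ord2 mulrDr lerD2l ler_peMl//.
  by rewrite addr_ge0// sqr_ge0.
by rewrite lerDr invr_ge0 ltW.
Qed.

(** Compactness of the parameter interval selects finitely many local estimates, whose constants add
    up. *)
Lemma trace_inequality D (a b : R2) :
  open D -> bounded_set D -> lipschitz_boundary D ->
  a != b -> segment a b `<=` frontier D ->
  exists2 K : R, 0 <= K & forall phi, C1 phi ->
    norm2 (length R) [set` `[0, 1]] (fun t => phi (seg a b t)) ^+ 2 <= K * H1sqr D phi.
Proof.
move=> oD bD lD ab sD.
have /choice[f Hf] : forall t0 : R, exists p : R * R, 0 <= t0 <= 1 ->
    [/\ 0 < p.1, 0 <= p.2 & forall phi, C1 phi ->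
    (\int[mu]_(t in ([set` `[0, 1]] `&` [set` `]t0 - p.1, t0 + p.1[])%R) ((phi (seg a b t)) ^+ 2)%:E
      <= (p.2 * H1sqr D phi)%:E)%E].
  move=> t0; have [t01|t01] := boolP (0 <= t0 <= 1); last by exists (0, 0).
  by have [eta [K H]] := local_trace_inequality oD bD lD ab sD t01; exists (eta, K).
pose J t0 : set R := [set` `]t0 - (f t0).1, t0 + (f t0).1[].
have := @segment_compact R 0 1; rewrite compact_cover.
case/(_ R [set` `[0, 1]] J) => [t0 _|t0 t01|I ID IJ].
- exact: interval_open.
- exists t0 => //; rewrite /J /= in_itv/=.
  by have [f0 _ _] := Hf t0 t01; rewrite ltrBlDr !ltrDl f0.
pose Is : seq R := finmap.enum_fset I.
have HI (t0 : R) : t0 \in Is -> 0 <= t0 <= 1 by move=> /ID; rewrite inE.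
exists (\sum_(t0 <- Is) (f t0).2).
  rewrite big_seq; apply: sumr_ge0 => t0 /HI tI.
  by have [] := Hf _ tI.
move=> phi Cphi; have [cphi _] := Cphi.
have cps : continuous (fun t : R => phi (seg a b t)).
  by move=> t; apply: continuous_comp; [exact: continuous_seg|exact: cphi].
have cps2 : continuous (fun t : R => phi (seg a b t) ^+ 2).
  by move=> t; apply: cvg_sqr; exact: cps.
have mp : measurable_fun setT (fun t : measurableTypeR R => phi (seg a b t) ^+ 2).
  exact: continuous_measurable_fun.
have mA t0 : measurable ([set` `[0, 1]] `&` J t0 : set (measurableTypeR R)).
  by rewrite /J; exact: measurableI.
rewrite -lee_fin -integral_sqr_norm2//; last exact: continuous_in_L2_I01.
pose G t0 t := ((phi (seg a b t) ^+ 2) * \1_([set` `[0, 1]] `&` J t0) t)%:E.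
have mG t0 : measurable_fun setT (G t0 : measurableTypeR R -> \bar R).
  by apply/measurable_EFinP; apply: measurable_funM => //; exact: measurable_indic.
have G0 t0 t : (0 <= G t0 t)%E by rewrite lee_fin mulr_ge0 ?sqr_ge0// indicE.
have iG t0 : (\int[mu]_t G t0 t = \int[mu]_(t in ([set` `[0, 1]] `&` J t0)%R) (phi (seg a b t) ^+ 2)%:E)%E.
  rewrite [RHS]integral_mkcond; apply: eq_integral => t _.
  by rewrite /G indicE patchE; case: ifPn => tI; rewrite ?mulr1 ?mulr0.
apply: (@le_trans _ _ (\sum_(t0 <- Is) \int[mu]_t G t0 t)%E).
  rewrite -ge0_integral_sum// integral_mkcond; apply: ge0_le_integral => //.
  - by move=> t _; rewrite patchE; case: ifP => // _; rewrite lee_fin sqr_ge0.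
  - have mI : measurable ([set` `[0, 1]] : set (measurableTypeR R)) by exact: measurable_itv.
    apply/(measurable_restrictT (fun t : measurableTypeR R => (phi (seg a b t) ^+ 2)%:E) mI).
    exact/measurable_EFinP/measurable_funTS.
  - exact: emeasurable_sum.
  - move=> t _; rewrite patchE; case: ifPn => [/set_mem tI|_]; last exact: sume_ge0.
    have [t0 /= t0I t0J] := IJ _ tI.
    rewrite (big_rem _ t0I)/= -[leLHS]adde0; apply: leeD; last exact: sume_ge0.
    by rewrite /G indicE mem_set ?mulr1.
rewrite mulr_suml -sumEFin !big_seq; apply: lee_sum => t0 /HI t0I.
by rewrite iG; have [_ _ ] := Hf _ t0I; apply.
Qed.

End TraceInequality.

(** * Weak derivatives *)

Section OneVariableSmooth.
Variable R : realType.
Implicit Types (f g : R -> R) (p : {poly R}).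

Local Notation der f := (derive1 (f : R -> R)).

Fixpoint diffn (n : nat) f : Prop :=
  if n is m.+1 then (forall x : R, derivable f x 1) /\ diffn m (der f) else True.

Definition smooth1 f := forall n, diffn n f.

Lemma diffnS n : forall f, diffn n.+1 f -> diffn n f.
Proof. by elim: n => [//|n IH] f [df /IH]. Qed.

Lemma diffnD n : forall f g, diffn n f -> diffn n g -> diffn n (fun x => f x + g x).
Proof.
elim: n => [//|n IH] f g [df nf] [dg ng]; split; first by move=> x; apply: derivableD.
have -> : der (fun x => f x + g x) = (fun x => (der f) x + (der g) x).
  by apply/funext => x; rewrite !derive1E (deriveD (df x) (dg x)).
exact: IH.
Qed.

Lemma diffnM n : forall f g, diffn n f -> diffn n g -> diffn n (fun x => f x * g x).
Proof.
elim: n => [//|n IH] f g Hf Hg; have [df nf] := Hf; have [dg ng] := Hg.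
split; first by move=> x; apply: derivableM.
have -> : der (fun x => f x * g x) = (fun x => f x * (der g) x + g x * (der f) x).
  by apply/funext => x; rewrite !derive1E (deriveM (df x) (dg x)).
by apply: diffnD; apply: IH => //; exact: diffnS.
Qed.

Lemma diffn_cst n (c : R) : diffn n (fun=> c).
Proof.
elim: n c => [//|n IH] c; split; first by move=> x; exact: derivable_cst.
have -> : der (fun=> c) = (fun=> 0).
  by apply/funext => x; rewrite derive1E derive_cst.
exact: IH.
Qed.

Lemma is_derive_affine f (a b x d : R) : is_derive (a * x + b) 1 f d ->
  is_derive x 1 (fun y => f (a * y + b)) (d * a).
Proof.
move=> df.
have H : is_derive x 1 ((a *: (@id R)) + cst b) (a *: 1 + 0) by apply: is_deriveD.
rewrite addr0 [_ *: 1]mulr1 in H.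
exact: (@is_derive1_comp _ f (fun y => a * y + b) x d a).
Qed.

Lemma diffn_affine n (a b : R) : forall f, diffn n f -> diffn n (fun x => f (a * x + b)).
Proof.
elim: n => [//|n IH] f [df nf].
have H (x : R) : is_derive x 1 (fun y => f (a * y + b)) ((der f) (a * x + b) * a).
  by apply: is_derive_affine; split => //; rewrite derive1E.
split; first by move=> x; have [] := H x.
have -> : der (fun x => f (a * x + b)) = (fun x => (der f) (a * x + b) * a).
  by apply/funext => x; rewrite [LHS]derive1E; have [_ ->] := H x.
by apply: diffnM; [exact: IH|exact: diffn_cst].
Qed.

Lemma smooth1_derive f : smooth1 f -> smooth1 (der f).
Proof. by move=> sf n; have [] := sf n.+1. Qed.

Lemma smooth1_is_derive f (x : R) : smooth1 f -> is_derive x 1 f ((der f) x).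
Proof. by move=> /(_ 1)[df _]; split => //; rewrite derive1E. Qed.

Lemma smooth1_continuous f : smooth1 f -> continuous f.
Proof.
move=> sf x; apply: differentiable_continuous; apply/derivable1_diffP.
by have [] := smooth1_is_derive x sf.
Qed.

(** For p = 1 the classical smooth function exp(-1/x), extended by 0. The polynomial factor in 1/x
    makes the family stable under differentiation. *)
Definition flat p (x : R) : R := if 0 < x then p.[x^-1] * expR (- x^-1) else 0.

(** Each monomial y^i is at most i! exp(y), being i! times a term of the exponential series. *)
Lemma poly_expR_bounded p : exists2 C : R, 0 <= C &
  forall y, 0 <= y -> `|p.[y]| * expR (- y) <= C.
Proof.
exists (\sum_(i < size p) `|p`_i| * i`!%:R).
  by apply: sumr_ge0 => i _; rewrite mulr_ge0.
move=> y y0; rewrite horner_coef.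
apply: le_trans (ler_wpM2r (expR_ge0 _) (ler_norm_sum _ _ _)) _.
rewrite mulr_suml; apply: ler_sum => i _; rewrite normrM -mulrA ler_wpM2l//.
rewrite ger0_norm ?exprn_ge0// expRN ler_pdivrMr ?expR_gt0//.
case: i => -[_|i _] /=; first by rewrite expr0 fact0 mul1r -expR0 ler_expR.
have := expR_ge1Dxn i y0; have f0 : 0 < i.+1`!%:R :> R by rewrite ltr0n fact_gt0.
move=> H; rewrite mulrC -ler_pdivrMr//; apply: le_trans H.
by rewrite lerDr.
Qed.

(** Away from 0 the chain rule in 1/x produces the polynomial. At 0 from the right, the difference
    quotient is h times the bounded quantity (1/h)^2 p(1/h) exp(-1/h). *)
Lemma is_derive_flat p (x : R) :
  is_derive x 1 (flat p) (flat ('X^2 * (p - p^`())) x).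
Proof.
have [x0|x0|x0] := ltgtP 0 x.
- have H : is_derive x 1 (fun y => p.[y^-1] * expR (- y^-1)) (flat ('X^2 * (p - p^`())) x).
    have xn : x != 0 by rewrite gt_eqF.
    have Hi : is_derive x 1 (fun y : R => y^-1) (- x ^- 2).
      have := is_deriveV xn (is_derive_id x 1).
      by rewrite /GRing.scale/= mulr1.
    have Hp := @is_derive1_comp _ (horner p) (fun y : R => y^-1) x _ _ (is_derive_poly p _) Hi.
    have He : is_derive x 1 (fun y : R => expR (- y^-1)) (expR (- x^-1) * (x ^- 2)).
      have Hn : is_derive x 1 (fun y : R => - y^-1) (- - x ^- 2) by apply: is_deriveN.
      rewrite opprK in Hn.
      exact: (@is_derive1_comp _ expR (fun y : R => - y^-1) x _ _ (is_derive_expR _) Hn).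
    have -> : flat ('X^2 * (p - p^`())) x = p.[x^-1] *: (expR (- x^-1) * x ^- 2) +
        expR (- x^-1) *: (p^`().[x^-1] * - x ^- 2).
      rewrite /flat x0 !hornerE /GRing.scale/= exprVn; ring.
    exact: is_deriveM.
  apply: near_eq_is_derive H; near=> y; rewrite /flat ifT//.
  by near: y; exact: lt_nbhsr.
- have -> : flat ('X^2 * (p - p^`())) x = 0 by rewrite /flat ifN// -leNgt ltW.
  have H : is_derive x 1 (cst 0 : R -> R) 0 by exact: is_derive_cst.
  apply: near_eq_is_derive H; near=> y; rewrite /flat ifN// -leNgt ltW//.
  by near: y; exact: lt_nbhsl.
- rewrite -x0 /flat ltxx.
  have [C C0 HC] := poly_expR_bounded ('X^2 * p).
  have H : (fun h => h^-1 *: ((flat p \o shift 0) (h *: 1) - flat p 0)) @ 0^' --> (0 : R).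
    apply/cvgrPdist_le => e e0; near=> h.
    rewrite sub0r normrN /= addr0 /GRing.scale/= mulr1 /flat ltxx subr0.
    have h0 : h != 0 by near: h; exact: nbhs_dnbhs_neq.
    case: ifPn => [hp|_]; last by rewrite mulr0 normr0 ltW.
    have Hh := HC h^-1 (ltW _); rewrite invr_gt0 in Hh.
    have {}Hh := Hh hp.
    have hC : h * C <= e.
      have : `|h| <= e / (C + 1).
        by near: h; apply: dnbhs0_le; rewrite divr_gt0// ltr_wpDl.
      rewrite gtr0_norm// ler_pdivlMr ?ltr_wpDl//.
      by move=> hh; apply: le_trans hh; rewrite ler_wpM2l ?lerDl// ltW.
    apply: le_trans hC; rewrite -ler_pdivrMl//.
    apply: le_trans Hh; rewrite !hornerE !normrM (ger0_norm (expR_ge0 _)).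
    have hi : `|h^-1| = h^-1 by rewrite gtr0_norm ?invr_gt0.
    by rewrite hi !mulrA.
  by split; [apply/cvg_ex; exists 0|exact/cvg_lim].
Unshelve. all: by end_near.
Qed.

Lemma smooth1_flat p : smooth1 (flat p).
Proof.
move=> n; elim: n p => [//|n IH] p; split; first by move=> x; have [] := is_derive_flat p x.
have -> : der (flat p) = flat ('X^2 * (p - p^`())).
  by apply/funext => x; rewrite derive1E; have [_ ->] := is_derive_flat p x.
exact: IH.
Qed.

(** Vanishes outside the open interval between a and b and takes values in [0, 1]; the steepening
    factor n makes it tend to the indicator of that interval. *)
Definition bump (a b : R) (n : nat) (t : R) : R :=
  flat 1 (n%:R * t + - (n%:R * a)) * flat 1 ((- n%:R) * t + n%:R * b).

Lemma smooth1_bump a b n : smooth1 (bump a b n).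
Proof.
by move=> m; apply: diffnM; apply: diffn_affine; exact: smooth1_flat.
Qed.

Lemma flat1_01 x : 0 <= flat 1 x <= 1.
Proof.
rewrite /flat; case: ifPn => [x0|_]; last by rewrite lexx ler01.
rewrite hornerC mul1r expR_ge0/= expR_le1 oppr_le0 invr_ge0 ltW//.
Qed.

Lemma bump_01 a b n t : 0 <= bump a b n t <= 1.
Proof.
have /andP[x0 x1] := flat1_01 (n%:R * t + - (n%:R * a)).
have /andP[y0 y1] := flat1_01 ((- n%:R) * t + n%:R * b).
by rewrite /bump mulr_ge0//= -[leRHS]mulr1 ler_pM.
Qed.

Lemma bump_out a b n t : ~~ (a < t < b) -> bump a b n t = 0.
Proof.
rewrite negb_and -!leNgt /bump /flat => /orP[ta|bt].
  rewrite ifN ?mul0r// -leNgt -mulrN -mulrDr mulr_ge0_le0// subr_le0//.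
rewrite [X in _ * X]ifN ?mulr0// -leNgt mulNr -mulrN -mulrDr mulr_ge0_le0//.
by rewrite addrC subr_le0.
Qed.

Lemma flat1_cvg (s : R) (u : nat -> R) : 0 < s -> (forall n, u n = n%:R * s) ->
  (fun n => flat 1 (u n)) @ \oo --> (1 : R).
Proof.
move=> s0 uE.
have H : (fun n : nat => expR (- (n.+1%:R * s)^-1)) @ \oo --> (expR 0 : R).
  have Hc : (fun n : nat => - (n.+1%:R * s)^-1) @ \oo --> (0 : R).
    have -> : (fun n : nat => - (n.+1%:R * s)^-1) = (fun n : nat => (- s^-1) * n.+1%:R^-1).
      by apply/funext => n; rewrite invfM mulNr mulrC.
    have -> : (0 : R) = (- s^-1) * 0 by rewrite mulr0.
    by apply: cvgM; [exact: cvg_cst|exact: cvg_harmonic].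
  exact: (cvg_comp _ _ Hc (@continuous_expR R 0)).
rewrite expR0 in H.
have : (fun n : nat => flat 1 (u (n + 1)%N)) @ \oo --> (1 : R).
  apply: cvg_trans H; apply: near_eq_cvg; apply: nearW => n.
  by rewrite uE addn1 /flat mulr_gt0// hornerC mul1r.
by rewrite (cvg_shiftn 1 (fun n => flat 1 (u n))).
Qed.

Lemma bump_cvg a b t : (fun n => bump a b n t) @ \oo --> (\1_([set` `]a, b[]) t : R).
Proof.
have [tab|tab] := boolP (a < t < b); last first.
  rewrite indicE memNset//=; last by rewrite in_itv/=; exact/negP.
  rewrite (_ : (fun n => _) = (fun=> 0)); first exact: cvg_cst.
  by apply/funext => n; exact: bump_out.
have /andP[at_ tb] := tab.
rewrite indicE mem_set//= -[X in _ --> X]mulr1; apply: cvgM.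
  by apply: (@flat1_cvg (t - a)) => [|n]; [rewrite subr_gt0|ring].
by apply: (@flat1_cvg (b - t)) => [|n]; [rewrite subr_gt0|ring].
Qed.

End OneVariableSmooth.

(** * Products of one-variable functions as test functions *)

Section TensorTest.
Variable R : realType.
Local Notation R2 := (R * R)%type.
Local Notation mR2 := (measurableTypeR R * measurableTypeR R)%type.

Local Notation der f := (derive1 (f : R -> R)).

Definition tensor (f g : R -> R) (x : R2) : R := f x.1 * g x.2.

Lemma is_derive_tensor (f g : R -> R) (x : R2) i : smooth1 f -> smooth1 g ->
  is_derive x (basis_vec R i) (tensor f g)
    (if i == 0 then tensor (der f) g x else tensor f (der g) x).
Proof.
move=> sf sg.
have H0 : is_derive x (basis_vec R 0) (tensor f g) (tensor (der f) g x).
  rewrite basis_vec0.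
  have [d E] := smooth1_is_derive x.1 sf.
  have Eq : (fun h => h^-1 *: ((tensor f g \o shift x) (h *: (1, 0)) - tensor f g x)) =
      (fun h => (h^-1 *: ((f \o shift x.1) (h *: 1) - f x.1)) * g x.2).
    apply/funext => h; rewrite /tensor /=.
    by rewrite scaler0 add0r /GRing.scale/= -mulrBl mulrA.
  have Hc : (fun h => (h^-1 *: ((f \o shift x.1) (h *: 1) - f x.1)) * g x.2) @ 0^' -->
      tensor (der f) g x.
    by apply: cvgM; [rewrite -E; exact: d|exact: cvg_cst].
  by split; [rewrite /derivable Eq; apply/cvg_ex; eexists; exact: Hc|rewrite /derive Eq; exact/cvg_lim].
case: (eqVneq i 0) => [->//|i0].
have {i i0}-> : i = 1 by apply/val_inj; case: i i0 => -[|[|]].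
rewrite basis_vec1.
have [d E] := smooth1_is_derive x.2 sg.
have Eq : (fun h => h^-1 *: ((tensor f g \o shift x) (h *: (0, 1)) - tensor f g x)) =
    (fun h => f x.1 * (h^-1 *: ((g \o shift x.2) (h *: 1) - g x.2))).
  apply/funext => h; rewrite /tensor /=.
  by rewrite scaler0 add0r /GRing.scale/= -mulrBr mulrCA.
have Hc : (fun h => f x.1 * (h^-1 *: ((g \o shift x.2) (h *: 1) - g x.2))) @ 0^' -->
    tensor f (der g) x.
  by apply: cvgM; [exact: cvg_cst|rewrite -E; exact: d].
by split; [rewrite /derivable Eq; apply/cvg_ex; eexists; exact: Hc|rewrite /derive Eq; exact/cvg_lim].
Qed.

Lemma partial_tensor (f g : R -> R) i : smooth1 f -> smooth1 g ->
  partials [:: i] (tensor f g) = if i == 0 then tensor (der f) g else tensor f (der g).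
Proof.
move=> sf sg; apply/funext => x; rewrite /=.
by have [_ ->] := is_derive_tensor x i sf sg; case: ifP.
Qed.

Lemma partials_tensor s : forall f g : R -> R, smooth1 f -> smooth1 g ->
  exists f' g', [/\ smooth1 f', smooth1 g' & partials s (tensor f g) = tensor f' g'].
Proof.
elim: s => [|i s IH] f g sf sg; first by exists f, g.
have [f' [g' [sf' sg' E]]] := IH _ _ sf sg.
rewrite /= -/(partials s (tensor f g)) E -[X in exists _ _, [/\ _, _ & X = _]]/(partials [:: i] (tensor f' g')).
rewrite partial_tensor//; case: ifP => _; [exists (der f'), g'|exists f', (der g')];
  by split => //; exact: smooth1_derive.
Qed.

Lemma continuous_tensor (f g : R -> R) : smooth1 f -> smooth1 g -> continuous (tensor f g).
Proof.
move=> /smooth1_continuous cf /smooth1_continuous cg x; apply: cvgM.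
  by apply: continuous_comp; [exact: cvg_fst|exact: cf].
by apply: continuous_comp; [exact: cvg_snd|exact: cg].
Qed.

Lemma smooth_tensor (f g : R -> R) : smooth1 f -> smooth1 g -> smooth (tensor f g).
Proof.
move=> sf sg s; have [f' [g' [sf' sg' ->]]] := partials_tensor s sf sg.
split; first exact: continuous_tensor.
by move=> x i; have [] := is_derive_tensor x i sf' sg'.
Qed.

Lemma partials_tensorC i j (f g : R -> R) : smooth1 f -> smooth1 g ->
  partials [:: i; j] (tensor f g) = partials [:: j; i] (tensor f g).
Proof.
move=> sf sg; have sf' := smooth1_derive sf; have sg' := smooth1_derive sg.
have E k l : partials [:: k; l] (tensor f g) = partials [:: k] (partials [:: l] (tensor f g)) by [].
rewrite !E !partial_tensor//.
by case: ifP => ei; case: ifP => ej; rewrite !partial_tensor// ?ei ?ej.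
Qed.

Definition closed_box (a b c d : R) : set R2 := [set` `[a, b]] `*` [set` `[c, d]].
Definition open_box (a b c d : R) : set R2 := [set` `]a, b[] `*` [set` `]c, d[].

Lemma test_tensor (D : set R2) (a b c d : R) n m : closed_box a b c d `<=` D ->
  test_function D (tensor (bump a b n) (bump c d m)).
Proof.
move=> bD; split; first by apply: smooth_tensor; exact: smooth1_bump.
exists (closed_box a b c d); split => //.
  by apply: compact_setX; exact: segment_compact.
move=> x nx; rewrite /tensor.
have [x1|/bump_out->] := boolP (a < x.1 < b); last by rewrite mul0r.
have [x2|/bump_out->] := boolP (c < x.2 < d); last by rewrite mulr0.
case: nx; split; rewrite /= in_itv/=.
  by have /andP[/ltW-> /ltW->] := x1.
by have /andP[/ltW-> /ltW->] := x2.
Qed.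

End TensorTest.

(** * The fundamental lemma of the calculus of variations *)

Section FundamentalLemma.
Variable R : realType.
Local Notation R2 := (R * R)%type.
Local Notation mR2 := (measurableTypeR R * measurableTypeR R)%type.
Variables (D : set R2) (g : R2 -> R).
Hypothesis oD : open D.
Hypothesis Lg : in_L2 (area R) D g.
Hypothesis Dg : forall f1 f2 : R -> R, smooth1 f1 -> smooth1 f2 ->
  test_function D (tensor f1 f2) -> inner (area R) D g (tensor f1 f2) = 0.

Let mD : measurable (D : set mR2) := open_measurable_plane oD.

Lemma measurable_open_box (a b c d : R) : measurable (open_box a b c d : set mR2).
Proof. by apply: measurableX; exact: measurable_itv. Qed.

Lemma bounded_open_box (a b c d : R) : bounded_set (open_box a b c d).
Proof.
exists (`|a| + `|b| + `|c| + `|d|); split; first exact: num_real.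
move=> M HM x [/=]; rewrite !in_itv/= => /andP[x1 x2] /andP[x3 x4].
rewrite prod_normE ge_max !ler_norml.
have := ler_norm a; have := ler_norm b; have := ler_norm c; have := ler_norm d.
have := ler_norm (- a); have := ler_norm (- b); have := ler_norm (- c); have := ler_norm (- d).
rewrite !normrN; have := normr_ge0 a; have := normr_ge0 b; have := normr_ge0 c.
by have := normr_ge0 d; move=> *; apply/andP; split; apply/andP; split; lra.
Qed.

Lemma integrable_open_box (a b c d : R) : closed_box a b c d `<=` D ->
  (area R).-integrable (open_box a b c d) (EFin \o g).
Proof.
move=> bD; set Q := open_box a b c d.
have mQ : measurable (Q : set mR2) by exact: measurable_open_box.
have QD : Q `<=` D.
  move=> x [/=]; rewrite !in_itv/= => /andP[x1 x2] /andP[x3 x4]; apply: bD.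
  by split; rewrite /= in_itv/= !ltW.
have LQ : in_L2 (area R) Q g.
  have [mg gi] := (in_L2P (area R) mD g).1 Lg.
  apply/in_L2P => //; split; first exact: measurable_funS mg.
  apply: le_lt_trans gi; apply: ge0_subset_integral => //.
    exact/measurable_EFinP/measurable_funX.
  by move=> x _; rewrite lee_fin sqr_ge0.
have L1 : in_L2 (area R) Q (fun=> 1).
  by apply: continuous_in_L2 => //; [exact: bounded_open_box|exact: cst_continuous].
have := in_L2_integrable_mul mQ LQ L1; apply: eq_integrable => // x _ /=.
by rewrite mulr1.
Qed.

(** Tensor products of bump functions tend to the indicator of the open box; dominated convergence
    applies with the integrable bound |g|. *)
Lemma integral_box0 (a b c d : R) : closed_box a b c d `<=` D ->
  (\int[area R]_(x in open_box a b c d) (g x)%:E = 0)%E.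
Proof.
move=> bD; set Q := open_box a b c d.
have mQ : measurable (Q : set mR2) by exact: measurable_open_box.
have QD : Q `<=` D.
  move=> x [/=]; rewrite !in_itv/= => /andP[x1 x2] /andP[x3 x4]; apply: bD.
  by split; rewrite /= in_itv/= !ltW.
pose phi n := tensor (bump a b n) (bump c d n).
have phi01 n x : 0 <= phi n x <= 1.
  have /andP[p0 p1] := bump_01 a b n x.1; have /andP[q0 q1] := bump_01 c d n x.2.
  by rewrite /phi /tensor mulr_ge0//= -[leRHS]mulr1 ler_pM.
have phiQ n x : ~ Q x -> phi n x = 0.
  move=> nQ; rewrite /phi /tensor.
  have [x1|/bump_out->] := boolP (a < x.1 < b); last by rewrite mul0r.
  have [x2|/bump_out->] := boolP (c < x.2 < d); last by rewrite mulr0.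
  by case: nQ; split; rewrite /= in_itv/=.
have mg : measurable_fun Q g by apply: measurable_funS (in_L2_measurable mD Lg).
have mphi n : measurable_fun setT (phi n : mR2 -> R).
  by apply: continuous_measurable_plane; apply: continuous_tensor; exact: smooth1_bump.
have gi := integrable_open_box bD.
have [_ _ H] := @dominated_convergence _ _ _ (area R) Q mQ
  (fun n x => (g x * phi n x)%:E) (EFin \o g) (fun x => `|(g x)%:E|)%E
  (fun n => ltac:(apply/measurable_EFinP; apply: measurable_funM => //; exact: measurable_funTS))
  ltac:(exact/measurable_EFinP)
  ltac:(apply: nearW => x [x1 x2]; apply/cvg_EFin; [exact: nearW|];
     rewrite /comp /= -[X in _ --> X]mulr1; apply: cvgM; [exact: cvg_cst|];
     rewrite /phi /tensor -[X in _ --> X]mulr1; apply: cvgM;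
     [have := @bump_cvg R a b x.1|have := @bump_cvg R c d x.2];
     by rewrite indicE mem_set)
  ltac:(exact: integrable_abse gi)
  ltac:(apply: nearW => x n _; have /andP[p0 p1] := phi01 n x;
        by rewrite /= lee_fin normrM (ger0_norm p0) ler_piMr).
have E n : (\int[area R]_(x in Q) (g x * phi n x)%:E = 0)%E.
  have tphi : test_function D (phi n) by exact: test_tensor.
  have ci : continuous (phi n) by apply: continuous_tensor; exact: smooth1_bump.
  have H0 := Dg (@smooth1_bump R a b n) (@smooth1_bump R c d n) tphi.
  have gphi : (area R).-integrable Q (EFin \o (fun x => g x * phi n x)).
    apply: le_integrable gi => //.
      by apply/measurable_EFinP; apply: measurable_funM => //; exact: measurable_funTS.
    move=> x _ /=; have /andP[p0 p1] := phi01 n x.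
    by rewrite lee_fin normrM (ger0_norm p0) ler_piMr.
  have EQ : (\int[area R]_(x in Q) (g x * phi n x)%:E = \int[area R]_(x in D) (g x * phi n x)%:E)%E.
    rewrite [LHS]integral_mkcond [RHS]integral_mkcond; apply: eq_integral => x _.
    rewrite !patchE; case: ifPn => [/set_mem /QD Dx|/negP nQ]; first by rewrite mem_set.
    by rewrite phiQ ?mulr0 ?if_same// => Qx; apply: nQ; rewrite inE.
  have fin : (\int[area R]_(x in Q) (g x * phi n x)%:E)%E \is a fin_num.
    exact: integrable_fin_num.
  by rewrite -(fineK fin) EQ; move: H0; rewrite /inner /Rintegral => ->.
have H0 : (fun n => (\int[area R]_(x in Q) (g x * phi n x)%:E)%E) @ \oo --> (0 : \bar R)%E.
  by rewrite (_ : (fun n => _) = fun=> 0%E); [exact: cvg_cst|apply/funext => n; exact: E].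
exact: (cvg_unique _ H H0).
Qed.

Definition itvoo_or_all : set (set R) := [set A | (exists x y : R, A = [set` `]x, y[]) \/ A = setT].

Lemma plane_measurable_generated :
  @measurable _ mR2 = <<s [set A `*` B | A in itvoo_or_all & B in itvoo_or_all] >>.
Proof.
have E : <<s (@ocitv R) >> = <<s itvoo_or_all >>.
  rewrite -[LHS]/((R.-ocitv.-measurable).-sigma.-measurable) RGenOpens.measurableE.
  apply/seteqP; split.
    apply: smallest_sub; first exact: smallest_sigma_algebra.
    by move=> A [x [y ->]]; apply: sub_sigma_algebra; left; exists x, y.
  apply: smallest_sub; first exact: smallest_sigma_algebra.
  move=> A [[x [y ->]]|->]; first by apply: sub_sigma_algebra; exists x, y.
  have [S0 SC _] := @smallest_sigma_algebra _ setT (@RGenOpens.G R).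
  by rewrite -[X in _ X](setD0 setT); exact: SC.
set G := [set A `*` B | A in _ & B in _].
have mfst : measurable_fun setT (fst : g_sigma_algebraType G -> measurableTypeR R).
  apply: (measurability _ E) => _ [A Ai <-]; apply: sub_sigma_algebra.
  by exists A => //; exists setT; [right|apply/seteqP; split=> [x []|x []]].
have msnd : measurable_fun setT (snd : g_sigma_algebraType G -> measurableTypeR R).
  apply: (measurability _ E) => _ [A Ai <-]; apply: sub_sigma_algebra.
  by exists setT; [right|exists A => //; apply/seteqP; split=> [x []|x []]].
have itvm A : itvoo_or_all A -> measurable (A : set (measurableTypeR R)).
  by move=> [[p [q ->]]|->]; [exact: measurable_itv|exact: measurableT].
apply/seteqP; split.
  apply: smallest_sub; first exact: smallest_sigma_algebra.
  by move=> _ [[A mA <-]|[A mA <-]]; [exact: mfst|exact: msnd].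
apply: smallest_sub; first exact: sigma_algebra_measurable.
by move=> _ [A /itvm mA [B /itvm mB <-]]; exact: measurableX.
Qed.

(** The measurable sets over whose intersection with the box g integrates to 0 form a Dynkin system
    that contains the rectangles, a generator stable under intersection. So they are all the
    measurable sets. *)
Lemma ae_box0 (a b c d : R) : closed_box a b c d `<=` D ->
  {ae area R, forall x, open_box a b c d x -> g x = 0}.
Proof.
move=> bD; set Q := open_box a b c d.
have mQ : measurable (Q : set mR2) by exact: measurable_open_box.
have gi := integrable_open_box bD; rewrite -/Q in gi.
have giS A : measurable (A : set mR2) -> (area R).-integrable (Q `&` A) (EFin \o g).
  by move=> mA; apply: integrableS gi => //; exact: measurableI.
pose P (A : set mR2) := (\int[area R]_(x in Q `&` A) (g x)%:E = 0)%E.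
have HP A : measurable A -> P A.
  move=> mA; have := @dynkin_induction _ mR2 _ P plane_measurable_generated.
  apply; last by rewrite -plane_measurable_generated.
  - move=> _ _ [A1 A1i [A2 A2i <-]] [B1 B1i [B2 B2i <-]].
    have cl (C1 C2 : set R) : itvoo_or_all C1 -> itvoo_or_all C2 -> itvoo_or_all (C1 `&` C2).
      case=> [[x [y ->]]|->]; last by rewrite setTI.
      case=> [[x' [y' ->]]|->]; last by rewrite setIT; left; exists x, y.
      left; exists (Num.max x x'), (Num.min y y').
      apply/seteqP; split=> z /=; rewrite !in_itv/= gt_max lt_min.
        by move=> [/andP[-> ->] /andP[-> ->]].
      by move=> /andP[/andP[-> ->] /andP[-> ->]].
    by exists (A1 `&` B1); [exact: cl|exists (A2 `&` B2); [exact: cl|rewrite setXI]].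
  - by rewrite /P setIT; exact: integral_box0.
  - move=> _ [A1 A1i [A2 A2i <-]].
    have cl (p q : R) (C : set R) : itvoo_or_all C ->
       exists p' q', [/\ p <= p', q' <= q & [set` `]p, q[] `&` C = [set` `]p', q'[]].
      case=> [[x [y ->]]|->]; last by exists p, q; rewrite setIT.
      exists (Num.max p x), (Num.min q y); rewrite le_max lexx ge_min lexx; split => //.
      apply/seteqP; split=> z /=; rewrite !in_itv/= gt_max lt_min.
        by move=> [/andP[-> ->] /andP[-> ->]].
      by move=> /andP[/andP[-> ->] /andP[-> ->]].
    have [a' [b' [aa' bb' E1]]] := cl a b _ A1i.
    have [c' [d' [cc' dd' E2]]] := cl c d _ A2i.
    rewrite /P /Q /open_box -setXI E1 E2; apply: integral_box0.
    move=> x [/=]; rewrite !in_itv/= => /andP[x1 x2] /andP[x3 x4]; apply: bD.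
    by split; rewrite /= in_itv/=; apply/andP; split; lra.
  - move=> A0 mA0 PA0; rewrite /P.
    have EU : Q = (Q `&` A0) `|` (Q `&` ~` A0) by rewrite -setIUr setUv setIT.
    have := integral_box0 bD; rewrite -/Q [X in integral _ X _]EU.
    rewrite integral_setU//; last 4 first.
    - exact: measurableI.
    - by apply: measurableI => //; exact: measurableC.
    - by rewrite -EU; exact: measurable_int gi.
    - by apply/disj_setPS => x [[_ ?] [_ ?]].
    by rewrite PA0 add0e.
  - move=> F mF tF PF; rewrite /P setI_bigcupr.
    rewrite integral_bigcup.
    - by rewrite eseries0// => i _ _; exact: PF.
    - exact: trivIset_setIl.
    - by move=> k; exact: measurableI.
    - by rewrite -setI_bigcupr; apply: giS; exact: bigcupT_measurable.
have : ae_eq (area R) Q (EFin \o g) (cst 0%E).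
  apply: integral_ae_eq => // E EQ mE.
  have -> : E = Q `&` E by rewrite setIC; apply/esym/setIidPl.
  by rewrite integral_cst ?mul0e; [exact: HP|exact: measurableI].
by apply: filterS => x H /H/= [].
Qed.

(* Tensor products of bump functions suffice, and on these the partial
   derivatives commute for free. *)
Lemma fundamental_lemma : {ae area R, forall x, D x -> g x = 0}.
Proof.
(* Countably many closed boxes with rational centres, restricted to those inside D, have open cores
   covering D, so their exceptional null sets suffice. *)
pose box (q : rat * rat * nat) : set R2 := closed_box (ratr q.1.1 - q.2.+1%:R^-1)
  (ratr q.1.1 + q.2.+1%:R^-1) (ratr q.1.2 - q.2.+1%:R^-1) (ratr q.1.2 + q.2.+1%:R^-1).
pose N (q : rat * rat * nat) : set R2 := [set x | box q `<=` D /\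
   open_box (ratr q.1.1 - q.2.+1%:R^-1)
  (ratr q.1.1 + q.2.+1%:R^-1) (ratr q.1.2 - q.2.+1%:R^-1) (ratr q.1.2 + q.2.+1%:R^-1) x /\ g x <> 0].
have Nneg q : (area R).-negligible (N q).
  have [bD|nbD] := pselect (box q `<=` D).
    have := ae_box0 bD; apply: negligibleS => x [_ [xb gx]] /= H.
    exact/gx/H.
  rewrite (_ : N q = set0); first exact: negligible_set0.
  by apply/seteqP; split=> // x [].
have HU : (area R).-negligible (\bigcup_k (if unpickle k is Some q then N q else set0)).
  apply: negligible_bigcup => k; case: (unpickle k) => [q|]; first exact: Nneg.
  exact: negligible_set0.
apply: negligibleS HU => x /= /not_implyP[Dx gx].
have [e /= e0 xe] : nbhs_ball x D by apply/nbhs_ballP; exact: oD.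
have [n ne] : exists n : nat, n.+1%:R^-1 < e / 3 :> R.
  have [n _ Hn] := near_infty_natSinv_lt (PosNum (divr_gt0 e0 (ltr0n _ 3))).
  by exists n; apply: (Hn n) => /=.
have n0 : 0 < n.+1%:R^-1 :> R by rewrite invr_gt0.
set dd := n.+1%:R^-1 : R in ne n0 *.
have near_rat (y : R) : exists q : rat, y - dd < ratr q /\ ratr q < y.
  have [|q /[!in_itv]/= /andP[q1 q2]] := @rat_in_itvoo R (y - dd) y.
    by rewrite ltrBlDr ltrDl.
  by exists q.
have [q1 [xq1 xq1']] := near_rat x.1; have [q2 [xq2 xq2']] := near_rat x.2.
have Nx : N (q1, q2, n) x.
  split; last first.
    by split => //; split; rewrite /= in_itv/= -/dd; apply/andP; split; lra.
  move=> y [/=]; rewrite !in_itv/= -/dd => /andP[y1 y2] /andP[y3 y4]; apply: xe.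
  by split; rewrite /= /ball/= ltr_norml; apply/andP; split; lra.
by exists (pickle (q1, q2, n)); [exact: I|move: Nx; rewrite -[unpickle _]/(unpickle (pickle (q1, q2, n))) pickleK].
Qed.

End FundamentalLemma.

(** * Norms, inner products and linear combinations under convergence in L2 *)

Section SquareIntegrableLimits.
Context (R : realType) (d : measure_display) (X : measurableType d).
Variables (mu : {measure set X -> \bar R}) (D : set X).
Hypothesis mD : measurable D.
Local Notation L2 := (in_L2 mu D).
Local Notation ip := (inner mu D).
Local Notation nm := (norm2 mu D).

Lemma cvg0_dominated (a b : nat -> R) : (forall n, 0 <= a n <= b n) ->
  b @ \oo --> (0 : R) -> a @ \oo --> (0 : R).
Proof.
move=> ab b0; apply: (@squeeze_cvgr _ _ _ _ (fun=> 0) b) => //.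
  by apply: nearW.
exact: cvg_cst.
Qed.

Lemma cvg_to0_dominated (a b : nat -> R) (l : R) : (forall n, `|a n - l| <= b n) ->
  b @ \oo --> (0 : R) -> a @ \oo --> l.
Proof.
move=> ab b0; have : (fun n => `|a n - l|) @ \oo --> (0 : R).
  by apply: cvg0_dominated b0 => n; rewrite normr_ge0 ab.
move/norm_cvg0P => H; have -> : a = (fun n => (a n - l) + l).
  by apply/funext => n; rewrite subrK.
by rewrite -[X in _ --> X]add0r; apply: cvgD; [exact: H|exact: cvg_cst].
Qed.

Lemma cvg_norm2 (f_ : nat -> X -> R) f : (forall n, L2 (f_ n)) -> L2 f ->
  (fun n => nm (fun x => f_ n x - f x)) @ \oo --> (0 : R) ->
  (fun n => nm (f_ n)) @ \oo --> nm f.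
Proof.
by move=> Lf_ Lf; apply: cvg_to0_dominated => n; exact: norm2_dist.
Qed.

Lemma cvg_inner (f_ g_ : nat -> X -> R) f g :
  (forall n, L2 (f_ n)) -> L2 f -> (forall n, L2 (g_ n)) -> L2 g ->
  (fun n => nm (fun x => f_ n x - f x)) @ \oo --> (0 : R) ->
  (fun n => nm (fun x => g_ n x - g x)) @ \oo --> (0 : R) ->
  (fun n => ip (f_ n) (g_ n)) @ \oo --> ip f g.
Proof.
move=> Lf_ Lf Lg_ Lg cf cg.
pose b n := nm (fun x => f_ n x - f x) * nm (g_ n) + nm f * nm (fun x => g_ n x - g x).
apply: (@cvg_to0_dominated _ b) => [n|].
  have -> : ip (f_ n) (g_ n) - ip f g =
     ip (fun x => f_ n x - f x) (g_ n) + ip f (fun x => g_ n x - g x).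
    by rewrite innerBl// innerBr// addrA subrK.
  apply: le_trans (ler_normD _ _) _; apply: lerD; apply: inner_CS => //; exact: in_L2B.
rewrite -[X in _ --> X](_ : 0 * nm g + nm f * 0 = 0); last by ring.
by apply: cvgD; apply: cvgM => //; [exact: cvg_norm2|exact: cvg_cst].
Qed.

Lemma cvg_dist_lincomb (a b : R) (f_ g_ : nat -> X -> R) f g :
  (forall n, L2 (f_ n)) -> L2 f -> (forall n, L2 (g_ n)) -> L2 g ->
  (fun n => nm (fun x => f_ n x - f x)) @ \oo --> (0 : R) ->
  (fun n => nm (fun x => g_ n x - g x)) @ \oo --> (0 : R) ->
  (fun n => nm (fun x => (a * f_ n x + b * g_ n x) - (a * f x + b * g x))) @ \oo --> (0 : R).
Proof.
move=> Lf_ Lf Lg_ Lg cf cg.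
apply: (@cvg0_dominated _ (fun n => `|a| * nm (fun x => f_ n x - f x) +
    `|b| * nm (fun x => g_ n x - g x))) => [n|].
  rewrite norm2_ge0/=.
  have Lf1 : L2 (fun x => f_ n x - f x) by exact: in_L2B.
  have Lg1 : L2 (fun x => g_ n x - g x) by exact: in_L2B.
  rewrite -!norm2Z//.
  apply: le_trans (norm2D _ (in_L2Z _ _ Lf1) (in_L2Z _ _ Lg1)) => //.
  by rewrite le_eqVlt; apply/orP; left; apply/eqP; apply: eq_norm2 => x _; ring.
rewrite -[X in _ --> X](_ : `|a| * 0 + `|b| * 0 = 0); last by ring.
by apply: cvgD; apply: cvgM => //; exact: cvg_cst.
Qed.

Lemma ae_mono (P Q : X -> Prop) : ae_in mu D P -> (forall x, D x -> P x -> Q x) ->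
  ae_in mu D Q.
Proof. by rewrite /ae_in => H PQ; move: H; apply: filterS => x H Dx; exact: PQ (H Dx). Qed.

Lemma ae_mono2 (P1 P2 Q : X -> Prop) : ae_in mu D P1 -> ae_in mu D P2 ->
  (forall x, D x -> P1 x -> P2 x -> Q x) -> ae_in mu D Q.
Proof.
rewrite /ae_in => H1 H2 PQ; move: H1 H2; apply: filterS2 => x H1 H2 Dx.
exact: PQ (H1 Dx) (H2 Dx).
Qed.

Lemma ae_all (P : X -> Prop) : (forall x, D x -> P x) -> ae_in mu D P.
Proof. by move=> H; apply: nearW. Qed.

Lemma in_L2_lincomb (a b : R) f g : L2 f -> L2 g -> L2 (fun x => a * f x + b * g x).
Proof. by move=> Lf Lg; apply: in_L2D => //; exact: in_L2Z. Qed.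

Lemma inner_lincombl (a b : R) f g h : L2 f -> L2 g -> L2 h ->
  ip (fun x => a * f x + b * g x) h = a * ip f h + b * ip g h.
Proof.
move=> Lf Lg Lh; rewrite innerDl//; [|exact: in_L2Z|exact: in_L2Z].
by rewrite !innerZl.
Qed.

End SquareIntegrableLimits.

(** * Uniqueness, linearity, closedness and symmetry of weak derivatives *)

Section WeakDerivatives.
Variable R : realType.
Local Notation R2 := (R * R)%type.
Local Notation mR2 := (measurableTypeR R * measurableTypeR R)%type.
Variable D : set R2.
Hypotheses (oD : open D) (bD : bounded_set D).
Implicit Types (v w g h phi : R2 -> R) (s : seq 'I_2).
Local Notation L2 := (in_L2 (area R) D).
Local Notation ip := (inner (area R) D).
Local Notation nm := (norm2 (area R) D).
Let mD : measurable (D : set mR2) := open_measurable_plane oD.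

Lemma partials_out (K : set R2) phi s : closed K ->
  (forall x, ~ K x -> phi x = 0) -> forall x, ~ K x -> partials s phi x = 0.
Proof.
move=> cK; elim: s => [//|i s IH] phi0 x nKx /=.
have H : is_derive x (basis_vec R i) (cst 0 : R2 -> R) 0 by exact: is_derive_cst.
have [_ <-] : is_derive x (basis_vec R i) (partials s phi) 0; last by [].
apply: near_eq_is_derive H.
have : nbhs x (~` K) by apply: open_nbhs_nbhs; split => //; exact: closed_openC.
by apply: filterS => y /IH ->.
Qed.

Lemma test_function_partials s phi : test_function D phi -> test_function D (partials s phi).
Proof.
move=> [sphi [K [cK KD phi0]]]; split; first exact: smooth_partials.
exists K; split => // x; apply: partials_out => //.
by apply: compact_closed => //; exact: norm_hausdorff.
Qed.

Lemma smooth_in_L2 phi : smooth phi -> L2 phi.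
Proof. by move=> /smooth_C1[c _]; exact: continuous_in_L2. Qed.

Lemma test_in_L2 phi : test_function D phi -> L2 phi.
Proof. by move=> [/smooth_in_L2]. Qed.

Lemma test_measurable s phi : test_function D phi -> measurable_fun D (partials s phi : mR2 -> R).
Proof. by move/(test_function_partials s)/test_in_L2/(in_L2_measurable mD). Qed.

Lemma ae_eq_0_test g h : L2 g -> L2 h ->
  (forall f1 f2 : R -> R, smooth1 f1 -> smooth1 f2 ->
    test_function D (tensor f1 f2) -> ip g (tensor f1 f2) = ip h (tensor f1 f2)) ->
  ae_in (area R) D (fun x => g x = h x).
Proof.
move=> Lg Lh H.
have := @fundamental_lemma R D (fun x => g x - h x) oD (in_L2B mD Lg Lh).
have /[swap]/[apply] : forall f1 f2 : R -> R, smooth1 f1 -> smooth1 f2 ->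
    test_function D (tensor f1 f2) -> ip (fun x => g x - h x) (tensor f1 f2) = 0.
  move=> f1 f2 s1 s2 t; have Lt := test_in_L2 t.
  by rewrite innerBl// H// subrr.
by move=> H0; apply: (ae_mono H0) => x _ /eqP; rewrite subr_eq0 => /eqP.
Qed.

Lemma is_wderiv_unique s v g h : is_wderiv D s v g -> is_wderiv D s v h ->
  ae_in (area R) D (fun x => g x = h x).
Proof.
move=> [Lg Hg] [Lh Hh]; apply: ae_eq_0_test => // f1 f2 _ _ t.
have := Hg _ t; rewrite Hh// => /esym; apply: mulfI.
by rewrite signr_eq0.
Qed.

Lemma wderivP s v g : is_wderiv D s v g -> is_wderiv D s v (wderiv D s v).
Proof. by move=> H; exact: (@xgetI _ _ (fun g => is_wderiv D s v g) g). Qed.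

Lemma wderiv_eq s v g : is_wderiv D s v g -> ae_in (area R) D (fun x => wderiv D s v x = g x).
Proof. by move=> H; exact: is_wderiv_unique (wderivP H) H. Qed.

Lemma Hk_wderiv k s v : Hk k D v -> (size s <= k)%N -> is_wderiv D s v (wderiv D s v).
Proof. by move=> [_ H] /H [g /wderivP]. Qed.

Lemma Hk_wderiv_L2 k s v : Hk k D v -> (size s <= k)%N -> L2 (wderiv D s v).
Proof. by move=> Hv /(Hk_wderiv Hv)[]. Qed.

Lemma is_wderiv_nil v : L2 v -> is_wderiv D [::] v v.
Proof. by move=> Lv; split => // phi _; rewrite mul1r. Qed.

Lemma is_wderiv_lincomb (a b : R) s v w g h : L2 v -> L2 w ->
  is_wderiv D s v g -> is_wderiv D s w h ->
  is_wderiv D s (fun x => a * v x + b * w x) (fun x => a * g x + b * h x).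
Proof.
move=> Lv Lw [Lg Hg] [Lh Hh]; split; first exact: in_L2_lincomb.
move=> phi t; have Lt := test_in_L2 t.
have Lts := test_in_L2 (test_function_partials s t).
by rewrite !inner_lincombl// Hg// Hh//; ring.
Qed.

Lemma Hk_lincomb (a b : R) k v w : Hk k D v -> Hk k D w ->
  Hk k D (fun x => a * v x + b * w x).
Proof.
move=> Hv Hw; split; first by apply: in_L2_lincomb => //; [exact: Hv.1|exact: Hw.1].
move=> s sk; exists (fun x => a * wderiv D s v x + b * wderiv D s w x).
apply: is_wderiv_lincomb; [exact: Hv.1|exact: Hw.1| |]; exact: Hk_wderiv sk.
Qed.

Lemma wderiv_lincomb (a b : R) k s v w : Hk k D v -> Hk k D w -> (size s <= k)%N ->
  ae_in (area R) D (fun x => wderiv D s (fun x => a * v x + b * w x) x =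
     a * wderiv D s v x + b * wderiv D s w x).
Proof.
move=> Hv Hw sk; apply: wderiv_eq.
by apply: is_wderiv_lincomb; [exact: Hv.1|exact: Hw.1| |]; exact: Hk_wderiv sk.
Qed.

(** [wderiv] is a choice from the set of all weak derivatives. Functions equal almost everywhere
    have the same such set, so the choices are equal as functions, not only almost everywhere. *)
Lemma ae_wderiv s v w : L2 v -> L2 w -> ae_in (area R) D (fun x => v x = w x) ->
  wderiv D s v = wderiv D s w.
Proof.
move=> Lv Lw vw; rewrite /wderiv; congr xget; apply/funext => g; apply/propext.
have E phi : test_function D phi -> ip v (partials s phi) = ip w (partials s phi).
  move=> t; have mt := test_measurable s t.
  apply: (ae_eq_inner mD (in_L2_measurable mD Lv) (in_L2_measurable mD Lw) mt mt vw).
  exact: nearW.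
by split=> -[Lg H]; split=> // phi t; rewrite -H// E.
Qed.

Lemma ae_Hk k v w : L2 v -> L2 w -> ae_in (area R) D (fun x => v x = w x) ->
  Hk k D v -> Hk k D w.
Proof.
move=> Lv Lw vw [_ H]; split => // s sk; exists (wderiv D s w).
have [g vg] := H s sk; have [Lg Hg] := wderivP vg; rewrite -(ae_wderiv s Lv Lw vw).
split => // phi t; rewrite -Hg//; have mt := test_measurable s t.
have wv : ae_in (area R) D (fun x => w x = v x) by apply: (ae_mono vw) => x _ ->.
apply: (ae_eq_inner mD (in_L2_measurable mD Lw) (in_L2_measurable mD Lv) mt mt wv).
exact: nearW.
Qed.

Lemma is_wderiv_cvg s (v_ g_ : nat -> R2 -> R) v g :
  (forall n, L2 (v_ n)) -> L2 v -> L2 g -> (forall n, is_wderiv D s (v_ n) (g_ n)) ->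
  (fun n => nm (fun x => v_ n x - v x)) @ \oo --> (0 : R) ->
  (fun n => nm (fun x => g_ n x - g x)) @ \oo --> (0 : R) ->
  is_wderiv D s v g.
Proof.
move=> Lv_ Lv Lg Hn cv cg; split => // phi t.
have Lt := test_in_L2 t; have Lts := test_in_L2 (test_function_partials s t).
have c0 f : (fun n : nat => nm (fun x => f x - f x)) @ \oo --> (0 : R).
  rewrite (_ : (fun n => _) = fun=> 0); first exact: cvg_cst.
  apply/funext => n; rewrite -(norm2_0 (area R) mD).
  by apply: eq_norm2 => x _; rewrite subrr.
have c1 := cvg_inner mD Lv_ Lv (fun=> Lts) Lts cv (c0 _).
have c2 := cvg_inner mD (fun n => (Hn n).1) Lg (fun=> Lt) Lt cg (c0 _).
apply: (cvg_unique _ c1); first exact: Rhausdorff.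
rewrite /=.
have -> : (fun n => ip (v_ n) (partials s phi)) = (fun n => (-1) ^+ size s * ip (g_ n) phi).
  by apply/funext => n; rewrite (Hn n).2.
by apply: cvgM c2; exact: cvg_cst.
Qed.

(** [partials] applies the last index of the list first. By duality the order is reversed on v: the
    head of the list is the first derivative taken of v. *)
Lemma is_wderiv_comp i j v g h : is_wderiv D [:: j] v g -> is_wderiv D [:: j; i] v h ->
  is_wderiv D [:: i] g h.
Proof.
move=> [Lg Hg] [Lh Hh]; split => // phi t.
have := Hg _ (test_function_partials [:: i] t).
rewrite partials_cat Hh//= !exprS expr0 !mulr1 !mulN1r opprK mul1r => ->.
by rewrite opprK.
Qed.

(** It is enough to test with tensor products, whose mixed partial derivatives commute. *)
Lemma is_wderivC i j v g h : is_wderiv D [:: i; j] v g -> is_wderiv D [:: j; i] v h ->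
  ae_in (area R) D (fun x => g x = h x).
Proof.
move=> [Lg Hg] [Lh Hh]; apply: ae_eq_0_test => // f1 f2 s1 s2 t.
have := Hg _ t; rewrite (partials_tensorC i j s1 s2) Hh//=.
by rewrite sqrrN expr1n !mul1r => ->.
Qed.

Lemma wderiv_comp i j v : Hk 2 D v ->
  is_wderiv D [:: i] (wderiv D [:: j] v) (wderiv D [:: j; i] v).
Proof. by move=> Hv; apply: is_wderiv_comp; exact: Hk_wderiv Hv _. Qed.

Lemma Hk1_wderiv j v : Hk 2 D v -> Hk 1 D (wderiv D [:: j] v).
Proof.
move=> Hv; split; first exact: Hk_wderiv_L2 Hv _.
move=> [|i [|//]] _; last by exists (wderiv D [:: j; i] v); exact: wderiv_comp.
by exists (wderiv D [:: j] v); apply: is_wderiv_nil; exact: Hk_wderiv_L2 Hv _.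
Qed.

Lemma HkS k l v : (k <= l)%N -> Hk l D v -> Hk k D v.
Proof. by move=> kl [Lv H]; split => // s sk; apply: H; exact: leq_trans kl. Qed.

Lemma hessian_sym v : Hk 2 D v -> ae_in (area R) D (fun x => Defs.is_sym (hessian D v x)).
Proof.
move=> Hv.
have H := is_wderivC (@Hk_wderiv 2 [:: 0%R; 1%R] v Hv isT)
  (@Hk_wderiv 2 [:: 1%R; 0%R] v Hv isT).
apply: (ae_mono H) => x Dx Hx; apply/matrixP => i j; rewrite !mxE.
have o01 (k : 'I_2) : k = 0 \/ k = 1.
  by case: k => -[|[|//]] p; [left|right]; apply/val_inj.
by case: (o01 i) => ->; case: (o01 j) => ->; [reflexivity|exact: esym Hx|exact: Hx|reflexivity].
Qed.

Lemma C1_in_L2 phi : C1 phi -> L2 phi /\ forall i, L2 (partials [:: i] phi).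
Proof. by move=> [c dphi]; split=> [|i]; apply: continuous_in_L2 => //; have [] := dphi i. Qed.

Lemma integral_partialM i phi psi : C1 phi -> C1 psi ->
  (\int[area R]_(z in D) partials [:: i] (fun x => (phi x * psi x)%R) z)%R =
  ip phi (partials [:: i] psi) + ip (partials [:: i] phi) psi.
Proof.
move=> c1 c2; have [Lp dp] := C1_in_L2 c1; have [Lq dq] := C1_in_L2 c2.
rewrite [X in _ = _ + X]innerC /inner -RintegralD//; try exact: in_L2_integrable_mul.
by apply: eq_Rintegral => x _; rewrite partialM.
Qed.

(** The product with a test function vanishes on the boundary segments, so the bound by boundary
    integrals makes the integral of its derivative zero. Duality reverses the order of the indices,
    and the reversal is kept because the partial derivatives of a [smooth] function are not assumed
    to commute. *)
Lemma smooth_is_wderiv E s phi : frontier_in D E ->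
  (forall e, e \in E -> e.1 != e.2 -> segment e.1 e.2 `<=` frontier D) ->
  smooth phi -> is_wderiv D s phi (partials (rev s) phi).
Proof.
move=> frE segE sphi; split; first by apply: smooth_in_L2; exact: smooth_partials.
have [K K0 HK] := integral_partial_frontier oD bD frE.
elim: s phi sphi => [|i s IH] phi sphi psi t; first by rewrite mul1r.
have tp := test_function_partials s t; have [sp [Q [cQ QD p0]]] := tp.
have Lp := test_in_L2 tp.
have -> : ip phi (partials (i :: s) psi) = - ip (partials [:: i] phi) (partials s psi).
  have H := HK i (fun x => phi x * partials s psi x)
    (C1M (smooth_C1 sphi) (smooth_C1 sp)).
  have {}H : (\int[area R]_(z in D) partials [:: i] (fun x => (phi x * partials s psi x)%R) z)%R = 0.
    apply/eqP; rewrite -normr_le0; apply: le_trans H _.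
    rewrite big1_seq ?mulr0// => e /andP[e12 eE].
      transitivity (\int[length R]_(t in [set` `[0%R, 1%R]]) (0 : R))%R.
      apply: eq_Rintegral => tt /set_mem tI.
      have [_ nD] := frontierP oD (segE e eE e12 _ (ex_intro2 _ _ tt tI erefl)).
      by rewrite p0 ?mulr0 ?normr0// => /QD.
    by rewrite Rintegral_cst ?mul0r//; exact: measurable_itv.
  rewrite integral_partialM// in H; try exact: smooth_C1.
  by apply/eqP; rewrite -addr_eq0; apply/eqP.
rewrite (IH _ (smooth_partials [:: i] sphi) _ t).
rewrite exprS mulN1r rev_cons -cats1 mulNr.
by rewrite -[partials (rev s ++ _) phi]partials_cat.
Qed.

End WeakDerivatives.

(** * Traces, Green's formula and completeness of [H20] *)

Lemma cvg0_sum (R : realType) (I : eqType) (r : seq I) (P : pred I) (F : I -> nat -> R) :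
  (forall i, i \in r -> P i -> F i @ \oo --> (0 : R)) ->
  (fun n => \sum_(i <- r | P i) F i n) @ \oo --> (0 : R).
Proof.
elim: r => [|i r IH] H.
  rewrite (_ : (fun n => _) = fun=> 0); first exact: cvg_cst.
  by apply/funext => n; rewrite big_nil.
have {}IH : (fun n => \sum_(i <- r | P i) F i n) @ \oo --> (0 : R).
  by apply: IH => j jr; apply: H; rewrite inE jr orbT.
have [Pi|nPi] := boolP (P i); last first.
  by rewrite (_ : (fun n => _) = (fun n => \sum_(i <- r | P i) F i n))//;
     apply/funext => n; rewrite big_cons (negbTE nPi).
rewrite (_ : (fun n => _) = (fun n => F i n + \sum_(i <- r | P i) F i n)); last first.
  by apply/funext => n; rewrite big_cons Pi.
by rewrite -[X in _ --> X]addr0; apply: cvgD => //; apply: H => //; rewrite inE eqxx.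
Qed.

Lemma integral_normM_le (R : realType) (d : measure_display) (X : measurableType d)
    (mu : {measure set X -> \bar R}) (D : set X) (f g : X -> R) : measurable D ->
  in_L2 mu D f -> in_L2 mu D g ->
  (\int[mu]_(x in D) `|f x * g x| <= norm2 mu D f * norm2 mu D g)%R.
Proof.
move=> mD Lf Lg.
have L2n h : in_L2 mu D h -> in_L2 mu D (fun x => `|h x|) /\
    norm2 mu D (fun x => `|h x|) = norm2 mu D h.
  move=> Lh; split.
    apply: (in_L2_dominated mD _ Lh).
      by apply: measurableT_comp => //; exact: in_L2_measurable Lh.
    by apply: nearW => x _; rewrite normr_id.
  congr Num.sqrt; apply: eq_Rintegral => x _.
  by rewrite -normrM ger0_norm// -expr2 sqr_ge0.
have [Lf' <-] := L2n _ Lf; have [Lg' <-] := L2n _ Lg.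
have := inner_CS mD Lf' Lg'; apply: le_trans.
apply: le_trans (ler_norm _); rewrite le_eqVlt; apply/orP; left; apply/eqP.
by apply: eq_Rintegral => x _; rewrite normrM.
Qed.

Lemma ler_of_sqr (R : realDomainType) (a b : R) : 0 <= b -> a ^+ 2 <= b ^+ 2 -> a <= b.
Proof.
move=> b0 H; rewrite leNgt; apply/negP => ba.
by have := ltr_pM b0 b0 ba ba; rewrite -!expr2 ltNge H.
Qed.

Lemma ler_of_sqr_mul (R : realDomainType) (a b : R) : 0 <= a -> 0 <= b ->
  a ^+ 2 <= a * b -> a <= b.
Proof.
move=> a0 b0; have [->//|an0] := eqVneq a 0.
by rewrite expr2 ler_pM2l// lt0r an0.
Qed.

Section ClampedFunctions.
Variable R : realType.
Local Notation R2 := (R * R)%type.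
Local Notation mR2 := (measurableTypeR R * measurableTypeR R)%type.
Local Notation I01 := [set` `[0%R : R, 1%R]].
Variables (D : set R2) (E : seq (R2 * R2)).
Hypotheses (oD : open D) (bD : bounded_set D) (lD : lipschitz_boundary D).
Hypothesis frE : frontier D = [set x | exists2 e, e \in E & segment e.1 e.2 x].
Implicit Types (v w g h phi psi : R2 -> R) (s : seq 'I_2).
Local Notation L2 := (in_L2 (area R) D).
Local Notation ip := (inner (area R) D).
Local Notation nm := (norm2 (area R) D).
Local Notation nm1 := (norm2 (length R) I01).
Local Notation wd := (wderiv D).
Let mD : measurable (D : set mR2) := open_measurable_plane oD.
Let mI : measurable (I01 : set (measurableTypeR R)).
Proof. exact: measurable_itv. Qed.

Let Lsm phi (sp : smooth phi) : L2 phi := smooth_in_L2 oD bD sp.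
Let Lsmd phi i (sp : smooth phi) : L2 (partials [:: i] phi) :=
  smooth_in_L2 oD bD (smooth_partials [:: i] sp).

Lemma polygonal_frontier_in : frontier_in D E.
Proof.
move=> z cz nz; have : frontier D z by split => // /interior_subset.
by rewrite frE.
Qed.

Lemma polygonal_segment e : e \in E -> segment e.1 e.2 `<=` frontier D.
Proof. by move=> eE x xe; rewrite frE; exists e. Qed.

Definition H1dist phi v : R :=
  nm (fun x => phi x - v x) ^+ 2 +
  \sum_i nm (fun x => partials [:: i] phi x - wd [:: i] v x) ^+ 2.

(** Convergence in H1 with the derivatives of the limit as a parameter: linear combinations and
    limits have natural weak derivatives that agree with [wderiv] only almost everywhere. *)
Definition H1approx (phi : nat -> R2 -> R) v (dv : 'I_2 -> R2 -> R) : Prop :=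
  [/\ forall n, smooth (phi n),
      (fun n => nm (fun x => phi n x - v x)) @ \oo --> (0 : R) &
      forall i, (fun n => nm (fun x => partials [:: i] (phi n) x - dv i x))
           @ \oo --> (0 : R)].

Lemma ae_H1approx (phi : nat -> R2 -> R) v w (dv dw : 'I_2 -> R2 -> R) :
  L2 v -> L2 w -> (forall i, L2 (dv i)) -> (forall i, L2 (dw i)) ->
  ae_in (area R) D (fun x => v x = w x) ->
  (forall i, ae_in (area R) D (fun x => dv i x = dw i x)) ->
  H1approx phi v dv -> H1approx phi w dw.
Proof.
move=> Lv Lw Ldv Ldw vw dvw [sphi cv cdv]; split=> // [|i].
  rewrite (_ : (fun n => _) = (fun n => nm (fun x => phi n x - v x)))//.
  apply/funext => n; have Ln := smooth_in_L2 oD bD (sphi n).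
  apply: (ae_eq_norm2 mD (in_L2_measurable mD (in_L2B mD Ln Lw))
     (in_L2_measurable mD (in_L2B mD Ln Lv))).
  by apply: (ae_mono vw) => x _ ->.
rewrite (_ : (fun n => _) = (fun n => nm (fun x => partials [:: i] (phi n) x - dv i x)))//.
apply/funext => n; have Ln := smooth_in_L2 oD bD (smooth_partials [:: i] (sphi n)).
apply: (ae_eq_norm2 mD (in_L2_measurable mD (in_L2B mD Ln (Ldw i)))
   (in_L2_measurable mD (in_L2B mD Ln (Ldv i)))).
by apply: (ae_mono (dvw i)) => x _ ->.
Qed.

Lemma H1approx_lincomb (a b : R) (phi psi : nat -> R2 -> R) v w (dv dw : 'I_2 -> R2 -> R) :
  L2 v -> L2 w -> (forall i, L2 (dv i)) -> (forall i, L2 (dw i)) ->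
  H1approx phi v dv -> H1approx psi w dw ->
  H1approx (fun n x => a * phi n x + b * psi n x) (fun x => a * v x + b * w x)
    (fun i x => a * dv i x + b * dw i x).
Proof.
move=> Lv Lw Ldv Ldw [sp cp cdp] [sq cq cdq].
have Ls f (sf : forall n : nat, smooth (f n)) n := Lsm (sf n).
have Lds f i (sf : forall n : nat, smooth (f n)) n := Lsmd i (sf n).
split=> [n||i].
- exact: smooth_lincomb.
- exact: (cvg_dist_lincomb mD a b (Ls _ sp) Lv (Ls _ sq) Lw cp cq).
- rewrite (_ : (fun n => _) = (fun n => nm (fun x => (a * partials [:: i] (phi n) x +
     b * partials [:: i] (psi n) x) - (a * dv i x + b * dw i x)))); last first.
    by apply/funext => n; rewrite partials_lincomb.
  exact: (cvg_dist_lincomb mD a b (Lds _ i sp) (Ldv i) (Lds _ i sq) (Ldw i) (cdp i) (cdq i)).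
Qed.

Lemma trace_approx v g : is_trace D v g -> exists phi : nat -> R2 -> R,
  H1approx phi v (fun i => wd [:: i] v) /\
  forall a b, a != b -> segment a b `<=` frontier D -> in_L2 (length R) I01 (g \o seg a b) /\
    (fun n => nm1 (fun t => phi n (seg a b t) - g (seg a b t))) @ \oo --> (0 : R).
Proof. by move=> [phi [sp cp cdp H]]; exists phi; split. Qed.

Lemma approx_trace (phi : nat -> R2 -> R) v g (dv : 'I_2 -> R2 -> R) :
  (forall i, is_wderiv D [:: i] v (dv i)) -> L2 v -> H1approx phi v dv ->
  (forall a b, a != b -> segment a b `<=` frontier D -> in_L2 (length R) I01 (g \o seg a b) /\
    (fun n => nm1 (fun t => phi n (seg a b t) - g (seg a b t))) @ \oo --> (0 : R)) ->
  is_trace D v g.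
Proof.
move=> vdv Lv Ha Hs; exists phi.
have [||||sp cp cdp] := @ae_H1approx phi v v dv (fun i => wd [:: i] v) Lv Lv _ _ _ _ Ha.
- by move=> i; have [] := vdv i.
- by move=> i; have [] := wderivP (vdv i).
- exact: ae_all.
- by move=> i; apply: (ae_mono (wderiv_eq oD bD (vdv i))) => x _ ->.
by [].
Qed.

Lemma is_trace_lincomb (a b : R) v w g h : Hk 1 D v -> Hk 1 D w ->
  is_trace D v g -> is_trace D w h ->
  is_trace D (fun x => a * v x + b * w x) (fun x => a * g x + b * h x).
Proof.
move=> Hv Hw /trace_approx[phi [pv pg]] /trace_approx[psi [qw qh]].
have Lv := Hv.1; have Lw := Hw.1.
have dv i := @Hk_wderiv _ _ 1 [:: i] _ Hv isT.
have dw i := @Hk_wderiv _ _ 1 [:: i] _ Hw isT.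
apply: (@approx_trace (fun n x => a * phi n x + b * psi n x) _ _
   (fun i x => a * wd [:: i] v x + b * wd [:: i] w x)).
- by move=> i; exact: is_wderiv_lincomb.
- exact: in_L2_lincomb.
- exact: (H1approx_lincomb a b Lv Lw (fun i => (dv i).1) (fun i => (dw i).1) pv qw).
- move=> c d cd cdF; have [Lg cg] := pg c d cd cdF; have [Lh ch] := qh c d cd cdF.
  split; first exact: (in_L2_lincomb mI a b Lg Lh).
  have Lphi n : in_L2 (length R) I01 (fun t => phi n (seg c d t)).
    apply: continuous_in_L2_I01; case: pv => sp _ _.
    move=> t; apply: continuous_comp; first exact: continuous_seg.
    by have [c0 _] := smooth_C1 (sp n); exact: c0.
  have Lpsi n : in_L2 (length R) I01 (fun t => psi n (seg c d t)).
    apply: continuous_in_L2_I01; case: qw => sp _ _.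
    move=> t; apply: continuous_comp; first exact: continuous_seg.
    by have [c0 _] := smooth_C1 (sp n); exact: c0.
  exact: (cvg_dist_lincomb mI a b Lphi Lg Lpsi Lh cg ch).
Qed.

Lemma continuous_on_seg phi (a b : R2) : smooth phi ->
  in_L2 (length R) I01 (fun t => phi (seg a b t)).
Proof.
move=> /smooth_C1[c _]; apply: continuous_in_L2_I01 => t.
by apply: continuous_comp; [exact: continuous_seg|exact: c].
Qed.

Lemma smooth_lin phi psi : smooth phi -> smooth psi ->
  smooth (fun x => phi x - psi x) /\
  forall i x, partials [:: i] (fun x => phi x - psi x) x =
     partials [:: i] phi x - partials [:: i] psi x.
Proof.
move=> sp sq; have -> : (fun x => phi x - psi x) = (fun x => 1 * phi x + (-1) * psi x).
  by apply/funext => x; rewrite mul1r mulN1r.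
split; first exact: smooth_lincomb.
by move=> i x; rewrite partials_lincomb// mul1r mulN1r.
Qed.

Lemma cvg_H1dist (phi : nat -> R2 -> R) psi v : Hk 1 D v -> smooth psi ->
  H1approx phi v (fun i => wd [:: i] v) ->
  (fun n => H1sqr D (fun x => psi x - phi n x)) @ \oo --> H1dist psi v.
Proof.
move=> Hv spsi [sp cp cdp].
have Ls n := Lsm (sp n); have Lds i n := Lsmd i (sp n).
have Lpsi := Lsm spsi; have Ldpsi i := Lsmd i spsi.
have c1 (f_ : nat -> R2 -> R) f g : (forall n, L2 (f_ n)) -> L2 f -> L2 g ->
    (fun n => nm (fun x => f_ n x - f x)) @ \oo --> (0 : R) ->
    (fun n => nm (fun x => g x - f_ n x) ^+ 2) @ \oo --> nm (fun x => g x - f x) ^+ 2.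
  move=> Lf_ Lf Lg cf; apply: cvg_sqr.
  apply: (cvg_norm2 mD (fun n => in_L2B mD Lg (Lf_ n)) (in_L2B mD Lg Lf)).
  rewrite (_ : (fun n => _) = (fun n => nm (fun x => f_ n x - f x)))//.
  apply/funext => n; rewrite norm2_distC; apply: eq_norm2 => x _; ring.
have Ldv i := @Hk_wderiv_L2 _ _ 1 [:: i] _ Hv isT.
rewrite /H1dist sum_ord2.
rewrite (_ : (fun n => _) = (fun n => nm (fun x => psi x - phi n x) ^+ 2 +
  (nm (fun x => partials [:: 0] psi x - partials [:: 0] (phi n) x) ^+ 2 +
   nm (fun x => partials [:: 1] psi x - partials [:: 1] (phi n) x) ^+ 2))).
  by apply: cvgD; [exact: c1 Hv.1 _ cp|apply: cvgD; exact: c1 (cdp _)].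
apply/funext => n; rewrite /H1sqr sum_ord2; have [_ H] := smooth_lin spsi (sp n).
congr (_ + (_ ^+ 2 + _ ^+ 2)); apply: eq_norm2 => x _; exact: H.
Qed.

(** The trace inequality for psi - phi n, in the limit along the smooth functions phi n that define
    the trace g. *)
Lemma trace_dist (a b : R2) (K : R) v g psi : a != b -> segment a b `<=` frontier D ->
  (forall phi, C1 phi -> nm1 (fun t => phi (seg a b t)) ^+ 2 <= K * H1sqr D phi) ->
  Hk 1 D v -> is_trace D v g -> smooth psi ->
  nm1 (fun t => psi (seg a b t) - g (seg a b t)) ^+ 2 <= K * H1dist psi v.
Proof.
move=> ab abF HK Hv /trace_approx[phi [pv /(_ _ _ ab abF)[Lg cg]]] spsi.
have [sp _ _] := pv.
have cl : (fun n => nm1 (fun t => psi (seg a b t) - phi n (seg a b t)) ^+ 2) @ \oo -->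
    nm1 (fun t => psi (seg a b t) - g (seg a b t)) ^+ 2.
  apply: cvg_sqr.
  have Lp n := continuous_on_seg a b (sp n); have Lq := continuous_on_seg a b spsi.
  apply: (cvg_norm2 mI (fun n => in_L2B mI Lq (Lp n)) (in_L2B mI Lq Lg)).
  rewrite (_ : (fun n => _) = (fun n => nm1 (fun t => phi n (seg a b t) - g (seg a b t))))//.
  apply/funext => n; rewrite norm2_distC; apply: eq_norm2 => x _ /=; ring.
have cr : (fun n => K * H1sqr D (fun x => psi x - phi n x)) @ \oo --> K * H1dist psi v.
  by apply: cvgM; [exact: cvg_cst|exact: cvg_H1dist].
apply: ler_cvg_to cl cr _; apply: nearW => n.
by apply: HK; apply: smooth_C1; have [] := smooth_lin spsi (sp n).
Qed.

Lemma H1dist_small v g (eps : R) : 0 < eps -> Hk 1 D v -> is_trace D v g ->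
  exists phi, smooth phi /\ H1dist phi v <= eps.
Proof.
move=> e0 Hv /trace_approx[phi [[sp cp cdp] _]].
have H : (fun n => H1dist (phi n) v) @ \oo --> (0 : R).
  rewrite /H1dist.
  rewrite (_ : (fun n => _) = (fun n => nm (fun x => phi n x - v x) ^+ 2 +
    (nm (fun x => partials [:: 0] (phi n) x - wd [:: 0] v x) ^+ 2 +
     nm (fun x => partials [:: 1] (phi n) x - wd [:: 1] v x) ^+ 2))); last first.
    by apply/funext => n; rewrite sum_ord2.
  rewrite -[X in _ --> X](_ : 0 ^+ 2 + (0 ^+ 2 + 0 ^+ 2) = 0); last by rewrite expr0n/= !addr0.
  by apply: cvgD; [exact: cvg_sqr|apply: cvgD; exact: cvg_sqr].
have /cvgrPdist_le/(_ _ e0)[N _ HN] := H.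
exists (phi N); split => //; have := HN N (leqnn _); rewrite /= sub0r normrN.
exact: le_trans (ler_norm _).
Qed.

(** The boundary integrals of phi n times psi are at most the product of the L2 norms on each edge,
    and those of phi n tend to 0 because v has zero trace. *)
Lemma green_smooth v psi i : Hk 1 D v -> is_trace D v (fun=> 0) -> smooth psi ->
  ip (wd [:: i] v) psi = - ip v (partials [:: i] psi).
Proof.
move=> Hv /trace_approx[phi [[sp cp cdp] tr]] spsi.
have [K K0 HK] := integral_partial_frontier oD bD polygonal_frontier_in.
have Ls n := Lsm (sp n); have Lds n := Lsmd i (sp n).
have Lpsi := Lsm spsi; have Ldpsi := Lsmd i spsi.
have Ldv := @Hk_wderiv_L2 _ _ 1 [:: i] _ Hv isT.
have c0 f : (fun n : nat => nm (fun x => f x - f x)) @ \oo --> (0 : R).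
  rewrite (_ : (fun n => _) = fun=> 0); first exact: cvg_cst.
  apply/funext => n; rewrite -(norm2_0 (area R) mD).
  by apply: eq_norm2 => x _; rewrite subrr.
have cl : (fun n => ip (phi n) (partials [:: i] psi) + ip (partials [:: i] (phi n)) psi) @ \oo -->
    ip v (partials [:: i] psi) + ip (wd [:: i] v) psi.
  apply: cvgD.
    exact: (cvg_inner mD Ls Hv.1 (fun=> Ldpsi) Ldpsi cp (c0 _)).
  exact: (cvg_inner mD Lds Ldv (fun=> Lpsi) Lpsi (cdp i) (c0 _)).
have cr : (fun n => ip (phi n) (partials [:: i] psi) + ip (partials [:: i] (phi n)) psi) @ \oo --> (0 : R).
  apply: (@cvg_to0_dominated _ _ (fun n => K * \sum_(e <- E | e.1 != e.2)
     nm1 (fun t => phi n (seg e.1 e.2 t) - 0) * nm1 (fun t => psi (seg e.1 e.2 t)))) => [n|].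
    rewrite subr0 -(integral_partialM oD bD i (smooth_C1 (sp n)) (smooth_C1 spsi)).
    apply: le_trans (HK i _ (C1M (smooth_C1 (sp n)) (smooth_C1 spsi))) _.
    apply: ler_wpM2l => //; apply: ler_sum => e _.
    rewrite (_ : nm1 (fun t => _ - 0) = nm1 (fun t => phi n (seg e.1 e.2 t))); last first.
      by apply: eq_norm2 => t _; rewrite subr0.
    by apply: integral_normM_le; [exact: mI|exact: continuous_on_seg|exact: continuous_on_seg].
  rewrite -[X in _ --> X](mulr0 K); apply: cvgM; first exact: cvg_cst.
  apply: cvg0_sum => e eE e12; rewrite -[X in _ --> X](mul0r (nm1 (fun t => psi (seg e.1 e.2 t)))).
  apply: cvgM; last exact: cvg_cst.
  by have [_] := tr _ _ e12 (polygonal_segment eE).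
have := cvg_unique _ cl cr; rewrite addrC => H.
by apply/eqP; rewrite -addr_eq0; apply/eqP; apply: H; exact: Rhausdorff.
Qed.

(** The trace h enters through the smooth functions that come with it, which approximate w in H1. *)
Lemma green v w h i : Hk 1 D v -> is_trace D v (fun=> 0) -> Hk 1 D w -> is_trace D w h ->
  ip (wd [:: i] v) w = - ip v (wd [:: i] w).
Proof.
move=> Hv tv Hw /trace_approx[phi [[sp cp cdp] _]].
have Ls n := Lsm (sp n); have Lds n := Lsmd i (sp n).
have Ldv := @Hk_wderiv_L2 _ _ 1 [:: i] _ Hv isT.
have Ldw := @Hk_wderiv_L2 _ _ 1 [:: i] _ Hw isT.
have c0 f : (fun n : nat => nm (fun x => f x - f x)) @ \oo --> (0 : R).
  rewrite (_ : (fun n => _) = fun=> 0); first exact: cvg_cst.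
  apply/funext => n; rewrite -(norm2_0 (area R) mD).
  by apply: eq_norm2 => x _; rewrite subrr.
have c1 := cvg_inner mD (fun=> Ldv) Ldv Ls Hw.1 (c0 _) cp.
have c2 : (fun n => ip (wd [:: i] v) (phi n)) @ \oo --> - ip v (wd [:: i] w).
  rewrite (_ : (fun n => _) = (fun n => - ip v (partials [:: i] (phi n)))); last first.
    by apply/funext => n; exact: green_smooth.
  by apply: cvgN; exact: (cvg_inner mD (fun=> Hv.1) Hv.1 Lds Ldw (c0 _) (cdp i)).
exact: (cvg_unique (@Rhausdorff R) c1 c2).
Qed.

Lemma partial_fst (x : R2) : partials [:: 0] (fun x : R2 => x.1) x = 1.
Proof.
have := is_derive_slice0 x.1 x.2 (@C1_fst R); rewrite -surjective_pairing => -[_ <-].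
by rewrite derive_id.
Qed.

(** For a smooth phi the derivative of x1 phi^2 in the first direction is phi^2 + 2 x1 phi times
    that of phi, and |x1| <= B on the domain. The boundary term disappears in the limit, leaving
    |v|^2 <= 2 B |v| times the norm of the derivative. *)
Lemma poincare : exists2 B : R, 0 < B &
  forall v, Hk 1 D v -> is_trace D v (fun=> 0) -> nm v <= B * nm (wd [:: 0] v).
Proof.
have [B B0 HB] := bounded_set_box bD.
have HB1 x : D x -> `|x.1| <= B by move=> /HB[].
have HBc x : closure D x -> `|x.1| <= B.
  have cl : closed [set x : R2 | `|x.1| <= B].
    have -> : [set x : R2 | `|x.1| <= B] = (fun x : R2 => `|x.1|) @^-1` [set y | y <= B] by [].
    apply: preimage_closed; last exact: closed_le.
    by move=> y _; apply: continuous_comp; [exact: cvg_fst|exact: norm_continuous].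
  by move=> cx; apply: cl; apply: (closureS _ cx) => y; exact: HB1.
exists (2 * B); first by rewrite mulr_gt0.
move=> v Hv /trace_approx[phi [[sp cp cdp] tr]].
have [K K0 HK] := integral_partial_frontier oD bD polygonal_frontier_in.
have Ls n := Lsm (sp n); have Lds n := Lsmd 0 (sp n).
have Ldv := @Hk_wderiv_L2 _ _ 1 [:: 0] _ Hv isT.
have mulB n : L2 (fun x => x.1 * phi n x) /\ nm (fun x => x.1 * phi n x) <= B * nm (phi n).
  have c1 := C1M (@C1_fst R) (smooth_C1 (sp n)).
  have L1 : L2 (fun x => x.1 * phi n x) by have [] := C1_in_L2 oD bD c1.
  split => //; rewrite -[X in X * _](ger0_norm (ltW B0)) -norm2Z//.
  apply: norm2_le_ae => //; first exact: in_L2Z.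
  apply: nearW => x Dx; rewrite !normrM ler_wpM2r//.
  by apply: le_trans (ler_norm _); exact: HB1.
have key n : nm (phi n) ^+ 2 <= 2 * (B * nm (phi n) * nm (partials [:: 0] (phi n))) +
    K * \sum_(e <- E | e.1 != e.2) (B * (nm1 (fun t => phi n (seg e.1 e.2 t) - 0) ^+ 2)).
  have cn := smooth_C1 (sp n); have cc := C1M cn cn.
  have := HK 0 _ (C1M (@C1_fst R) cc).
  rewrite (integral_partialM oD bD 0 (@C1_fst R) cc).
  have -> : ip (partials [:: 0] (fun x : R2 => x.1)) (fun x => phi n x * phi n x) = nm (phi n) ^+ 2.
    rewrite norm2_sqr; apply: eq_Rintegral => x _; rewrite partial_fst; ring.
  have -> : ip (fun x => x.1) (partials [:: 0] (fun x => phi n x * phi n x)) =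
      2 * ip (fun x => x.1 * phi n x) (partials [:: 0] (phi n)).
    rewrite -(innerZl mD 2 (mulB n).1 (Lds n)).
    by apply: eq_Rintegral => x _; rewrite partialM//; ring.
  have H1 : - (B * nm (phi n) * nm (partials [:: 0] (phi n))) <=
      ip (fun x => x.1 * phi n x) (partials [:: 0] (phi n)).
    have [L1 N1] := mulB n.
    have := inner_CS mD L1 (Lds n); rewrite ler_norml => /andP[H _].
    by apply: le_trans H; rewrite lerN2 ler_wpM2r// norm2_ge0.
  have H2 : K * (\sum_(e <- E | e.1 != e.2)
      (\int[length R]_(t in [set` `[0%R, 1%R]]) `|(fun x : R2 => (x.1 * (phi n x * phi n x))%R) (seg e.1 e.2 t)|)%R)
      <= K * \sum_(e <- E | e.1 != e.2) (B * (nm1 (fun t => phi n (seg e.1 e.2 t) - 0) ^+ 2)).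
    apply: ler_wpM2l => //; rewrite big_seq_cond [leRHS]big_seq_cond.
    apply: ler_sum => e /andP[eE e12].
    rewrite (_ : nm1 (fun t => _ - 0) = nm1 (fun t => phi n (seg e.1 e.2 t))); last first.
      by apply: eq_norm2 => t _; rewrite subr0.
    have L1 := continuous_on_seg e.1 e.2 (sp n).
    have L2' : in_L2 (length R) I01 (fun t => (seg e.1 e.2 t).1 * phi n (seg e.1 e.2 t)).
      have [c _] := C1M (@C1_fst R) cn.
      apply: (@continuous_in_L2_I01 R (fun t => (fun x : R2 => x.1 * phi n x) (seg e.1 e.2 t))) => t.
      apply: (@continuous_comp _ _ _ (seg e.1 e.2) (fun x : R2 => x.1 * phi n x)).
        exact: continuous_seg.
      exact: c.
    have N1 : nm1 (fun t => (seg e.1 e.2 t).1 * phi n (seg e.1 e.2 t)) <=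
        B * nm1 (fun t => phi n (seg e.1 e.2 t)).
      rewrite -[X in X * _](ger0_norm (ltW B0)) -norm2Z//.
      apply: norm2_le_ae => //; first exact: in_L2Z.
      apply: nearW => t tI; rewrite !normrM ler_wpM2r//.
      apply: le_trans (ler_norm _); apply: HBc.
      by have [] := polygonal_segment eE (ex_intro2 _ _ t tI erefl).
    apply: le_trans (_ : nm1 (fun t => (seg e.1 e.2 t).1 * phi n (seg e.1 e.2 t)) *
       nm1 (fun t => phi n (seg e.1 e.2 t)) <= _).
      apply: le_trans (integral_normM_le mI L2' L1).
      rewrite le_eqVlt; apply/orP; left; apply/eqP; apply: eq_Rintegral => t _.
      by rewrite mulrA.
    by rewrite expr2 mulrA ler_wpM2r// norm2_ge0.
  rewrite ler_norml => /andP[_ H3]; lra.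
have H : nm v ^+ 2 <= 2 * (B * nm v * nm (wd [:: 0] v)).
  have c1 := cvg_norm2 mD Ls Hv.1 cp; have c2 := cvg_norm2 mD Lds Ldv (cdp 0).
  have cl : (fun n => nm (phi n) ^+ 2) @ \oo --> nm v ^+ 2 by exact: cvg_sqr.
  have cr : (fun n => 2 * (B * nm (phi n) * nm (partials [:: 0] (phi n))) +
    K * \sum_(e <- E | e.1 != e.2) (B * (nm1 (fun t => phi n (seg e.1 e.2 t) - 0) ^+ 2))) @ \oo -->
      2 * (B * nm v * nm (wd [:: 0] v)) + K * 0.
    apply: cvgD.
      apply: cvgM; first exact: cvg_cst.
      by apply: cvgM => //; apply: cvgM => //; exact: cvg_cst.
    apply: cvgM; first exact: cvg_cst.
    apply: cvg0_sum => e eE e12.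
    rewrite -[X in _ --> X](_ : B * 0 ^+ 2 = 0); last by rewrite expr0n mulr0.
    apply: cvgM; first exact: cvg_cst.
    by apply: cvg_sqr; have [_] := tr _ _ e12 (polygonal_segment eE).
  rewrite mulr0 addr0 in cr.
  by apply: ler_cvg_to cl cr _; apply: nearW.
apply: ler_of_sqr_mul; [exact: norm2_ge0|by rewrite !mulr_ge0 ?norm2_ge0// ltW|].
by apply: le_trans H _; rewrite -[2 * B * _]mulrA (mulrCA _ 2) (mulrCA (nm v)) (mulrA B).
Qed.

Lemma is_trace_ae_fun v w g : Hk 1 D v -> L2 w -> ae_in (area R) D (fun x => v x = w x) ->
  is_trace D v g -> is_trace D w g.
Proof.
move=> Hv Lw vw /trace_approx[phi [pV tp]]; have Lv := Hv.1.
have Ew s : wd s v = wd s w by exact: ae_wderiv vw.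
have Hw : Hk 1 D w by exact: ae_Hk vw Hv.
have Ld j : L2 (wd [:: j] v) := @Hk_wderiv_L2 _ _ 1 [:: j] _ Hv isT.
apply: (approx_trace (phi := phi) (dv := fun j => wd [:: j] v)) tp.
- by move=> j; rewrite Ew; exact: (@Hk_wderiv _ _ 1 [:: j] _ Hw isT).
- exact: Lw.
- have re j : ae_in (area R) D (fun x => wd [:: j] v x = wd [:: j] v x) by exact: ae_all.
  exact: (ae_H1approx Lv Lw Ld Ld vw re pV).
Qed.

Lemma H20_lincomb (a b : R) v w : H20 D v -> H20 D w ->
  H20 D (fun x => a * v x + b * w x).
Proof.
move=> [Hv tv [g [tg ng]]] [Hw tw [h [th nh]]].
have Hv1 := HkS (isT : (1 <= 2)%N) Hv; have Hw1 := HkS (isT : (1 <= 2)%N) Hw.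
split; first exact: Hk_lincomb.
  by have := is_trace_lincomb a b Hv1 Hw1 tv tw; under [X in is_trace _ _ X]funext do rewrite !mulr0 addr0.
exists (fun i x => a * g i x + b * h i x); split.
  move=> i.
  have Hdv := Hk1_wderiv i Hv; have Hdw := Hk1_wderiv i Hw.
  have := is_trace_lincomb a b Hdv Hdw (tg i) (th i).
  set V := (fun x : R2 => _ + _) => tV.
  have HV : Hk 1 D V by exact: Hk_lincomb.
  have HW : Hk 1 D (wd [:: i] (fun x => a * v x + b * w x)).
    by apply: Hk1_wderiv => //; exact: Hk_lincomb.
  have VW : ae_in (area R) D (fun x => V x = wd [:: i] (fun x => a * v x + b * w x) x).
    have := wderiv_lincomb oD bD a b Hv1 Hw1 (isT : (size [:: i] <= 1)%N).
    by move/ae_mono; apply=> // x _ ->.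
  exact: is_trace_ae_fun HV HW.1 VW tV.
move=> c d cd cdF; have := nh _ _ cd cdF; have := ng _ _ cd cdF.
move=> G H; apply: (ae_mono2 G H) => t _ G' H' /=.
rewrite !mulrDr !(mulrCA _ a) !(mulrCA _ b).
by rewrite addrACA -!mulrDr G' H' !mulr0 addr0.
Qed.

(** A test function is its own smooth approximation; its support lies in the open set D, so it and
    its derivatives vanish on the frontier. *)
Lemma test_H20 phi : test_function D phi -> H20 D phi.
Proof.
move=> tphi; have [sphi [Q [cQ QD p0]]] := tphi.
have sw s psi : smooth psi -> is_wderiv D s psi (partials (rev s) psi).
  move=> sp; have := smooth_is_wderiv oD bD s polygonal_frontier_in
    (fun e eE _ => polygonal_segment eE) sp.
  exact.
have Hk2 psi : smooth psi -> Hk 2 D psi.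
  by move=> sp; split=> [|s _]; [exact: Lsm|exists (partials (rev s) psi); exact: sw].
have tr psi : test_function D psi -> is_trace D psi (fun=> 0).
  move=> tpsi; have [sp [P [cP PD pp0]]] := tpsi.
  apply: (approx_trace (phi := fun=> psi) (dv := fun i => partials [:: i] psi)).
  - by move=> i; exact: sw.
  - exact: Lsm.
  - split=> // [|i].
      rewrite (_ : (fun n => _) = fun=> 0); first exact: cvg_cst.
      apply/funext => n; rewrite -(norm2_0 (area R) mD).
      by apply: eq_norm2 => x _; rewrite subrr.
    rewrite (_ : (fun n => _) = fun=> 0); first exact: cvg_cst.
    apply/funext => n; rewrite -(norm2_0 (area R) mD).
    by apply: eq_norm2 => x _; rewrite subrr.
  - move=> a b ab abF; split; first exact: in_L2_0.
    rewrite (_ : (fun n => _) = fun=> 0); first exact: cvg_cst.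
    apply/funext => n; rewrite -[RHS](norm2_0 (length R) mI).
    apply: eq_norm2 => t tI; rewrite subr0.
    have [_ nD] := frontierP oD (abF _ (ex_intro2 _ _ t tI erefl)).
    by apply: pp0 => /PD.
split; [exact: Hk2|exact: tr|].
exists (fun _ _ => 0); split=> [i|a b ab abF]; last by apply: ae_all => t _; rewrite !mulr0 addr0.
have sdp := smooth_partials [:: i] sphi.
have H1 : Hk 1 D (wd [:: i] phi) by apply: Hk1_wderiv => //; exact: Hk2.
have ae1 : ae_in (area R) D (fun x => partials [:: i] phi x = wd [:: i] phi x).
  by apply: (ae_mono (wderiv_eq oD bD (sw [:: i] phi sphi))) => x _ ->.
exact: is_trace_ae_fun (HkS (isT : (1 <= 2)%N) (Hk2 _ sdp)) H1.1 ae1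
  (tr _ (test_function_partials [:: i] tphi)).
Qed.

Lemma ae_H20 v w : L2 w -> ae_in (area R) D (fun x => v x = w x) -> H20 D v -> H20 D w.
Proof.
move=> Lw vw [Hv tv [g [tg ng]]]; have Lv := Hv.1.
have Ew s : wd s v = wd s w by exact: ae_wderiv.
have Hw : Hk 2 D w by exact: ae_Hk Hv.
split; [exact: Hw| |by exists g; split; [move=> i; rewrite -Ew; exact: tg|exact: ng]].
exact: is_trace_ae_fun (HkS (isT : (1 <= 2)%N) Hv) Lw vw tv.
Qed.

(** Green's formula gives |v_i|^2 <= |v| |v_ii| for the first and second derivatives in direction i.
    With |v| <= B |v_0| this first yields |v_0| <= B eps, then the bound of v, then that of the
    other derivative. *)
Lemma H20_poincare : exists2 B : R, 0 < B & forall v (eps : R), H20 D v ->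
  (forall j, nm (wd [:: j; j] v) <= eps) ->
  nm v <= B ^+ 2 * eps /\ forall i, nm (wd [:: i] v) <= B * eps.
Proof.
have [B B0 HB] := poincare; exists B => // v eps [Hv tv [g [tg _]]] He.
have Hv1 := HkS (isT : (1 <= 2)%N) Hv.
have sq i : nm (wd [:: i] v) ^+ 2 <= nm v * nm (wd [:: i; i] v).
  have Hdv := Hk1_wderiv i Hv.
  rewrite norm2_sqr (green i Hv1 tv Hdv (tg i)).
  have L1 := @Hk_wderiv_L2 _ _ 1 [:: i] _ Hdv isT.
  apply: le_trans (ler_norm _) _; rewrite normrN.
  apply: le_trans (inner_CS mD Hv.1 L1) _; rewrite le_eqVlt; apply/orP; left; apply/eqP.
  congr (_ * _); apply: (ae_eq_norm2 mD (in_L2_measurable mD L1)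
    (in_L2_measurable mD (@Hk_wderiv_L2 _ _ 2 [:: i; i] _ Hv isT))).
  exact: (wderiv_eq oD bD (wderiv_comp i i Hv)).
have nn w : 0 <= nm w by exact: norm2_ge0.
have Hb := HB v Hv1 tv.
have e0 : 0 <= eps by exact: le_trans (nn _) (He 0).
have N0 : nm (wd [:: 0] v) <= B * eps.
  have := sq 0; have := He 0; have := nn (wd [:: 0] v); have := nn (wd [:: 0; 0] v).
  move: Hb (nn v); set a := nm v; set b := nm (wd [:: 0] v); set c := nm (wd [:: 0; 0] v).
  move=> Hb a0 c0 b0 ce H.
  have [->|bn0] := eqVneq b 0; first by rewrite mulr_ge0// ltW.
  have bp : 0 < b by rewrite lt0r bn0.
  rewrite -(ler_pM2l bp) -expr2; apply: le_trans H _.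
  rewrite mulrCA mulrA; apply: ler_pM => //; exact: le_trans Hb _.
have N1 : nm v <= B ^+ 2 * eps.
  by apply: le_trans Hb _; rewrite expr2 -mulrA ler_pM2l.
split; first exact: N1.
move=> i; apply: ler_of_sqr; first by rewrite mulr_ge0// ltW.
apply: le_trans (sq i) _; rewrite exprMn (expr2 eps) mulrA.
exact: ler_pM (nn _) (nn _) N1 (He i).
Qed.

Lemma is_trace_ae w g h : is_trace D w g ->
  (forall a b, a != b -> segment a b `<=` frontier D -> in_L2 (length R) I01 (h \o seg a b) /\
    ae_in (length R) I01 (fun t => g (seg a b t) = h (seg a b t))) -> is_trace D w h.
Proof.
move=> [phi [sp c1 c2 H]] gh; exists phi; split => // a b ab abF.
have [Lg cg] := H _ _ ab abF; have [Lh e] := gh _ _ ab abF; split => //.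
rewrite (_ : (fun n => _) = (fun n => nm1 (fun t => phi n (seg a b t) - g (seg a b t))))//.
apply/funext => n; have Lp := continuous_on_seg a b (sp n).
apply: (ae_eq_norm2 mI (in_L2_measurable mI (in_L2B mI Lp Lh))
  (in_L2_measurable mI (in_L2B mI Lp Lg))).
by apply: (ae_mono e) => t _ /= ->.
Qed.

Lemma norm2_le_H1dist phi v (r : R) : 0 <= r -> H1dist phi v <= r ^+ 2 ->
  nm (fun x => phi x - v x) <= r /\
  forall i, nm (fun x => partials [:: i] phi x - wd [:: i] v x) <= r.
Proof.
move=> r0; rewrite /H1dist sum_ord2 => H.
have a0 := sqr_ge0 (nm (fun x => phi x - v x)).
have a1 i := sqr_ge0 (nm (fun x => partials [:: i] phi x - wd [:: i] v x)).
split=> [|i]; apply: ler_of_sqr => //.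
  by apply: le_trans H; rewrite lerDl addr_ge0.
have : i = 0 \/ i = 1 by case: i => -[|[|//]] p; [left|right]; apply/val_inj.
case=> ->; apply: le_trans H; first by rewrite addrCA lerDl addr_ge0.
by rewrite addrA lerDr addr_ge0.
Qed.

(** Each [w_ k] is replaced by a smooth [phi k] that is 2^-k close in H1. The [phi k] then have
    geometrically small increments in H1, hence by the trace inequality on every boundary segment,
    where they converge almost everywhere. *)
Lemma trace_limit (w_ : nat -> R2 -> R) w (g_ : nat -> R2 -> R) (L : R) : 0 <= L ->
  (forall k, Hk 1 D (w_ k)) -> (forall k, is_trace D (w_ k) (g_ k)) -> Hk 1 D w ->
  (forall k, nm (fun x => w x - w_ k x) <= L * (2^-1) ^+ k) ->
  (forall i k, nm (fun x => wd [:: i] w x - wd [:: i] (w_ k) x) <= L * (2^-1) ^+ k) ->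
  exists g, is_trace D w g /\ forall a b, a != b -> segment a b `<=` frontier D ->
    exists M : R, forall k, in_L2 (length R) I01 (g_ k \o seg a b) /\
      nm1 (fun t => g (seg a b t) - g_ k (seg a b t)) <= M * (2^-1) ^+ k.
Proof.
move=> L0 Hw_ tw_ Hw cw cdw.
pose r k : R := (2^-1) ^+ k.
have r0 k : 0 < r k by rewrite exprn_gt0.
(* [H1dist] is a squared distance, hence the squared tolerance. *)
have [phi Hphi] := choice (fun k => H1dist_small (exprn_gt0 2 (r0 k)) (Hw_ k) (tw_ k)).
have sp k : smooth (phi k) by have [] := Hphi k.
have Ls k := Lsm (sp k); have Lds k i := Lsmd i (sp k).
have Lw_ k := (Hw_ k).1; have Ldw_ k i := @Hk_wderiv_L2 _ _ 1 [:: i] _ (Hw_ k) isT.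
have Lw := Hw.1; have Ldw i := @Hk_wderiv_L2 _ _ 1 [:: i] _ Hw isT.
have d0 k : nm (fun x => phi k x - w x) <= (1 + L) * r k.
  apply: le_trans (norm2_triangle mD (Ls k) (Lw_ k) Lw) _.
  rewrite mulrDl mul1r lerD//; first by have [] := norm2_le_H1dist (ltW (r0 k)) (Hphi k).2.
  by rewrite norm2_distC; exact: cw.
have d1 i k : nm (fun x => partials [:: i] (phi k) x - wd [:: i] w x) <= (1 + L) * r k.
  apply: le_trans (norm2_triangle mD (Lds k i) (Ldw_ k i) (Ldw i)) _.
  rewrite mulrDl mul1r lerD//; first by have [_] := norm2_le_H1dist (ltW (r0 k)) (Hphi k).2.
  by rewrite norm2_distC; exact: cdw.
have rS k : r k.+1 <= r k.
  by rewrite /r exprS ler_piMl// ?exprn_ge0// invf_le1// ler1n.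
have step (F_ : nat -> R2 -> R) F : (forall k, L2 (F_ k)) -> L2 F ->
    (forall k, nm (fun x => F_ k x - F x) <= (1 + L) * r k) ->
    forall k, nm (fun x => F_ k.+1 x - F_ k x) ^+ 2 <= (2 * (1 + L)) ^+ 2 * r k ^+ 2.
  move=> LF_ LF HF k; rewrite -exprMn; apply: lerXn2r.
  - by rewrite nnegrE norm2_ge0.
  - by rewrite nnegrE !mulr_ge0 ?addr_ge0 ?exprn_ge0.
  apply: le_trans (norm2_triangle mD (LF_ k.+1) LF (LF_ k)) _.
  rewrite [X in _ + X]norm2_distC.
  have := HF k.+1; have := HF k; have : (1 + L) * r k.+1 <= (1 + L) * r k.
    by rewrite ler_wpM2l// addr_ge0.
  rewrite -mulrA mulr_natl mulr2n => A B C; apply: lerD => //.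
  exact: le_trans C A.
have fast k : H1sqr D (fun x => phi k.+1 x - phi k x) <= 3 * (2 * (1 + L)) ^+ 2 * r k ^+ 2.
  rewrite /H1sqr sum_ord2.
  have [_ H] := smooth_lin (sp k.+1) (sp k).
  have E1 i : nm (partials [:: i] (fun x => phi k.+1 x - phi k x)) =
      nm (fun x => partials [:: i] (phi k.+1) x - partials [:: i] (phi k) x).
    by apply: eq_norm2 => x _; exact: H.
  rewrite !E1.
  have A0 := step _ _ Ls Lw d0 k.
  have A1 i := step _ _ (fun k => Lds k i) (Ldw i) (d1 i) k.
  move: (A1 0) (A1 1) => {A1}A1 A2.
  apply: le_trans (lerD A0 (lerD A1 A2)) _.
  by rewrite le_eqVlt; apply/orP; left; apply/eqP; ring.
have rcvg : r @ \oo --> (0 : R) by apply: cvg_expr; rewrite ger0_norm ?invr_ge0// invf_lt1 ?ltr1n.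
have seg_est a b : a != b -> segment a b `<=` frontier D -> exists2 K : R, 0 <= K &
    (forall k, in_L2 (length R) I01 (fun t => plim phi (seg a b t)) /\
      nm1 (fun t => plim phi (seg a b t) - phi k (seg a b t)) <=
        2 * (Num.sqrt K * (Num.sqrt 3 * (2 * (1 + L)))) * r k) /\
    (forall k, in_L2 (length R) I01 (g_ k \o seg a b) /\
      nm1 (fun t => phi k (seg a b t) - g_ k (seg a b t)) <= Num.sqrt K * r k).
  move=> ab abF; have [K K0 HK] := trace_inequality oD bD lD ab abF.
  exists K => //; split=> k; last first.
    have Lg : in_L2 (length R) I01 (g_ k \o seg a b).
      by have [psi [_ _ _ /(_ _ _ ab abF)[]]] := tw_ k.
    split => //; apply: ler_of_sqr.
      by rewrite mulr_ge0 ?sqrtr_ge0// ltW.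
    apply: le_trans (trace_dist ab abF HK (Hw_ k) (tw_ k) (sp k)) _.
    by rewrite exprMn sqr_sqrtr// ler_wpM2l//; have [] := Hphi k.
  have Lp n := continuous_on_seg a b (sp n).
  have st n : nm1 (fun t => phi n.+1 (seg a b t) - phi n (seg a b t)) <=
      (Num.sqrt K * (Num.sqrt 3 * (2 * (1 + L)))) * (2^-1) ^+ n.
    apply: ler_of_sqr.
      by rewrite !mulr_ge0 ?sqrtr_ge0 ?addr_ge0// ltW.
    have [ss _] := smooth_lin (sp n.+1) (sp n).
    apply: le_trans (HK _ (smooth_C1 ss)) _.
    rewrite exprMn (exprMn _ (Num.sqrt K)) (exprMn _ (Num.sqrt 3)) !sqr_sqrtr//.
    by rewrite -(mulrA K) ler_wpM2l//; exact: fast.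
  exact: (plim_L2 mI Lp st k).
(* The pointwise limit is formed in the whole plane, so that one function serves as the trace on all
   boundary segments at once. *)
exists (plim phi); split.
  apply: (approx_trace (phi := phi) (dv := fun i => wd [:: i] w)).
  - by move=> i; exact: (@Hk_wderiv _ _ 1 [:: i] _ Hw isT).
  - exact: Lw.
  - have cr : (fun k => (1 + L) * r k) @ \oo --> (0 : R).
      by rewrite -[X in _ --> X](mulr0 (1 + L)); apply: cvgM => //; exact: cvg_cst.
    split => // [|i].
      by apply: cvg0_dominated cr => k; rewrite norm2_ge0 d0.
    by apply: cvg0_dominated cr => k; rewrite norm2_ge0 d1.
  - move=> a b ab abF; have [K K0 [H1 _]] := seg_est a b ab abF.
    split; first by have [] := H1 0%N.
    set M := 2 * _ in H1.
    have cr : (fun k => M * r k) @ \oo --> (0 : R).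
      by rewrite -[X in _ --> X](mulr0 M); apply: cvgM => //; exact: cvg_cst.
    apply: cvg0_dominated cr => k; rewrite norm2_ge0/= norm2_distC.
    by have [] := H1 k.
move=> a b ab abF; have [K K0 [H1 H2]] := seg_est a b ab abF.
set M := 2 * _ in H1; exists (M + Num.sqrt K) => k.
have [Lg_ Hg_] := H2 k; have [Lp Hp] := H1 k; split => //.
apply: le_trans (norm2_triangle mI Lp (continuous_on_seg a b (sp k)) Lg_) _.
by rewrite mulrDl lerD.
Qed.

Lemma trace_in_L2 v g a b : is_trace D v g -> a != b -> segment a b `<=` frontier D ->
  in_L2 (length R) I01 (g \o seg a b).
Proof. by move=> [psi [_ _ _ H]] ab abF; have [] := H a b ab abF. Qed.

(** The Poincare inequalities turn small increments of the second derivatives into small increments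
    of all derivatives. Their limits are weak derivatives of the limit function, and the boundary
    conditions survive because the traces converge as well. *)
Lemma H20_complete (v_ : nat -> R2 -> R) (L : R) : (forall k, H20 D (v_ k)) ->
  (forall i j k, nm (fun x => wd [:: i; j] (v_ k.+1) x - wd [:: i; j] (v_ k) x) <=
    L * (2^-1) ^+ k) ->
  exists v, H20 D v /\ forall i j k,
    nm (fun x => wd [:: i; j] v x - wd [:: i; j] (v_ k) x) <= 2 * L * (2^-1) ^+ k.
Proof.
move=> Hv_ HL; have [B B0 HB] := H20_poincare .
have L0 : 0 <= L by have := le_trans (norm2_ge0 _ _ _) (HL 0 0 0%N); rewrite expr0 mulr1.
have Hvk k : Hk 2 D (v_ k) by have [] := Hv_ k.
pose r k : R := (2^-1) ^+ k.
have r0 k : 0 < r k by rewrite exprn_gt0.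
(* The empty list selects [v_ k] itself, since [wderiv D [::]] equals it only almost everywhere. *)
pose u s k := if s is [::] then v_ k else wd s (v_ k).
have wu s k : (size s <= 2)%N -> is_wderiv D s (v_ k) (u s k).
  case: s => [|i s] sk; first exact: is_wderiv_nil (Hvk k).1.
  exact: Hk_wderiv (Hvk k) sk.
have Lu s k (sk : (size s <= 2)%N) : L2 (u s k) := (wu s k sk).1.
(* Dominates the constants L, B L and B^2 L for the derivatives of order 2, 1 and 0. *)
pose L' := (B ^+ 2 + B + 1) * L.
have LL' : [/\ L <= L', B * L <= L' & B ^+ 2 * L <= L'].
  have h1 : 0 <= B ^+ 2 * L by rewrite mulr_ge0// sqr_ge0.
  have h2 : 0 <= B * L by rewrite mulr_ge0// ltW.
  rewrite /L' !mulrDl mul1r; split.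
  - by rewrite lerDr addr_ge0.
  - by rewrite -addrA addrCA lerDl addr_ge0.
  - by rewrite -addrA lerDl addr_ge0.
have fast s k : (size s <= 2)%N -> nm (fun x => u s k.+1 x - u s k x) <= L' * r k.
  move=> sk; pose d := fun x => 1 * v_ k.+1 x + (-1) * v_ k x.
  have Hd : H20 D d by exact: H20_lincomb.
  have Hd2 : Hk 2 D d by have [] := Hd.
  have Ed s' : (size s' <= 2)%N -> is_wderiv D s' d (fun x => u s' k.+1 x - u s' k x).
    move=> sk'; rewrite (_ : (fun x => _ - _) = (fun x => 1 * u s' k.+1 x + (-1) * u s' k x)).
      exact: (is_wderiv_lincomb oD bD 1 (-1) (Hvk k.+1).1 (Hvk k).1 (wu s' k.+1 sk') (wu s' k sk')).
    by apply/funext => x; rewrite mul1r mulN1r.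
  have N s' : (size s' <= 2)%N -> nm (fun x => u s' k.+1 x - u s' k x) = nm (wd s' d).
    move=> sk'; have e := Ed s' sk'.
    apply: (ae_eq_norm2 mD (in_L2_measurable mD e.1) (in_L2_measurable mD (wderivP e).1)).
    by apply: (ae_mono (wderiv_eq oD bD e)) => x _ ->.
  have [b1 b2 b3] := LL'.
  have rr (a : R) : a <= L' -> a * r k <= L' * r k by move=> h; rewrite ler_wpM2r// ltW.
  have H2 i j : nm (wd [:: i; j] d) <= L * r k by rewrite -N//; exact: HL.
  have [H0 H1] := HB d (L * r k) Hd (fun j => H2 j j).
  case: s sk => [|i [|j [|//]]] sk.
  - rewrite N// (_ : nm (wd [::] d) = nm d); last first.
      have e := is_wderiv_nil Hd2.1.
      apply: (ae_eq_norm2 mD (in_L2_measurable mD (wderivP e).1) (in_L2_measurable mD e.1)).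
      exact: (wderiv_eq oD bD e).
    by apply: le_trans H0 _; rewrite mulrA; exact: rr.
  - by rewrite N//; apply: le_trans (H1 i) _; rewrite mulrA; exact: rr.
  - by rewrite N//; apply: le_trans (H2 i j) _; exact: rr.
pose g s := plim (u s).
have Hg s (sk : (size s <= 2)%N) k := plim_L2 mD (fun n => Lu s n sk) (fun n => fast s n sk) k.
have rcvg : r @ \oo --> (0 : R) by apply: cvg_expr; rewrite ger0_norm ?invr_ge0// invf_lt1 ?ltr1n.
pose v := g [::].
have cu s : (size s <= 2)%N -> (fun n => nm (fun x => u s n x - g s x)) @ \oo --> (0 : R).
  move=> sk; have cr : (fun k => 2 * L' * r k) @ \oo --> (0 : R).
    by rewrite -[X in _ --> X](mulr0 (2 * L')); apply: cvgM => //; exact: cvg_cst.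
  apply: cvg0_dominated cr => k; rewrite norm2_ge0/= norm2_distC.
  by have [] := Hg s sk k.
have Lv : L2 v by have [] := Hg [::] isT 0%N.
have wv s : (size s <= 2)%N -> is_wderiv D s v (g s).
  move=> sk; apply: (is_wderiv_cvg oD bD (fun n => (Hvk n).1) Lv _ (fun n => wu s n sk)).
  - by have [] := Hg s sk 0%N.
  - exact: cu [::] isT.
  - exact: cu.
have Hv : Hk 2 D v by split=> [|s sk]; [exact: Lv|exists (g s); exact: wv].
have Nd s k : (0 < size s <= 2)%N ->
    nm (fun x => wd s v x - wd s (v_ k) x) = nm (fun x => g s x - u s k x).
  case: s => [//|i s] /andP[_ sk].
  have Lg : L2 (g (i :: s)) by have [] := Hg _ sk 0%N.
  have Lw := (wderivP (wv _ sk)).1.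
  apply: (ae_eq_norm2 mD (in_L2_measurable mD (in_L2B mD Lw (Lu _ k sk)))
    (in_L2_measurable mD (in_L2B mD Lg (Lu _ k sk)))).
  by apply: (ae_mono (wderiv_eq oD bD (wv _ sk))) => x _ ->.
exists v; split; last first.
  move=> i j k; rewrite Nd//.
  by have [] := plim_L2 mD (fun n => Lu [:: i; j] n isT) (HL i j) k.
have Hv1 := HkS (isT : (1 <= 2)%N) Hv.
have [b1 b2 b3] := LL'; have L'0 : 0 <= L' by exact: le_trans b1.
have L'00 : 0 <= 2 * L' by rewrite mulr_ge0.
split=> //.
  have [G [tG sG]] := @trace_limit v_ v (fun _ _ => 0) (2 * L') L'00
    (fun k => HkS (isT : (1 <= 2)%N) (Hvk k)) (fun k => let: And3 _ h _ := Hv_ k in h) Hv1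
    (fun k => (Hg [::] isT k).2)
    (fun i k => ltac:(rewrite Nd//; exact: (Hg [:: i] isT k).2)).
  apply: (is_trace_ae tG) => a b ab abF; split; first exact: in_L2_0.
  have [M HM] := sG a b ab abF.
  have LG : in_L2 (length R) I01 (G \o seg a b) by exact: trace_in_L2 tG ab abF.
  apply: norm2_eq0 => //.
  have c1 : (fun k : nat => nm1 (G \o seg a b)) @ \oo --> (0 : R).
    have cr : (fun k => M * r k) @ \oo --> (0 : R).
      by rewrite -[X in _ --> X](mulr0 M); apply: cvgM => //; exact: cvg_cst.
    apply: cvg0_dominated cr => k; rewrite norm2_ge0/=; apply: le_trans (HM k).2.
    rewrite le_eqVlt; apply/orP; left; apply/eqP; apply: eq_norm2 => t _ /=.
    by rewrite subr0.
  by have := cvg_unique (@Rhausdorff R) c1 (cvg_cst _) => <-.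
have [gk Hgk] := choice (fun k => let: And3 _ _ h := Hv_ k in h).
have lim i : exists G, is_trace D (wd [:: i] v) G /\ forall a b, a != b -> segment a b `<=` frontier D ->
    exists M : R, forall k, in_L2 (length R) I01 (gk k i \o seg a b) /\
      nm1 (fun t => G (seg a b t) - gk k i (seg a b t)) <= M * (2^-1) ^+ k.
  apply: (@trace_limit (fun k => wd [:: i] (v_ k)) _ (fun k => gk k i) (2 * L') L'00).
  - by move=> k; exact: Hk1_wderiv.
  - by move=> k; have [] := Hgk k.
  - exact: Hk1_wderiv.
  - by move=> k; rewrite Nd//; exact: (Hg [:: i] isT k).2.
  - move=> j k; have e := wderiv_comp j i Hv; have ek := wderiv_comp j i (Hvk k).
    rewrite (_ : nm _ = nm (fun x => wd [:: i; j] v x - wd [:: i; j] (v_ k) x)).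
      by rewrite Nd//; exact: (Hg [:: i; j] isT k).2.
    apply: (ae_eq_norm2 mD (in_L2_measurable mD (in_L2B mD (wderivP e).1 (wderivP ek).1))
      (in_L2_measurable mD (in_L2B mD e.1 ek.1))).
    by apply: (ae_mono2 (wderiv_eq oD bD e) (wderiv_eq oD bD ek)) => x _ -> ->.
have [G HG] := choice lim.
exists G; split=> [i|a b ab abF]; first by have [] := HG i.
have [M0 HM0] := (HG 0).2 a b ab abF; have [M1 HM1] := (HG 1).2 a b ab abF.
have LG i : in_L2 (length R) I01 (G i \o seg a b).
  by have [tGi _] := HG i; exact: trace_in_L2 tGi ab abF.
have Lk k i : in_L2 (length R) I01 (gk k i \o seg a b).
  by have tGi := (Hgk k).1 i; exact: trace_in_L2 tGi ab abF.
pose p := b.2 - a.2; pose q := a.1 - b.1.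
have cm (M : R) (F : nat -> R -> R) (F' : R -> R) : (forall k, nm1 (fun t => F' t - F k t) <= M * r k) ->
    (fun k => nm1 (fun t => F k t - F' t)) @ \oo --> (0 : R).
  move=> H; have cr : (fun k => M * r k) @ \oo --> (0 : R).
    by rewrite -[X in _ --> X](mulr0 M); apply: cvgM => //; exact: cvg_cst.
  by apply: cvg0_dominated cr => k; rewrite norm2_ge0/= norm2_distC.
have c := cvg_dist_lincomb mI p q (fun k => Lk k 0) (LG 0) (fun k => Lk k 1) (LG 1)
  (cm M0 _ _ (fun k => (HM0 k).2)) (cm M1 _ _ (fun k => (HM1 k).2)).
have Lpq := in_L2_lincomb mI p q (LG 0) (LG 1).
apply: (norm2_eq0 mI Lpq).
(* The normal derivative vanishes for every k, so its distance to the limit is the norm of the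
   limit: a constant sequence that tends to 0. *)
have Ek k : nm1 (fun t => p * (gk k 0 \o seg a b) t + q * (gk k 1 \o seg a b) t -
    (p * (G 0 \o seg a b) t + q * (G 1 \o seg a b) t)) =
    nm1 (fun t => p * (G 0 \o seg a b) t + q * (G 1 \o seg a b) t).
  rewrite -[RHS]norm2N; have Lg := in_L2_lincomb mI p q (Lk k 0) (Lk k 1).
  apply: (ae_eq_norm2 mI (in_L2_measurable mI (in_L2B mI Lg Lpq))
    (in_L2_measurable mI (in_L2N mI Lpq))).
  by apply: (ae_mono ((Hgk k).2 a b ab abF)) => t _ /= ->; rewrite sub0r.
rewrite (_ : (fun n => _) = fun=> nm1 (fun t => p * (G 0 \o seg a b) t + q * (G 1 \o seg a b) t)) in c.
  by have := cvg_unique (@Rhausdorff R) c (cvg_cst _) => <-.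
by apply/funext => k; exact: Ek.
Qed.

End ClampedFunctions.

(** The discriminant bound, with q + 1 in place of q so that the degenerate case q = 0 needs no
    separate treatment. *)
Lemma sqr_le_of_quadratic (R : realFieldType) (d e q : R) : 0 <= q ->
  (forall t, 0 <= e + 2 * t * d + t ^+ 2 * q) -> d ^+ 2 <= e * (q + 1).
Proof.
move=> q0 H; have q1 : 0 < q + 1 by rewrite ltr_wpDl.
have := H (- d / (q + 1)).
have -> : e + 2 * (- d / (q + 1)) * d + (- d / (q + 1)) ^+ 2 * q =
    (e * (q + 1) - d ^+ 2 * (1 + (q + 1)^-1)) / (q + 1).
  by field; rewrite gt_eqF.
rewrite pmulr_lge0 ?invr_gt0// subr_ge0; apply: le_trans.
by rewrite ler_peMr ?sqr_ge0// lerDl invr_ge0 ltW.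
Qed.

(** * The primal problem *)

(* Near-minimisers of [a v v - 2 * l v] can be chosen to be fast Cauchy, so that
   completeness along such sequences is enough. *)
Lemma riesz_representation (R : realType) (T : Type) (W : set (T -> R))
    (a : (T -> R) -> (T -> R) -> R) (l : (T -> R) -> R) (M : R) :
  W !=set0 ->
  (forall (c d : R) u v, W u -> W v -> W (fun x => c * u x + d * v x)) ->
  (forall (c d : R) u v w, W u -> W v -> W w ->
    a (fun x => c * u x + d * v x) w = c * a u w + d * a v w) ->
  (forall u v, W u -> W v -> a u v = a v u) ->
  (forall u, W u -> 0 <= a u u) ->
  (forall (c d : R) u v, W u -> W v -> l (fun x => c * u x + d * v x) = c * l u + d * l v) ->
  0 <= M -> (forall u, W u -> l u ^+ 2 <= M * a u u) ->
  (forall v_ : nat -> T -> R, (forall k, W (v_ k)) ->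
    (forall k, a (fun x => 1 * v_ k.+1 x + (-1) * v_ k x) (fun x => 1 * v_ k.+1 x + (-1) * v_ k x) <=
       ((2^-1) ^+ k) ^+ 2) ->
    exists2 u, W u & (fun k => a (fun x => 1 * u x + (-1) * v_ k x)
      (fun x => 1 * u x + (-1) * v_ k x)) @ \oo --> (0 : R)) ->
  exists2 u, W u & forall w, W w -> a u w = l w.
Proof.
move=> [w0 Ww0] Wlin alin asym a0 llin M0 lM complete.
have alinr c d u v w : W u -> W v -> W w ->
    a w (fun x => c * u x + d * v x) = c * a w u + d * a w v.
  move=> Wu Wv Ww; rewrite asym//; last exact: Wlin.
  by rewrite alin// (asym u w)// (asym v w).
have aq c d u v : W u -> W v -> a (fun x => c * u x + d * v x) (fun x => c * u x + d * v x) =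
    c ^+ 2 * a u u + 2 * (c * d) * a u v + d ^+ 2 * a v v.
  move=> Wu Wv; rewrite alin//; last exact: Wlin.
  by rewrite !alinr// (asym v u)//; ring.
pose J v := a v v - 2 * l v.
(* (2 l v)^2 <= 4 M a v v <= (M + a v v)^2, so the functional is bounded below. *)
have JM v : W v -> - M <= J v.
  move=> Wv; have H := lM v Wv; have p := a0 v Wv.
  suff : 2 * l v <= M + a v v by rewrite /J lerBrDr; move=> h; rewrite addrC lerBlDl.
  apply: ler_of_sqr; first by rewrite addr_ge0.
  move: H p M0; move: (l v) (a v v) => x y H y0 M0.
  have := sqr_ge0 (M - y); rewrite !expr2 in H *; nra.
pose S := [set J v | v in W].
have S0 : S !=set0 by exists (J w0), w0.
have Slb : has_lbound S by exists (- M) => _ [v Wv <-]; exact: JM.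
pose m := inf S.
have mJ v : W v -> m <= J v by move=> Wv; apply: ge_inf => //; exists v.
(* The parallelogram law bounds the energy of the difference of consecutive near-minimisers by 2 (e
   k + e (k + 1)) <= 4 e k, while 8 e k is the square of 2^-k. *)
pose e k : R := 8^-1 * ((2^-1) ^+ k) ^+ 2.
have e0 k : 0 < e k by rewrite mulr_gt0 ?invr_gt0// exprn_gt0// exprn_gt0// invr_gt0.
have eS k : e k.+1 <= e k.
  rewrite ler_wpM2l ?invr_ge0// lerXn2r ?nnegrE ?exprn_ge0 ?invr_ge0//.
  by rewrite exprS ler_piMl ?exprn_ge0 ?invr_ge0// invf_le1// ler1n.
have ex k : exists v, W v /\ J v < m + e k.
  by have [_ [v Wv <-] Hv] := inf_adherent (e0 k) (conj S0 Slb); exists v.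
have [v_ Hv_] := choice ex.
have Wv_ k : W (v_ k) by have [] := Hv_ k.
have Je k : J (v_ k) <= m + e k by have [_ /ltW] := Hv_ k.
have fast k : a (fun x => 1 * v_ k.+1 x + (-1) * v_ k x) (fun x => 1 * v_ k.+1 x + (-1) * v_ k x) <=
       ((2^-1) ^+ k) ^+ 2.
  (* The midpoint of the two near-minimisers is admissible, so its value is at least the infimum. *)
  have H := mJ _ (Wlin 2^-1 2^-1 _ _ (Wv_ k.+1) (Wv_ k)).
  have J1 := Je k; have J2 := Je k.+1; have es := eS k.
  rewrite aq//; move: H J1 J2; rewrite /J aq// llin//.
  have -> : ((2^-1) ^+ k) ^+ 2 = 8 * e k by rewrite /e mulrA divff// mul1r.
  move: es (e0 k) (a (v_ k) (v_ k)) (a (v_ k.+1) (v_ k.+1)) (a (v_ k.+1) (v_ k)) (l (v_ k)) (l (v_ k.+1)).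
  move: (e k) (e k.+1) (m) => e1 e2 mm es ep p q r l1 l2 H1 H2 H3.
  rewrite !expr2 in H1 *; lra.
have [u Wu cu] := complete v_ Wv_ fast.
exists u => // w Ww; set q := a w w.
have q0 : 0 <= q by exact: a0.
(* Moving from [v_ k] to [v_ k] + t w lowers the functional by at most e k, for every t, which
   controls its first variation. *)
have b1 k : (a (v_ k) w - l w) ^+ 2 <= e k * (q + 1).
  apply: sqr_le_of_quadratic => // t.
  have H := mJ _ (Wlin 1 t _ _ (Wv_ k) Ww); have J1 := Je k.
  move: H J1; rewrite /J aq// llin// -/q; lra.
have b2 k : (a u w - a (v_ k) w) ^+ 2 <=
    a (fun x => 1 * u x + (-1) * v_ k x) (fun x => 1 * u x + (-1) * v_ k x) * (q + 1).
  have -> : a u w - a (v_ k) w = a (fun x => 1 * u x + (-1) * v_ k x) w.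
    by rewrite alin// mul1r mulN1r.
  have Wd := Wlin 1 (-1) _ _ Wu (Wv_ k).
  apply: sqr_le_of_quadratic => // t.
  have := a0 _ (Wlin 1 t _ _ Wd Ww); rewrite aq// -/q; lra.
have ce : e @ \oo --> (0 : R).
  rewrite -[X in _ --> X](_ : 8^-1 * 0 ^+ 2 = 0); last by rewrite expr0n mulr0.
  apply: cvgM; first exact: cvg_cst.
  by apply: cvg_sqr; apply: cvg_expr; rewrite ger0_norm ?invr_ge0// invf_lt1 ?ltr1n.
have : (fun k : nat => (a u w - l w) ^+ 2) @ \oo --> (0 : R).
  pose b k := 2 * (e k * (q + 1)) + 2 * (a (fun x => 1 * u x + (-1) * v_ k x)
     (fun x => 1 * u x + (-1) * v_ k x) * (q + 1)).
  apply: (@cvg0_dominated _ _ b) => [k|].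
    rewrite sqr_ge0 /b/=; have h1 := b1 k; have h2 := b2 k.
    apply: le_trans (_ : 2 * (a (v_ k) w - l w) ^+ 2 + 2 * (a u w - a (v_ k) w) ^+ 2 <= _).
      move: (a u w) (a (v_ k) w) (l w) => x y z.
      by have := sqr_ge0 (x - y - (y - z)); rewrite !expr2; nra.
    by apply: lerD; rewrite ler_pM2l.
  rewrite /b -[X in _ --> X](_ : 2 * (0 * (q + 1)) + 2 * (0 * (q + 1)) = 0); last by ring.
  apply: cvgD; (apply: cvgM; first exact: cvg_cst); apply: cvgM => //; exact: cvg_cst.
move=> /(cvg_unique (@Rhausdorff R) (cvg_cst _)) /eqP.
by rewrite sqrf_eq0 subr_eq0 => /eqP.
Qed.

(** * Integrals of functions that need not be measurable *)

Section NonMeasurableIntegrand.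
Import HBNNSimple.
Context (R : realType) (d : measure_display) (X : measurableType d).
Variables (mu : {measure set X -> \bar R}) (D : set X).
Local Open Scope ereal_scope.

(** The integral of a nonnegative function, measurable or not, is the supremum over the simple
    functions below it, and cutting a simple function off on a null set preserves its integral. *)
Lemma ge0_integral_setD_null (f : X -> \bar R) (N : set X) : measurable N ->
  mu N = 0 -> (forall x, D x -> 0 <= f x) ->
  \int[mu]_(x in D) f x = \int[mu]_(x in (D `\` N)%R) f x.
Proof.
move=> mN N0 f0.
have mNC : measurable (~` N)%classic by exact: measurableC.
rewrite !ge0_integralE//; last by move=> x [/f0].
apply/eqP; rewrite eq_le; apply/andP; split; apply: ge_ereal_sup => _ /= [h hf <-].
  apply: ereal_sup_ubound; exists (proj_nnsfun h mNC).
    move=> x; have := hf x; rewrite /= mindicE !patchE.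
    case: (boolP (x \in ~` N)) => [xN|xN].
      rewrite mulr1; case: (boolP (x \in D)) => [xD|xD].
        by rewrite ifT// inE; split; [exact: set_mem xD|exact: set_mem xN].
      by rewrite ifN// ; apply: contra xD; rewrite !inE => -[].
    move=> _; rewrite mulr0; case: ifP => // xD.
    by apply: f0; move: xD; rewrite inE => -[].
  transitivity (\int[mu]_(x in (~` N)%classic) (h x)%:E).
    rewrite integral_nnsfun//; apply: eq_sintegral => x.
    by rewrite patchE /= mindicE; case: ifP; rewrite ?mulr1 ?mulr0.
  transitivity (\int[mu]_(x in setT) (h x)%:E); last first.
    by rewrite integral_nnsfun//; apply: eq_sintegral => x; rewrite patch_setT.
  rewrite [RHS](ge0_negligible_integral mN)//; first by rewrite setTD.
    exact/measurable_EFinP/measurable_funPT.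
  by move=> x _; rewrite lee_fin.
apply: ereal_sup_ubound; exists h => // x; apply: le_trans (hf x) _.
rewrite !patchE; case: ifPn => [|_]; first by rewrite inE => -[/mem_set-> _].
by case: ifPn => // /set_mem/f0.
Qed.

Lemma integral_setD_null (f : X -> \bar R) (N : set X) : measurable N ->
  mu N = 0 -> \int[mu]_(x in D) f x = \int[mu]_(x in (D `\` N)%R) f x.
Proof.
move=> mN N0; rewrite integralE [RHS]integralE.
by congr (_ - _); apply: ge0_integral_setD_null.
Qed.

(** Applied to integrands such as the one with [sym_inverse (C x) (M x)], which agrees with a
    measurable field only almost everywhere. *)
Lemma ae_eq_integral_any (f g : X -> \bar R) :
  {ae mu, forall x, D x -> f x = g x} ->
  \int[mu]_(x in D) f x = \int[mu]_(x in D) g x.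
Proof.
move=> [N [mN N0 fgN]]; rewrite (integral_setD_null f mN N0) (integral_setD_null g mN N0).
apply: eq_integral => x; rewrite inE => -[Dx nN]; apply: contrapT => nfg; apply: nN.
by apply: fgN => /= /(_ Dx).
Qed.

End NonMeasurableIntegrand.

Lemma ae_eq_Rintegral_any (R : realType) (d : measure_display) (X : measurableType d)
  (mu : {measure set X -> \bar R}) (D : set X) (f g : X -> R) :
  ae_in mu D (fun x => f x = g x) ->
  (\int[mu]_(x in D) f x = \int[mu]_(x in D) g x)%R.
Proof.
move=> fg; congr fine; apply: ae_eq_integral_any.
by apply: (@ae_mono _ _ _ _ _ _ (fun x => (f x)%:E = (g x)%:E) fg) => x _ ->.
Qed.

Section EssentiallyBounded.
Context (R : realType) (d : measure_display) (X : measurableType d).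
Variables (mu : {measure set X -> \bar R}) (D : set X).
Hypothesis mD : measurable D.

Lemma in_Linfty_bounded f : in_Linfty mu D f -> measurable_fun D f /\
  exists2 c : R, 0 <= c & ae_in mu D (fun x => `|f x| <= c).
Proof.
move=> /andP[]; rewrite !inE /= => mf; rewrite /finite_norm unlock/= => fin.
split; first by apply/(measurable_restrictT f mD).
(* The norm is the essential supremum only on a space of positive measure; on a null space every
   bound holds. *)
case: ifPn fin => [mu0 fin|]; last first.
  rewrite -leNgt => mu0 _; exists 0 => //.
  exists setT; split => //; first by apply/eqP; rewrite eq_le mu0 measure_ge0.
exists (Num.max 0 (fine (ess_sup_inf.ess_sup mu (abse \o (EFin \o f \_ D))))); first by rewrite le_max lexx.
have := ess_sup_inf.ess_sup_ge mu (abse \o (EFin \o f \_ D)).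
have fN : (0 <= ess_sup_inf.ess_sup mu (abse \o (EFin \o f \_ D)))%E by apply: ess_sup_inf.ess_sup_gee => //; apply: nearW => x; exact: abse_ge0.
rewrite /ae_in; apply: filterS => x H Dx.
rewrite le_max; apply/orP; right; rewrite -lee_fin fineK ?ge0_fin_numE//.
by apply: le_trans H; rewrite /= patchE mem_set.
Qed.

Lemma in_L2_mul_Linfty f g : in_Linfty mu D f -> in_L2 mu D g -> in_L2 mu D (fun x => f x * g x).
Proof.
move=> /in_Linfty_bounded[mf [c c0 fc]] Lg.
apply: (in_L2_dominated mD _ (in_L2Z mD c Lg)).
  by apply: measurable_funM => //; exact: in_L2_measurable Lg.
by apply: (ae_mono fc) => x _ h; rewrite !normrM ler_wpM2r// (ger0_norm c0).
Qed.

(** The inverse of f is f times the real power -1 of f squared. Where f = 0 the factor f produces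
    the conventional value 0. *)
Lemma measurable_fun_inv (f : X -> R) : measurable_fun D f -> measurable_fun D (fun x => (f x)^-1).
Proof.
move=> mf.
have -> : (fun x => (f x)^-1) = (fun x => f x * ((f x ^+ 2) `^ (-1))).
  apply/funext => x; rewrite powR_inv1 ?sqr_ge0//.
  have [->|f0] := eqVneq (f x) 0; first by rewrite invr0 mul0r.
  by rewrite expr2 invfM mulrA divff// mul1r.
apply: measurable_funM => //; apply: (measurableT_comp (measurable_powR (-1))).
exact: measurable_funX.
Qed.

Lemma measurable_det n (F : X -> 'M[R]_n) :
  (forall i j, measurable_fun D (fun x => F x i j)) ->
  measurable_fun D (fun x => \det (F x)).
Proof.
move=> mF; rewrite /determinant; apply: measurable_sum => s.
apply: measurable_funM; first exact: measurable_cst.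
by apply: measurable_prod => i _; exact: mF.
Qed.

Lemma measurable_adj n (F : X -> 'M[R]_n) i j :
  (forall i j, measurable_fun D (fun x => F x i j)) ->
  measurable_fun D (fun x => (\adj (F x)) i j).
Proof.
move=> mF; under eq_fun do rewrite mxE /cofactor.
apply: measurable_funM; first exact: measurable_cst.
by apply: measurable_det => k l; under eq_fun do rewrite !mxE; exact: mF.
Qed.

End EssentiallyBounded.

(** * Symmetric tensors and a basis of their space *)

Section TensorAlgebra.
Variable R : realType.
Implicit Types (A B M Q : 'M[R]_2).

Lemma ddotE A B : ddot A B = A 0 0 * B 0 0 + A 0 1 * B 0 1 + (A 1 0 * B 1 0 + A 1 1 * B 1 1).
Proof. by rewrite /ddot !sum_ord2. Qed.

Lemma ddotC A B : ddot A B = ddot B A.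
Proof. by rewrite !ddotE; ring. Qed.

Lemma ddot_lincombl (a b : R) A B Q : ddot (a *: A + b *: B) Q = a * ddot A Q + b * ddot B Q.
Proof. by rewrite !ddotE !mxE; ring. Qed.

Lemma ddot_lincombr (a b : R) A B Q : ddot Q (a *: A + b *: B) = a * ddot Q A + b * ddot Q B.
Proof. by rewrite !(ddotC Q) ddot_lincombl. Qed.

Lemma ddot_ge0 A : 0 <= ddot A A.
Proof. by rewrite ddotE -!expr2 !addr_ge0 ?sqr_ge0. Qed.

Lemma entry_sqr_le A i j : A i j ^+ 2 <= ddot A A.
Proof.
rewrite /ddot (bigD1 i)//= (bigD1 j)//= -expr2 -addrA lerDl addr_ge0//.
  by apply: sumr_ge0 => k _; rewrite -expr2 sqr_ge0.
by apply: sumr_ge0 => k _; apply: sumr_ge0 => l _; rewrite -expr2 sqr_ge0.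
Qed.

Lemma ddot_eq0 A : ddot A A = 0 -> A = 0.
Proof.
move=> A0; apply/matrixP => i j; rewrite mxE; apply/eqP; rewrite -sqrf_eq0 eq_le sqr_ge0 andbT.
by rewrite -[X in _ <= X]A0 entry_sqr_le.
Qed.

Lemma ord2P (P : 'I_2 -> Prop) : P 0 -> P 1 -> forall i, P i.
Proof.
move=> P0 P1 i; have : i = 0 \/ i = 1 by case: i => -[|[|//]] p; [left|right]; apply/val_inj.
by case=> ->.
Qed.

Lemma mx2P A B : A 0 0 = B 0 0 -> A 0 1 = B 0 1 -> A 1 0 = B 1 0 -> A 1 1 = B 1 1 -> A = B.
Proof. by move=> *; apply/matrixP; apply: ord2P; apply: ord2P. Qed.

Lemma is_symP A : Defs.is_sym A <-> A 0 1 = A 1 0.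
Proof.
split=> [sA|sA]; first by rewrite -[in LHS]sA mxE.
by apply: mx2P; rewrite !mxE.
Qed.

Definition symp A : 'M[R]_2 := 2^-1 *: (A + A^T).

Lemma symp_sym A : Defs.is_sym (symp A).
Proof. by apply/is_symP; rewrite !mxE addrC. Qed.

Lemma symp_id A : Defs.is_sym A -> symp A = A.
Proof. by move=> /is_symP sA; apply: mx2P; rewrite !mxE ?sA; field. Qed.

Lemma sym_lincomb (a b : R) A B : Defs.is_sym A -> Defs.is_sym B -> Defs.is_sym (a *: A + b *: B).
Proof. by move=> /is_symP sA /is_symP sB; apply/is_symP; rewrite !mxE sA sB. Qed.

(** The last basis element is not normalised: pairing with it gives twice the off-diagonal entry of
    a symmetric tensor. *)
Definition symb (k : 'I_3) : 'M[R]_2 :=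
  if k == 0 then delta_mx 0 0 else if k == 1 then delta_mx 1 1
  else delta_mx 0 1 + delta_mx 1 0.

Lemma symb_sym k : Defs.is_sym (symb k).
Proof. by apply/is_symP; rewrite /symb; case: ifP => _; [|case: ifP => _]; rewrite !mxE/= ?addr0 ?add0r. Qed.

Lemma sum_ord3 (V : nmodType) (F : 'I_3 -> V) : \sum_i F i = F 0 + F 1 + F 2.
Proof.
rewrite !big_ord_recr big_ord0 /= add0r; congr (_ + _ + _); congr F; exact/val_inj.
Qed.

Definition sym_of (b : 'rV[R]_3) : 'M[R]_2 := \sum_k b 0 k *: symb k.

Lemma sym_ofE b : [/\ sym_of b 0 0 = b 0 0, sym_of b 0 1 = b 0 2, sym_of b 1 0 = b 0 2 &
  sym_of b 1 1 = b 0 1].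
Proof. by rewrite /sym_of sum_ord3 /symb/= !mxE/=; split; ring. Qed.

Lemma sym_of_sym b : Defs.is_sym (sym_of b).
Proof. by apply/is_symP; have [_ -> -> _] := sym_ofE b. Qed.

Lemma sym_of_eq0 b : sym_of b = 0 -> b = 0.
Proof.
move=> b0; have [e1 e2 _ e3] := sym_ofE b; rewrite b0 !mxE in e1 e2 e3.
apply/matrixP => i k; rewrite (ord1 i) mxE.
have : [\/ k = 0, k = 1 | k = 2].
  by case: k => -[|[|[|//]]] p; [apply: Or31|apply: Or32|apply: Or33]; apply/val_inj.
by case=> ->.
Qed.

Lemma sympE A : symp A = A 0 0 *: symb 0 + A 1 1 *: symb 1 + (2^-1 * (A 0 1 + A 1 0)) *: symb 2.
Proof. by apply: mx2P; rewrite /symb/= !mxE/=; field. Qed.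

Lemma sym_eq_ddot A B : Defs.is_sym A -> Defs.is_sym B ->
  (forall k, ddot A (symb k) = ddot B (symb k)) -> A = B.
Proof.
move=> /is_symP sA /is_symP sB H.
have := H 0; have := H 1; have := H 2; rewrite !ddotE /symb/= !mxE/=.
rewrite !(mulr0, mulr1, addr0, add0r) -sA -sB => e2 e1 e0.
have e : A 0 1 = B 0 1 by move: e2; lra.
by apply: mx2P => //; rewrite -sA -sB.
Qed.

End TensorAlgebra.

Section TensorFields.
Variable R : realType.
Local Notation R2 := (R * R)%type.
Local Notation mR2 := (measurableTypeR R * measurableTypeR R)%type.
Variable D : set R2.
Hypothesis mD : measurable (D : set mR2).
Implicit Types (M Q N : R2 -> 'M[R]_2).
Local Notation L2 := (in_L2 (area R) D).
Local Notation ip := (inner (area R) D).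
Local Notation nm := (norm2 (area R) D).

Definition tL2 M : Prop := forall i j, L2 (fun x => M x i j).

Lemma tinner_sum M Q : tL2 M -> tL2 Q ->
  tinner D M Q = \sum_i \sum_j ip (fun x => M x i j) (fun x => Q x i j).
Proof.
move=> LM LQ; rewrite /tinner !sum_ord2.
have i1 i j := in_L2_integrable_mul mD (LM i j) (LQ i j).
under eq_Rintegral do rewrite ddotE.
rewrite RintegralD//; last 2 first.
- by have := integrableD mD (i1 0 0) (i1 0 1); apply: eq_integrable => // x _ /=; rewrite EFinD.
- by have := integrableD mD (i1 1 0) (i1 1 1); apply: eq_integrable => // x _ /=; rewrite EFinD.
by rewrite !RintegralD//; exact: i1.
Qed.

Lemma tL2_lincomb (a b : R) M Q : tL2 M -> tL2 Q -> tL2 (fun x => a *: M x + b *: Q x).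
Proof.
move=> LM LQ i j; have := in_L2_lincomb mD a b (LM i j) (LQ i j).
rewrite (_ : (fun x => (a *: M x + b *: Q x) i j) = (fun x => a * M x i j + b * Q x i j))//.
by apply/funext => x; rewrite !mxE.
Qed.

Lemma tinnerC M Q : tinner D M Q = tinner D Q M.
Proof. by apply: eq_Rintegral => x _; exact: ddotC. Qed.

Lemma tinner_lincombl (a b : R) M N Q : tL2 M -> tL2 N -> tL2 Q ->
  tinner D (fun x => a *: M x + b *: N x) Q = a * tinner D M Q + b * tinner D N Q.
Proof.
move=> LM LN LQ; rewrite !tinner_sum//; last exact: tL2_lincomb.
rewrite !mulr_sumr -big_split; apply: eq_bigr => i _ /=.
rewrite !mulr_sumr -big_split; apply: eq_bigr => j _ /=.
rewrite -inner_lincombl//; first by congr inner; apply/funext => x; rewrite !mxE.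
Qed.

Lemma tinner_lincombr (a b : R) M N Q : tL2 M -> tL2 N -> tL2 Q ->
  tinner D Q (fun x => a *: M x + b *: N x) = a * tinner D Q M + b * tinner D Q N.
Proof. by move=> *; rewrite tinnerC tinner_lincombl// !(tinnerC Q). Qed.

Lemma ae_eq_tinner M M' Q Q' : ae_in (area R) D (fun x => M x = M' x) ->
  ae_in (area R) D (fun x => Q x = Q' x) -> tinner D M Q = tinner D M' Q'.
Proof.
move=> MM QQ; apply: ae_eq_Rintegral_any.
by apply: (ae_mono2 MM QQ) => x _ -> ->.
Qed.

Lemma tinner_ge0 M : 0 <= tinner D M M.
Proof. by apply: Rintegral_ge0 => x _; exact: ddot_ge0. Qed.

Lemma tnorm_ge0 M : 0 <= tnorm D M. Proof. exact: sqrtr_ge0. Qed.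

Lemma tnorm_sqr M : tnorm D M ^+ 2 = tinner D M M.
Proof. by rewrite sqr_sqrtr// tinner_ge0. Qed.

Lemma ae_eq_tnorm M M' : ae_in (area R) D (fun x => M x = M' x) -> tnorm D M = tnorm D M'.
Proof. by move=> H; congr Num.sqrt; exact: ae_eq_tinner. Qed.

Lemma entry_le_tnorm M i j : tL2 M -> nm (fun x => M x i j) <= tnorm D M.
Proof.
move=> LM; apply: ler_of_sqr; first exact: tnorm_ge0.
rewrite tnorm_sqr tinner_sum// norm2_sqr (bigD1 i)//= (bigD1 j)//= -addrA lerDl addr_ge0//.
  by apply: sumr_ge0 => k _; exact: inner_ge0.
by apply: sumr_ge0 => k _; apply: sumr_ge0 => l _; exact: inner_ge0.
Qed.

Lemma tnorm_sqr_sum M : tL2 M -> tnorm D M ^+ 2 = \sum_i \sum_j nm (fun x => M x i j) ^+ 2.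
Proof.
move=> LM; rewrite tnorm_sqr tinner_sum//.
by apply: eq_bigr => i _; apply: eq_bigr => j _; rewrite norm2_sqr.
Qed.

Lemma tinner_eq0 M : tL2 M -> tinner D M M = 0 -> ae_in (area R) D (fun x => M x = 0).
Proof.
move=> LM M0.
have z i j : ae_in (area R) D (fun x => M x i j = 0).
  apply: norm2_eq0 => //; apply/eqP; rewrite eq_le norm2_ge0 andbT.
  by have := entry_le_tnorm i j LM; rewrite /tnorm M0 sqrtr0.
have z0 : ae_in (area R) D (fun x => M x 0 0 = 0 /\ M x 0 1 = 0).
  by apply: (ae_mono2 (z 0 0) (z 0 1)) => x _ -> ->.
have z1 : ae_in (area R) D (fun x => M x 1 0 = 0 /\ M x 1 1 = 0).
  by apply: (ae_mono2 (z 1 0) (z 1 1)) => x _ -> ->.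
by apply: (ae_mono2 z0 z1) => x _ [e1 e2] [e3 e4]; apply: mx2P; rewrite !mxE.
Qed.

Lemma integrable_ddot M Q : tL2 M -> tL2 Q ->
  (area R).-integrable D (EFin \o (fun x => ddot (M x) (Q x))).
Proof.
move=> LM LQ; have i1 i j := in_L2_integrable_mul mD (LM i j) (LQ i j).
have := integrableD mD (integrableD mD (i1 0 0) (i1 0 1)) (integrableD mD (i1 1 0) (i1 1 1)).
by apply: eq_integrable => // x _ /=; rewrite ddotE !EFinD.
Qed.

Lemma ae_le_tinner (a b : R) M Q M' Q' : tL2 M -> tL2 Q -> tL2 M' -> tL2 Q' ->
  ae_in (area R) D (fun x => a * ddot (M x) (Q x) <= b * ddot (M' x) (Q' x)) ->
  a * tinner D M Q <= b * tinner D M' Q'.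
Proof.
move=> LM LQ LM' LQ' H.
have I1 := integrable_ddot LM LQ; have I2 := integrable_ddot LM' LQ'.
rewrite -!RintegralZl// -subr_ge0 -RintegralB//; last 2 first.
- by have := integrableZl mD b I2; apply: eq_integrable => // x _ /=; rewrite EFinM.
- by have := integrableZl mD a I1; apply: eq_integrable => // x _ /=; rewrite EFinM.
(* The inequality holds only almost everywhere, so the difference is replaced by its modulus, which
   is nonnegative everywhere. *)
rewrite (@ae_eq_Rintegral_any _ _ _ _ _ _ (fun x : mR2 => `|b * ddot (M' x) (Q' x) - a * ddot (M x) (Q x)|)).
  by apply: Rintegral_ge0 => x _; exact: normr_ge0.
by apply: (ae_mono H) => x _ h; rewrite ger0_norm// subr_ge0.
Qed.

Lemma in_L2_norm f : L2 f -> L2 (fun x => `|f x|).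
Proof.
move=> Lf; apply: (in_L2_dominated mD _ Lf).
  by apply: measurableT_comp => //; exact: in_L2_measurable Lf.
by apply: nearW => x _; rewrite normr_id.
Qed.

End TensorFields.

(** * Boundedness, injectivity and measurable inversion of the elasticity tensor *)

Section Elasticity.
Variable R : realType.
Local Notation R2 := (R * R)%type.
Local Notation mR2 := (measurableTypeR R * measurableTypeR R)%type.
Variables (D : set R2) (C : R2 -> {linear 'M[R]_2 -> 'M[R]_2}).
Hypothesis mD : measurable (D : set mR2).
Hypothesis hC : elasticity_tensor D C.
Implicit Types (M Q N : R2 -> 'M[R]_2).
Local Notation L2 := (in_L2 (area R) D).
Local Notation tL2 := (tL2 D).

(* On the null set where [M] fails to be symmetric, [C x (M x)] need not be
   measurable, hence the projection. *)
Definition cfield M (x : R2) : 'M[R]_2 := C x (symp (M x)).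

(** The coefficients [C x (symb k) i j] are essentially bounded by assumption, so this form yields
    measurability and square integrability. *)
Lemma cfieldE M x i j : cfield M x i j = C x (symb R 0) i j * M x 0 0 +
  C x (symb R 1) i j * M x 1 1 + C x (symb R 2) i j * (2^-1 * (M x 0 1 + M x 1 0)).
Proof.
by rewrite /cfield sympE !linearD !linearZ !mxE; ring.
Qed.

Lemma cfield_L2 M : tL2 M -> tL2 (cfield M).
Proof.
move=> LM i j; have [_ Cb _ _] := hC.
have Lk k : in_Linfty (area R) D (fun x => C x (symb R k) i j) by apply: Cb; exact: symb_sym.
under eq_fun do rewrite cfieldE.
apply: in_L2D => //; last first.
  apply: in_L2_mul_Linfty => //; apply: in_L2Z => //; exact: in_L2D.
by apply: in_L2D => //; exact: in_L2_mul_Linfty.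
Qed.

Lemma cfield_sym M x : D x -> Defs.is_sym (cfield M x).
Proof. by have [Cs _ _ _] := hC => Dx; apply: Cs => //; exact: symp_sym. Qed.

Lemma cfield_L2S M : tL2 M -> in_L2S D (cfield M).
Proof. by move=> LM; split; [apply: ae_all => x; exact: cfield_sym|exact: cfield_L2]. Qed.

Lemma cfield_ae M : ae_in (area R) D (fun x => Defs.is_sym (M x)) ->
  ae_in (area R) D (fun x => cfield M x = C x (M x)).
Proof. by move=> sM; apply: (ae_mono sM) => x _ s; rewrite /cfield symp_id. Qed.

Lemma cfield_lincomb (a b : R) M N x :
  cfield (fun x => a *: M x + b *: N x) x = a *: cfield M x + b *: cfield N x.
Proof.
by apply/matrixP => i j; rewrite !mxE !cfieldE !mxE; ring.
Qed.

(** With s a common bound of the entries of C on the basis, an entry of the image is a sum of three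
    products, whence 3 s^2 for its square, and there are four entries. *)
Lemma cfield_bounded : exists2 c : R, 0 <= c & ae_in (area R) D (fun x => forall M,
  Defs.is_sym (M x) -> ddot (cfield M x) (cfield M x) <= c * ddot (M x) (M x)).
Proof.
have [_ Cb _ _] := hC.
have /choice[c Hc] : forall k, exists c : 'I_2 -> 'I_2 -> R, (forall i j, 0 <= c i j) /\
    forall i j, ae_in (area R) D (fun x => `|C x (symb R k) i j| <= c i j).
  move=> k.
  have H (p : 'I_2 * 'I_2) : exists c : R, 0 <= c /\
      ae_in (area R) D (fun x => `|C x (symb R k) p.1 p.2| <= c).
    have [_ [c c0 cH]] := in_Linfty_bounded mD (Cb (symb R k) p.1 p.2 (symb_sym R k)).
    by exists c.
  have [c cH] := choice H; exists (fun i j => c (i, j)).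
  by split=> i j; have [] := cH (i, j).
pose s := \sum_k \sum_i \sum_j c k i j.
have c0 k i j : 0 <= c k i j by have [] := Hc k.
have cs k i j : c k i j <= s.
  rewrite /s (bigD1 k)//= (bigD1 i)//= (bigD1 j)//= -!addrA lerDl !addr_ge0//.
  - by apply: sumr_ge0.
  - by apply: sumr_ge0 => l _; apply: sumr_ge0.
  - by apply: sumr_ge0 => l _; apply: sumr_ge0 => m _; apply: sumr_ge0.
have s0 : 0 <= s by apply: le_trans (cs 0 0 0).
have aes k i j : ae_in (area R) D (fun x => `|C x (symb R k) i j| <= s).
  by apply: (ae_mono ((Hc k).2 i j)) => x _ h; apply: le_trans h _.
have ent i j : ae_in (area R) D (fun x => forall M, Defs.is_sym (M x) ->
    cfield M x i j ^+ 2 <= 3 * s ^+ 2 * ddot (M x) (M x)).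
  have h01 := ae_mono2 (Q := fun x : mR2 => `|C x (symb R 0) i j| <= s /\ `|C x (symb R 1) i j| <= s)
    (aes 0 i j) (aes 1 i j) (fun x _ a b => conj a b).
  apply: (ae_mono2 h01 (aes 2 i j)) => x _ [h0 h1] h2 M /is_symP sM.
  rewrite cfieldE ddotE -sM.
  have -> : 2^-1 * (M x 0 1 + M x 0 1) = M x 0 1 by field.
  move: h0 h1 h2; move: (C x (symb R 0) i j) (C x (symb R 1) i j) (C x (symb R 2) i j).
  move: (M x 0 0) (M x 1 1) (M x 0 1) => p q r u v w h0 h1 h2.
  have sq (t : R) : `|t| <= s -> t ^+ 2 <= s ^+ 2.
    by move=> h; rewrite -real_normK ?num_real// lerXn2r ?nnegrE.
  have u2 := sq _ h0; have v2 := sq _ h1; have w2 := sq _ h2.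
  have H1 : (u * p + v * q + w * r) ^+ 2 <= 3 * ((u * p) ^+ 2 + (v * q) ^+ 2 + (w * r) ^+ 2).
    move: (u * p) (v * q) (w * r) => x1 x2 x3.
    have := sqr_ge0 (x1 - x2); have := sqr_ge0 (x1 - x3); have := sqr_ge0 (x2 - x3).
    rewrite !expr2; nra.
  apply: le_trans H1 _; rewrite -mulrA ler_pM2l// !exprMn.
  have a1 := ler_wpM2r (sqr_ge0 p) u2; have a2 := ler_wpM2r (sqr_ge0 q) v2.
  have a3 := ler_wpM2r (sqr_ge0 r) w2.
  have a4 : 0 <= s ^+ 2 * r ^+ 2 by rewrite mulr_ge0 ?sqr_ge0.
  rewrite !mulrDr -!expr2; move: a1 a2 a3 a4; lra.
exists (12 * s ^+ 2); first by rewrite mulr_ge0 ?sqr_ge0.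
have e0 := ae_mono2 (Q := fun x : mR2 => forall M, Defs.is_sym (M x) ->
  cfield M x 0 0 ^+ 2 <= 3 * s ^+ 2 * ddot (M x) (M x) /\
  cfield M x 0 1 ^+ 2 <= 3 * s ^+ 2 * ddot (M x) (M x))
    (ent 0 0) (ent 0 1) (fun x _ a b M sM => conj (a M sM) (b M sM)).
have e1 := ae_mono2 (Q := fun x : mR2 => forall M, Defs.is_sym (M x) ->
  cfield M x 1 0 ^+ 2 <= 3 * s ^+ 2 * ddot (M x) (M x) /\
  cfield M x 1 1 ^+ 2 <= 3 * s ^+ 2 * ddot (M x) (M x))
    (ent 1 0) (ent 1 1) (fun x _ a b M sM => conj (a M sM) (b M sM)).
apply: (ae_mono2 e0 e1) => x _ h0 h1 M sM.
have [h00 h01] := h0 M sM; have [h10 h11] := h1 M sM.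
rewrite [leLHS]ddotE -!expr2; move: h00 h01 h10 h11.
move: (ddot _ _) => d; move: (s ^+ 2) => s2.
have -> : 12 * s2 * d = 3 * s2 * d + 3 * s2 * d + (3 * s2 * d + 3 * s2 * d) by ring.
by move=> *; rewrite !lerD.
Qed.

Lemma coercive_injective : exists2 alpha : R, 0 < alpha &
  ae_in (area R) D (fun x => forall A, Defs.is_sym A -> alpha * ddot A A <= ddot (C x A) A).
Proof. by have [_ _ _ []] := hC => alpha a0 H; exists alpha. Qed.

Lemma sym_inverse_unique x A : Defs.is_sym A ->
  (forall B, Defs.is_sym B -> C x B = 0 -> B = 0) -> sym_inverse (C x) (C x A) = A.
Proof.
move=> sA inj; rewrite /sym_inverse; apply: xget_unique; first by split.
move=> B [sB CB]; apply/eqP; rewrite -subr_eq0; apply/eqP; apply: inj.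
  by have := sym_lincomb 1 (-1) sB sA; rewrite scale1r scaleN1r.
by rewrite linearB /= CB subrr.
Qed.

Lemma elasticity_injective : ae_in (area R) D (fun x =>
  forall B, Defs.is_sym B -> ddot (C x B) B = 0 -> B = 0).
Proof.
have [alpha a0 H] := coercive_injective; apply: (ae_mono H) => x _ h B sB CB.
apply: ddot_eq0; apply/eqP; rewrite eq_le ddot_ge0 andbT.
by have := h B sB; rewrite CB pmulr_rle0.
Qed.

Lemma sym_inverse_cfield M : ae_in (area R) D (fun x => Defs.is_sym (M x)) ->
  ae_in (area R) D (fun x => sym_inverse (C x) (cfield M x) = M x).
Proof.
move=> sM; apply: (ae_mono2 sM elasticity_injective) => x _ s inj.
rewrite /cfield symp_id//; apply: sym_inverse_unique => // B sB CB.
by apply: inj => //; rewrite CB ddotE !mxE; ring.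
Qed.

(** Matrix of the bilinear form of C x in the basis [symb]: inverting C x on symmetric tensors
    becomes a linear system of size 3. *)
Let K (x : R2) : 'M[R]_3 := \matrix_(l, k) ddot (C x (symb R l)) (symb R k).

Lemma sym_of_linear (b : 'rV[R]_3) x k :
  ddot (C x (sym_of b)) (symb R k) = (b *m K x) 0 k.
Proof.
rewrite mxE /sym_of linear_sum /= !sum_ord3 !linearZ /= !mxE !ddotE !mxE; ring.
Qed.

(** [sym_inverse] is a pointwise choice without evident measurability. Cramer's rule expresses it
    through determinants of measurable entries, and coercivity makes the result square
    integrable. *)
Lemma sym_inverse_field M : in_L2S D M -> exists2 B, in_L2S D B &
  ae_in (area R) D (fun x => sym_inverse (C x) (M x) = B x /\ C x (B x) = M x).
Proof.
move=> [sM LM]; have [Cs Cb _ _] := hC.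
pose m (x : R2) : 'rV[R]_3 := \row_k ddot (M x) (symb R k).
pose b (x : R2) : 'rV[R]_3 := (\det (K x))^-1 *: (m x *m \adj (K x)).
pose B (x : R2) := sym_of (b x).
(* A kernel vector of K would be the coordinate vector of a symmetric tensor of zero energy. *)
have detK : ae_in (area R) D (fun x => \det (K x) != 0).
  apply: (ae_mono elasticity_injective) => x _ inj; apply/negP => /det0P[v vn0 vK].
  move/eqP: vn0; apply; apply: sym_of_eq0; apply: inj; first exact: sym_of_sym.
  rewrite {2}/sym_of ddotC /ddot; under eq_bigr do under eq_bigr do rewrite summxE mulr_suml.
  transitivity (\sum_k v 0 k * ddot (C x (sym_of v)) (symb R k)); last first.
    by apply: big1 => k _; rewrite sym_of_linear vK mxE mulr0.
  by rewrite !sum_ord3 !sum_ord2 !ddotE !sum_ord3 !mxE; ring.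
have CB : ae_in (area R) D (fun x => C x (B x) = M x).
  apply: (ae_mono2 sM detK) => x Dx s dK; apply: sym_eq_ddot => //.
    by apply: Cs => //; exact: sym_of_sym.
  move=> k; rewrite sym_of_linear /b -scalemxAl -mulmxA mul_adj_mx mul_mx_scalar.
  by rewrite scalerA mulVf// scale1r mxE.
have mK i j : measurable_fun D (fun x : mR2 => K x i j).
  under eq_fun do rewrite mxE ddotE.
  have mC k l : measurable_fun D (fun x : mR2 => C x (symb R i) k l).
    by have [] := in_Linfty_bounded mD (Cb (symb R i) k l (symb_sym R i)).
  by apply: measurable_funD; apply: measurable_funD; apply: measurable_funM.
have mM i j : measurable_fun D (fun x : mR2 => M x i j) := in_L2_measurable mD (LM i j).
have mb k : measurable_fun D (fun x : mR2 => b x 0 k).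
  under eq_fun do rewrite !mxE.
  apply: measurable_funM; first by apply: measurable_fun_inv => //; exact: measurable_det.
  apply: measurable_sum => l; apply: measurable_funM; last exact: measurable_adj.
  under eq_fun do rewrite mxE ddotE.
  by apply: measurable_funD; apply: measurable_funD; apply: measurable_funM.
have mB i j : measurable_fun D (fun x : mR2 => B x i j).
  under eq_fun do rewrite /B /sym_of summxE.
  apply: measurable_sum => k; under eq_fun do rewrite mxE.
  by apply: measurable_funM; [exact: mb|exact: measurable_cst].
have [alpha a0 Ha] := coercive_injective.
have BM : ae_in (area R) D (fun x => alpha ^+ 2 * ddot (B x) (B x) <= ddot (M x) (M x)).
  apply: (ae_mono2 CB Ha) => x _ cb ha.
  have h1 := ha (B x) (sym_of_sym _); rewrite cb in h1.
  (* |M - alpha B|^2 >= 0 and alpha |B|^2 <= (M, B) together give alpha^2 |B|^2 <= |M|^2. *)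
  have h2 := ddot_ge0 (1 *: M x + (- alpha) *: B x).
  rewrite ddot_lincombl !ddot_lincombr (ddotC (B x) (M x)) in h2.
  move: h1 h2; move: (ddot (B x) (B x)) (ddot (M x) (B x)) (ddot (M x) (M x)) => p q r h1 h2.
  have := ler_wpM2l (ltW a0) h1; rewrite expr2 mulrA; nra.
have LB i j : L2 (fun x => B x i j).
  pose g (x : R2) := alpha^-1 * (`|M x 0 0| + `|M x 0 1| + (`|M x 1 0| + `|M x 1 1|)).
  have Lg : L2 g.
    apply: in_L2Z => //; apply: in_L2D => //; apply: in_L2D => //; exact: in_L2_norm.
  apply: (in_L2_dominated mD (mB i j) Lg); apply: (ae_mono BM) => x _ h.
  have g0 : 0 <= g x by rewrite /g mulr_ge0 ?addr_ge0 ?invr_ge0 ?(ltW a0).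
  rewrite (ger0_norm g0); apply: ler_of_sqr => //.
  rewrite real_normK ?num_real//; apply: le_trans (entry_sqr_le (B x) i j) _.
  rewrite /g exprMn exprVn ler_pdivlMl ?exprn_gt0//; apply: le_trans h _.
  rewrite ddotE -!expr2 -!(real_normK (num_real (M x _ _))).
  have := normr_ge0 (M x 0 0); have := normr_ge0 (M x 0 1).
  have := normr_ge0 (M x 1 0); have := normr_ge0 (M x 1 1).
  move: `|M x 0 0| `|M x 0 1| `|M x 1 0| `|M x 1 1| => p q r s s0 r0 q0 p0.
  have := mulr_ge0 p0 q0; have := mulr_ge0 p0 r0; have := mulr_ge0 p0 s0.
  have := mulr_ge0 q0 r0; have := mulr_ge0 q0 s0; have := mulr_ge0 r0 s0.
  rewrite !expr2; lra.
exists B.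
  by split=> //; apply: ae_all => x _; exact: sym_of_sym.
apply: (ae_mono2 CB elasticity_injective) => x _ cb inj; split=> //.
rewrite -[in LHS]cb; apply: sym_inverse_unique; first exact: sym_of_sym.
by move=> A sA CA; apply: inj => //; rewrite CA ddotE !mxE; ring.
Qed.

End Elasticity.

Lemma sum4_le (R : realType) (F : 'I_2 -> 'I_2 -> R) (z : R) :
  (forall i j, F i j <= z) -> \sum_i \sum_j F i j <= 4 * z.
Proof.
move=> H; rewrite !sum_ord2; have := H 0 0; have := H 0 1; have := H 1 0; have := H 1 1; lra.
Qed.

(** * Solvability and stability of the clamped plate problem *)

Section PrimalProblem.
Variable R : realType.
Local Notation R2 := (R * R)%type.
Local Notation mR2 := (measurableTypeR R * measurableTypeR R)%type.
Variables (D : set R2) (E : seq (R2 * R2)) (C : R2 -> {linear 'M[R]_2 -> 'M[R]_2}).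
Hypotheses (oD : open D) (bD : bounded_set D) (lD : lipschitz_boundary D).
Hypothesis frE : frontier D = [set x | exists2 e, e \in E & segment e.1 e.2 x].
Hypothesis hC : elasticity_tensor D C.
Implicit Types (u v w g h f : R2 -> R).
Local Notation L2 := (in_L2 (area R) D).
Local Notation ip := (inner (area R) D).
Local Notation nm := (norm2 (area R) D).
Local Notation wd := (wderiv D).
Local Notation hess := (hessian D).
Local Notation tL2 := (tL2 D).
Local Notation cfield := (cfield C).
Let mD : measurable (D : set mR2) := open_measurable_plane oD.

Lemma hessianE v i j : (fun x => hess v x i j) = wd [:: i; j] v.
Proof. by apply/funext => x; rewrite mxE. Qed.

Lemma hessian_L2 v : Hk 2 D v -> tL2 (hess v).
Proof. by move=> Hv i j; rewrite hessianE; exact: (@Hk_wderiv_L2 _ _ 2 [:: i; j] _ Hv isT). Qed.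

Lemma hessian_L2S v : Hk 2 D v -> in_L2S D (hess v).
Proof. by move=> Hv; split; [exact: hessian_sym|exact: hessian_L2]. Qed.

Lemma hessian_lincomb (a b : R) v w : Hk 2 D v -> Hk 2 D w ->
  ae_in (area R) D (fun x => hess (fun x => a * v x + b * w x) x = a *: hess v x + b *: hess w x).
Proof.
move=> Hv Hw.
have H i j := wderiv_lincomb oD bD a b Hv Hw (isT : (size [:: i; j] <= 2)%N).
pose P i j (x : R2) := hess (fun x => a * v x + b * w x) x i j = (a *: hess v x + b *: hess w x) i j.
have HP i j : ae_in (area R) D (P i j) by apply: (ae_mono (H i j)) => x _; rewrite /P !mxE.
have h0 := ae_mono2 (Q := fun x : mR2 => P 0 0 x /\ P 0 1 x) (HP 0 0) (HP 0 1) (fun x _ p q => conj p q).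
have h1 := ae_mono2 (Q := fun x : mR2 => P 1 0 x /\ P 1 1 x) (HP 1 0) (HP 1 1) (fun x _ p q => conj p q).
by apply: (ae_mono2 h0 h1) => x _ [p q] [r t]; exact: mx2P.
Qed.

Lemma hessian_wderiv_norm v w i j : Hk 2 D v -> Hk 2 D w ->
  nm (wd [:: i; j] (fun x => 1 * v x + (-1) * w x)) = nm (fun x => wd [:: i; j] v x - wd [:: i; j] w x).
Proof.
move=> Hv Hw; have Hd := Hk_lincomb oD bD 1 (-1) Hv Hw.
have Lv := @Hk_wderiv_L2 _ _ 2 [:: i; j] _ Hv isT.
have Lw := @Hk_wderiv_L2 _ _ 2 [:: i; j] _ Hw isT.
apply: (ae_eq_norm2 mD (in_L2_measurable mD (@Hk_wderiv_L2 _ _ 2 [:: i; j] _ Hd isT))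
  (in_L2_measurable mD (in_L2B mD Lv Lw))).
apply: (ae_mono (wderiv_lincomb oD bD 1 (-1) Hv Hw (isT : (size [:: i; j] <= 2)%N))) => x _ ->.
by rewrite mul1r mulN1r.
Qed.

Lemma H20_norm_le_hessian : exists2 c : R, 0 < c &
  forall v, H20 D v -> nm v <= c * tnorm D (hess v).
Proof.
have [B B0 HB] := H20_poincare oD bD frE.
exists (B ^+ 2); first by rewrite exprn_gt0.
move=> v Hv; have Hv2 : Hk 2 D v by have [] := Hv.
have [|H _] := HB v (tnorm D (hess v)) Hv; last exact: H.
by move=> j; rewrite -hessianE; exact: (entry_le_tnorm mD _ _ (hessian_L2 Hv2)).
Qed.

Definition energy u v : R := tinner D (cfield (hess u)) (hess v).

Lemma energyC u v : Hk 2 D u -> Hk 2 D v -> energy u v = energy v u.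
Proof.
move=> Hu Hv; have [_ _ Cs _] := hC; rewrite /energy [RHS]tinnerC.
apply: ae_eq_Rintegral_any.
have [su _] := hessian_L2S Hu; have [sv _] := hessian_L2S Hv.
have suv := ae_mono2 (Q := fun x : mR2 => Defs.is_sym (hess u x) /\ Defs.is_sym (hess v x))
  su sv (fun x _ p q => conj p q).
apply: (ae_mono2 Cs suv) => x _ cs [p q].
by rewrite /cfield !symp_id// cs.
Qed.

Lemma energy_lincombl (a b : R) u v w : Hk 2 D u -> Hk 2 D v -> Hk 2 D w ->
  energy (fun x => a * u x + b * v x) w = a * energy u w + b * energy v w.
Proof.
move=> Hu Hv Hw; have Lu := hessian_L2 Hu; have Lv := hessian_L2 Hv; have Lw := hessian_L2 Hw.
rewrite /energy -tinner_lincombl//; try exact: cfield_L2.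
apply: ae_eq_tinner; last by apply: ae_all.
apply: (ae_mono (hessian_lincomb a b Hu Hv)) => x _ hx.
by rewrite -cfield_lincomb /cfield hx.
Qed.

Lemma energy_coercive : exists2 alpha : R, 0 < alpha &
  forall v, Hk 2 D v -> alpha * tnorm D (hess v) ^+ 2 <= energy v v.
Proof.
have [alpha a0 Ha] := coercive_injective hC; exists alpha => // v Hv.
have [sv Lv] := hessian_L2S Hv.
rewrite tnorm_sqr -[energy v v]mul1r; apply: ae_le_tinner => //; first exact: cfield_L2.
by apply: (ae_mono2 Ha sv) => x _ h s; rewrite mul1r /cfield symp_id//; exact: h.
Qed.

Lemma cfield_tnorm : exists2 c : R, 0 <= c & forall M, in_L2S D M ->
  tnorm D (cfield M) <= c * tnorm D M.
Proof.
have [c c0 Hc] := cfield_bounded mD hC; exists (Num.sqrt c); first exact: sqrtr_ge0.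
move=> M [sM LM]; apply: ler_of_sqr; first by rewrite mulr_ge0 ?sqrtr_ge0.
rewrite exprMn !tnorm_sqr sqr_sqrtr// -[leLHS]mul1r.
have LC := cfield_L2 mD hC LM.
apply: ae_le_tinner => //.
by apply: (ae_mono2 Hc sM) => x _ h s; rewrite mul1r; exact: h.
Qed.

(** Twice the product of C M and M is at most |C M|^2 + |M|^2, whence the factor (c + 1) / 2. *)
Lemma energy_bounded : exists2 c : R, 0 <= c & forall v, Hk 2 D v ->
  energy v v <= c * \sum_i \sum_j nm (wd [:: i; j] v) ^+ 2.
Proof.
have [c c0 Hc] := cfield_bounded mD hC; exists (2^-1 * (c + 1)).
  by rewrite mulr_ge0 ?addr_ge0 ?invr_ge0.
move=> v Hv; have [sv Lv] := hessian_L2S Hv; have LC := cfield_L2 mD hC Lv.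
have -> : \sum_i \sum_j nm (wd [:: i; j] v) ^+ 2 = tinner D (hess v) (hess v).
  rewrite -tnorm_sqr tnorm_sqr_sum//.
  by apply: eq_bigr => i _; apply: eq_bigr => j _; rewrite hessianE.
rewrite -[energy v v]mul1r; apply: ae_le_tinner => //.
apply: (ae_mono2 Hc sv) => x _ h s; have := h _ s.
have := ddot_ge0 (1 *: cfield (hess v) x + (-1) *: hess v x).
rewrite ddot_lincombl !ddot_lincombr (ddotC (hess v x) (cfield _ _)).
move: (ddot (cfield (hess v) x) (cfield (hess v) x)) (ddot (cfield (hess v) x) (hess v x)).
by move: (ddot (hess v x) (hess v x)) => p q r; lra.
Qed.

Lemma H20_Hk v : H20 D v -> Hk 2 D v. Proof. by case. Qed.

Lemma H20_nonempty : H20 D !=set0.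
Proof.
exists (fun=> 0); apply: (test_H20 oD bD frE); split; first exact: smooth0.
by exists set0; split => //; exact: compact0.
Qed.

(** Coercivity turns increments of energy into increments of second derivatives, with L =
    alpha^(-1/2); boundedness of the energy turns their L2 convergence back into convergence in
    energy. *)
Lemma energy_complete (v_ : nat -> R2 -> R) : (forall k, H20 D (v_ k)) ->
  (forall k, energy (fun x => 1 * v_ k.+1 x + (-1) * v_ k x)
     (fun x => 1 * v_ k.+1 x + (-1) * v_ k x) <= ((2^-1) ^+ k) ^+ 2) ->
  exists2 u, H20 D u & (fun k => energy (fun x => 1 * u x + (-1) * v_ k x)
      (fun x => 1 * u x + (-1) * v_ k x)) @ \oo --> (0 : R).
Proof.
move=> Hv_ He; have [alpha a0 Ha] := energy_coercive; have [c c0 Hc] := energy_bounded.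
have Hk_ k := H20_Hk (Hv_ k).
pose L := Num.sqrt alpha^-1.
have L2E : L ^+ 2 = alpha^-1 by rewrite sqr_sqrtr// invr_ge0 ltW.
have Hd k := Hk_lincomb oD bD 1 (-1) (Hk_ k.+1) (Hk_ k).
have fast i j k : nm (fun x => wd [:: i; j] (v_ k.+1) x - wd [:: i; j] (v_ k) x) <= L * (2^-1) ^+ k.
  rewrite -hessian_wderiv_norm//; apply: ler_of_sqr.
    by rewrite mulr_ge0 ?sqrtr_ge0// exprn_ge0// invr_ge0.
  rewrite exprMn L2E ler_pdivlMl//; apply: le_trans (He k); apply: le_trans (Ha _ (Hd k)).
  rewrite ler_pM2l// lerXn2r ?nnegrE ?norm2_ge0 ?tnorm_ge0//.
  by rewrite -hessianE; exact: (entry_le_tnorm mD _ _ (hessian_L2 (Hd k))).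
have [u [Hu Hlim]] := H20_complete oD bD lD frE Hv_ fast.
exists u => //; have Hku := H20_Hk Hu.
pose b k : R := c * (4 * (2 * L * (2^-1) ^+ k) ^+ 2).
apply: (@cvg0_dominated _ _ b) => [k|].
  have Hdk := Hk_lincomb oD bD 1 (-1) Hku (Hk_ k).
  apply/andP; split.
    by apply: le_trans (Ha _ Hdk); rewrite mulr_ge0 ?sqr_ge0// ltW.
  apply: le_trans (Hc _ Hdk) _; apply: ler_wpM2l => //.
  have nk i j : nm (wd [:: i; j] (fun x => 1 * u x + (-1) * v_ k x)) ^+ 2 <= (2 * L * (2^-1) ^+ k) ^+ 2.
    rewrite hessian_wderiv_norm//; apply: lerXn2r; last exact: Hlim.
      by rewrite nnegrE norm2_ge0.
    by rewrite nnegrE !mulr_ge0 ?sqrtr_ge0 ?exprn_ge0 ?invr_ge0.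
  exact: sum4_le nk.
rewrite /b -[X in _ --> X](_ : c * (4 * (2 * L * 0) ^+ 2) = 0); last by rewrite mulr0 expr0n/= !mulr0.
apply: cvgM; first exact: cvg_cst.
apply: cvgM; first exact: cvg_cst.
apply: cvg_sqr; apply: cvgM; first exact: cvg_cst.
by apply: cvg_expr; rewrite ger0_norm ?invr_ge0// invf_lt1 ?ltr1n.
Qed.

Lemma primal_solution f : L2 f ->
  exists2 u, H20 D u & forall w, H20 D w -> energy u w = ip f w.
Proof.
move=> Lf; have [alpha a0 Ha] := energy_coercive; have [c c0 Hc] := H20_norm_le_hessian.
(* The bound of the functional combines Cauchy-Schwarz, |u| <= c |D^2 u| and alpha |D^2 u|^2 <=
   energy. *)
apply: (@riesz_representation R R2 (H20 D) energy (fun v => ip f v) (nm f ^+ 2 * (c ^+ 2 * alpha^-1))).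
- exact: H20_nonempty.
- by move=> a b u v Hu Hv; exact: H20_lincomb.
- by move=> a b u v w Hu Hv Hw; apply: energy_lincombl; exact: H20_Hk.
- by move=> u v Hu Hv; apply: energyC; exact: H20_Hk.
- move=> u Hu; apply: le_trans (Ha u (H20_Hk Hu)).
  by rewrite mulr_ge0 ?sqr_ge0// ltW.
- move=> a b u v Hu Hv; rewrite innerC inner_lincombl//; last 2 first.
    by have [] := H20_Hk Hu.
    by have [] := H20_Hk Hv.
  by rewrite (innerC (area R) D u) (innerC (area R) D v).
- by apply: mulr_ge0; [exact: sqr_ge0|apply: mulr_ge0; [exact: sqr_ge0|rewrite invr_ge0 ltW]].
- move=> u Hu; have [Lu _] := H20_Hk Hu.
  apply: le_trans (inner_CS_sqr mD Lf Lu) _; rewrite -!norm2_sqr -mulrA.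
  apply: ler_wpM2l; first exact: sqr_ge0.
  apply: le_trans (_ : (c * tnorm D (hess u)) ^+ 2 <= _).
    by rewrite lerXn2r ?nnegrE ?norm2_ge0 ?mulr_ge0 ?tnorm_ge0 ?(ltW c0)//; exact: Hc.
  rewrite exprMn -mulrA ler_wpM2l ?sqr_ge0// ler_pdivlMl//; exact: Ha (H20_Hk Hu).
- exact: energy_complete.
Qed.

(** Testing with u itself gives alpha |D^2 u|^2 <= (f, u) <= c |f| |D^2 u|; the other two bounds
    follow from this one. No mesh has appeared so far. *)
Lemma primal_stability : exists2 K : R, 0 < K & forall f u, L2 f -> H20 D u ->
  (forall w, H20 D w -> energy u w = ip f w) ->
  [/\ nm u <= K * nm f, tnorm D (hess u) <= K * nm f & tnorm D (cfield (hess u)) <= K * nm f].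
Proof.
have [alpha a0 Ha] := energy_coercive; have [c c0 Hc] := H20_norm_le_hessian.
have [d d0 Hd] := cfield_tnorm.
pose k := alpha^-1 * c; have k0 : 0 < k by rewrite mulr_gt0 ?invr_gt0.
pose K := k + c * k + d * k.
have [K1 K2 K3] : [/\ c * k <= K, k <= K & d * k <= K].
  have h1 : 0 <= c * k by rewrite mulr_ge0 ?ltW.
  have h2 : 0 <= d * k by rewrite mulr_ge0// ltW.
  rewrite /K; split.
  - by rewrite addrAC lerDr addr_ge0// ltW.
  - by rewrite -addrA lerDl addr_ge0.
  - by rewrite lerDr addr_ge0// ltW.
exists K; first by apply: lt_le_trans K2.
move=> f u Lf Hu Eu; have Hku := H20_Hk Hu; have [Lu _] := Hku.
have Ht : tnorm D (hess u) <= k * nm f.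
  apply: ler_of_sqr_mul; [exact: tnorm_ge0|by rewrite mulr_ge0 ?norm2_ge0// ltW|].
  rewrite -(ler_pM2l a0); apply: le_trans (Ha u Hku) _; rewrite Eu//.
  apply: le_trans (ler_norm _) _; apply: le_trans (inner_CS mD Lf Lu) _.
  apply: le_trans (ler_wpM2l (norm2_ge0 _ _ _) (Hc u Hu)) _.
  rewrite /k le_eqVlt; apply/orP; left; apply/eqP.
  by rewrite !mulrA (mulrC alpha) -!mulrA (mulrA alpha) divff ?gt_eqF// mul1r mulrCA [in RHS]mulrCA (mulrC (nm f)).
have f0 := norm2_ge0 (area R) D f.
have mono (a : R) : a <= K -> a * nm f <= K * nm f by move=> h; rewrite ler_wpM2r.
split.
- apply: le_trans (Hc u Hu) _; apply: le_trans (mono _ K1).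
  by rewrite -mulrA ler_pM2l.
- exact: le_trans Ht (mono _ K2).
- apply: le_trans (Hd _ (hessian_L2S Hku)) _; apply: le_trans (mono _ K3).
  by rewrite -mulrA ler_wpM2l.
Qed.

End PrimalProblem.

(** * Triangulations *)

Section NullLines.
Variable R : realType.
Local Notation R2 := (R * R)%type.
Local Notation mR2 := (measurableTypeR R * measurableTypeR R)%type.

Lemma measurable_line (a b c : R) : measurable ([set x : R2 | c + x.1 * a + x.2 * b = 0] : set mR2).
Proof.
apply: closed_measurable_plane.
have -> : [set x : R2 | c + x.1 * a + x.2 * b = 0] = (fun x : R2 => c + x.1 * a + x.2 * b) @^-1` [set 0] by [].
apply: preimage_closed; last exact: closed_eq.
by move=> x _; exact: continuous_affine2.
Qed.

(** A vertical line is the product of a point and the axis; any other line meets each vertical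
    section in one point. *)
Lemma line_null (a b c : R) : a != 0 \/ b != 0 ->
  area R [set x : R2 | c + x.1 * a + x.2 * b = 0] = 0%E.
Proof.
move=> ab; set Z := [set x : R2 | _].
have [b0|bn0] := eqVneq b 0.
  have an0 : a != 0 by case: ab => //; rewrite b0 eqxx.
  have -> : Z = [set - c / a] `*` setT.
    apply/seteqP; split=> x /=; rewrite /Z/= b0 mulr0 addr0.
      by move=> /eqP; rewrite addr_eq0 => /eqP ->; rewrite opprK mulfK.
    by move=> [-> _]; rewrite divfK// subrr.
  have := @product_measure1E _ _ _ _ R (@lebesgue_measure R) (@lebesgue_measure R)
    [set - c / a] setT (measurable_set1 _) measurableT.
  by rewrite [X in (_ = X * _)%E](lebesgue_measure_set1 (- c / a)) mul0e.
rewrite /area /product_measure1; apply: integral0_eq => x _ /=.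
rewrite (_ : xsection Z x = [set - (c + x * a) / b]); first exact: lebesgue_measure_set1.
apply/seteqP; split=> y; rewrite /xsection/= inE /Z/=.
  by move=> /eqP; rewrite addr_eq0 => /eqP ->; rewrite opprK mulfK.
by move=> ->; rewrite divfK// subrr.
Qed.

End NullLines.

(** * Barycentric coordinates *)

Section Triangles.
Variable R : realType.
Local Notation R2 := (R * R)%type.
Local Notation mR2 := (measurableTypeR R * measurableTypeR R)%type.
Implicit Types (p : 'I_3 -> R2).

(** Twice the signed area of the triangle. *)
Definition tri_det p : R :=
  ((p 1).1 - (p 0).1) * ((p 2).2 - (p 0).2) - ((p 2).1 - (p 0).1) * ((p 1).2 - (p 0).2).

(* Barycentric coordinates, by Cramer's rule. *)
Definition bary p (k : 'I_3) (x : R2) : R :=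
  let b1 := ((x.1 - (p 0).1) * ((p 2).2 - (p 0).2) - ((p 2).1 - (p 0).1) * (x.2 - (p 0).2)) / tri_det p in
  let b2 := (((p 1).1 - (p 0).1) * (x.2 - (p 0).2) - (x.1 - (p 0).1) * ((p 1).2 - (p 0).2)) / tri_det p in
  if k == 0 then 1 - b1 - b2 else if k == 1 then b1 else b2.

Lemma triangle_area_det p : 0 < triangle_area p -> tri_det p != 0.
Proof. by rewrite /triangle_area -/(tri_det p); apply: contraTneq => ->; rewrite normr0 mul0r ltxx. Qed.

Lemma ord3P (P : 'I_3 -> Prop) : P 0 -> P 1 -> P 2 -> forall i, P i.
Proof.
move=> P0 P1 P2 i; have : [\/ i = 0, i = 1 | i = 2].
  by case: i => -[|[|[|//]]] q; [apply: Or31|apply: Or32|apply: Or33]; apply/val_inj.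
by case=> ->.
Qed.

Lemma bary_unique p (l : 'I_3 -> R) x : tri_det p != 0 -> \sum_k l k = 1 ->
  x = \sum_k l k *: p k -> forall k, l k = bary p k x.
Proof.
move=> d0; rewrite !sum_ord3 => l1 xE.
have l0 : l 0 = 1 - l 1 - l 2 by rewrite -l1; ring.
have x1 : x.1 = l 0 * (p 0).1 + l 1 * (p 1).1 + l 2 * (p 2).1 by rewrite xE.
have x2 : x.2 = l 0 * (p 0).2 + l 1 * (p 1).2 + l 2 * (p 2).2 by rewrite xE.
have e1 : l 1 = bary p 1 x.
  rewrite /bary/= x1 x2 l0; move: d0; rewrite /tri_det => d0; field; exact: d0.
have e2 : l 2 = bary p 2 x.
  rewrite /bary/= x1 x2 l0; move: d0; rewrite /tri_det => d0; field; exact: d0.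
by apply: ord3P => //; rewrite l0 e1 e2 /bary.
Qed.

Lemma bary_sum p x : tri_det p != 0 -> \sum_k bary p k x = 1 /\ x = \sum_k bary p k x *: p k.
Proof.
move=> d0; rewrite !sum_ord3; split; first by rewrite /bary/=; ring.
rewrite [LHS]surjective_pairing [RHS]surjective_pairing /bary/=.
by congr pair; move: d0; rewrite /tri_det /GRing.scale/= => d0; field; exact: d0.
Qed.

Lemma open_triangleE p : tri_det p != 0 -> open_triangle p = [set x | forall k, 0 < bary p k x].
Proof.
move=> d0; apply/seteqP; split=> x.
  by move=> [l [l0 l1 xE]] k; rewrite -(bary_unique d0 l1 xE).
by move=> H; exists (bary p ^~ x); have [s1 xE] := bary_sum x d0.
Qed.

Lemma faceE p K : tri_det p != 0 -> face p K = [set x | (forall k, 0 <= bary p k x) /\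
  forall k, ~ K k -> bary p k x = 0].
Proof.
move=> d0; apply/seteqP; split=> x.
  move=> [l [l0 lK l1 xE]]; have e := bary_unique d0 l1 xE.
  by split=> k; [rewrite -e|move=> nK; rewrite -e; exact: lK].
by move=> [H0 HK]; exists (bary p ^~ x); have [s1 xE] := bary_sum x d0.
Qed.

Lemma bary_affine p k : exists a b c : R, forall x, bary p k x = c + x.1 * a + x.2 * b.
Proof.
have H1 : exists a b c : R, forall x, bary p 1 x = c + x.1 * a + x.2 * b.
  exists (((p 2).2 - (p 0).2) / tri_det p), (- ((p 2).1 - (p 0).1) / tri_det p),
    ((((p 2).1 - (p 0).1) * (p 0).2 - (p 0).1 * ((p 2).2 - (p 0).2)) / tri_det p).
  by move=> x; rewrite /bary/=; ring.
have H2 : exists a b c : R, forall x, bary p 2 x = c + x.1 * a + x.2 * b.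
  exists (- ((p 1).2 - (p 0).2) / tri_det p), (((p 1).1 - (p 0).1) / tri_det p),
    (((p 0).1 * ((p 1).2 - (p 0).2) - ((p 1).1 - (p 0).1) * (p 0).2) / tri_det p).
  by move=> x; rewrite /bary/=; ring.
move: k; apply: ord3P => //.
have [a1 [b1 [c1 E1]]] := H1; have [a2 [b2 [c2 E2]]] := H2.
exists (- a1 - a2), (- b1 - b2), (1 - c1 - c2) => x.
have -> : bary p 0 x = 1 - bary p 1 x - bary p 2 x by [].
by rewrite E1 E2; ring.
Qed.

Lemma bary_vertex p k l : tri_det p != 0 -> bary p k (p l) = (k == l)%:R.
Proof.
move=> d0; rewrite -(@bary_unique p (fun k => (k == l)%:R) (p l) d0)//.
- by rewrite (bigD1 l)//= eqxx big1 ?addr0// => i /negbTE ->.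
- rewrite (bigD1 l)//= eqxx scale1r big1 ?addr0// => i /negbTE ->.
  by rewrite scale0r.
Qed.

(** The coordinate is affine and takes the values 1 and 0 at two vertices, so it is not constant and
    its zero set is a line. *)
Lemma bary_zero_null p k : tri_det p != 0 ->
  measurable ([set x | bary p k x = 0] : set mR2) /\ area R [set x | bary p k x = 0] = 0%E.
Proof.
move=> d0; have [a [b [c E]]] := bary_affine p k.
have -> : [set x | bary p k x = 0] = [set x : R2 | c + x.1 * a + x.2 * b = 0].
  by apply/seteqP; split=> x /=; rewrite E.
split; first exact: measurable_line.
apply: line_null; have [a0|] := eqVneq a 0; last by left.
right; apply/eqP => b0.
have k1 := bary_vertex k k d0; have kl := bary_vertex k (if k == 0 then 1 else 0) d0.
rewrite eqxx E a0 b0 !mulr0 !addr0 in k1; rewrite E a0 b0 !mulr0 !addr0 k1 in kl.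
move: kl; have : k != (if k == 0 then 1 else 0) by move: k {E k1}; apply: ord3P.
by move=> /negbTE ->; exact/eqP/oner_neq0.
Qed.

Lemma continuous_bary p k : continuous (bary p k).
Proof.
have [a [b [c E]]] := bary_affine p k; have -> : bary p k = (fun x => c + x.1 * a + x.2 * b).
  exact/funext.
exact: continuous_affine2.
Qed.

Lemma open_open_triangle p : tri_det p != 0 -> open (open_triangle p).
Proof.
move=> d0; rewrite open_triangleE//.
have -> : [set x | forall k, 0 < bary p k x] =
    bary p 0 @^-1` [set y | 0 < y] `&` (bary p 1 @^-1` [set y | 0 < y] `&` bary p 2 @^-1` [set y | 0 < y]).
  by apply/seteqP; split=> x /= => [H|[h0 [h1 h2]]]; [|exact: ord3P].
have oP k : open (bary p k @^-1` [set y | 0 < y]).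
  by apply: open_comp; [move=> x _; exact: continuous_bary|exact: open_gt].
by apply: openI => //; exact: openI.
Qed.

End Triangles.

Lemma lipschitz_global (R : realType) (h : R -> R) : lipschitz h ->
  exists2 L : R, 0 < L & forall x y, `|h x - h y| <= L * `|x - y|.
Proof.
move=> [L [Lr HL]]; exists (`|L| + 1); first by rewrite ltr_wpDl.
move=> x y; have := HL (`|L| + 1) _ (x, y); apply; last by [].
by rewrite (le_lt_trans (ler_norm L))// ltrDl.
Qed.

Lemma ae_forall (R : realType) (d : measure_display) (X : measurableType d)
    (mu : {measure set X -> \bar R}) (D : set X) (I : finType) (P : I -> X -> Prop) :
  (forall i, ae_in mu D (P i)) -> ae_in mu D (fun x => forall i, P i x).
Proof.
move=> H; have : {ae mu, forall x, forall i, D x -> P i x} by apply: filter_forall.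
by rewrite /ae_in; apply: filterS => x h Dx i; exact: h.
Qed.

(** * Open elements lie in the domain, are disjoint and cover it up to a null set *)

Section MeshGeometry.
Variable R : realType.
Local Notation R2 := (R * R)%type.
Local Notation mR2 := (measurableTypeR R * measurableTypeR R)%type.
Variables (D : set R2) (n : nat) (T : 'I_n -> 'I_3 -> R2).
Hypotheses (oD : open D) (lD : lipschitz_boundary D) (hT : regular_mesh D T).
Local Notation elt i := (open_triangle (T i)).
Let mD : measurable (D : set mR2) := open_measurable_plane oD.

Lemma mesh_det i : tri_det (T i) != 0.
Proof. by have [H _ _ _] := hT; exact: triangle_area_det. Qed.

(** If a frontier point were interior to the closure, the closure would also contain a point a
    little below the graph. Points of D arbitrarily close to that one would lie above the graph,
    against the Lipschitz bound. *)
Lemma lipschitz_interior_closure : interior (closure D) `<=` D.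
Proof.
move=> x ix; apply: contrapT => nDx.
have cx : closure D x by exact: interior_subset.
have fx : frontier D x by split => // /interior_subset.
have [c [s [h [cs1 lh nx]]]] := lD fx.
have [L L0 HL] := lipschitz_global lh.
move: nx => /nbhs_ballP[rho /= rho0 Hrho].
have /nbhs_ballP[rho1 /= rho10 Hrho1] := ix.
pose m := Num.min rho rho1; have m0 : 0 < m by rewrite lt_min rho0.
have [c1 s1] : `|c| <= 1 /\ `|s| <= 1.
  split; rewrite -(@expr_le1 _ 2)// real_normK ?num_real// -cs1.
    by rewrite lerDl sqr_ge0.
  by rewrite lerDr sqr_ge0.
pose q (y : R2) := c * y.2 - s * y.1; pose p (y : R2) := c * y.1 + s * y.2.
(* y is x lowered by t across the graph, in the direction (s, -c), and the ball of radius t around y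
   stays inside the one of radius m around x. *)
pose t := m / 3; have t0 : 0 < t by rewrite divr_gt0.
pose y : R2 := (x.1 + t * s, x.2 - t * c).
have py : p y = p x by rewrite /p /y/=; ring.
have qy : q y = q x - t.
  rewrite -[t in RHS]mulr1 -cs1 /q /y/=; ring.
have tc : `|t * c| <= t by rewrite normrM (ger0_norm (ltW t0)) ler_piMr// ltW.
have ts : `|t * s| <= t by rewrite normrM (ger0_norm (ltW t0)) ler_piMr// ltW.
have mt : m = 3 * t by rewrite /t; field.
have xm z : ball y t z -> ball x m z.
  move=> [/= z1 z2]; rewrite /ball/= in z1 z2; split; rewrite /= /ball/=.
    have -> : x.1 - z.1 = (x.1 + t * s - z.1) - t * s by ring.
    by apply: le_lt_trans (ler_normB _ _) _; rewrite mt; lra.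
  have -> : x.2 - z.2 = (x.2 - t * c - z.2) + t * c by ring.
  by apply: le_lt_trans (ler_normD _ _) _; rewrite mt; lra.
have cy : closure D y.
  apply: Hrho1; apply: (@le_ball _ _ x m); first by rewrite ge_min lexx orbT.
  by apply: xm; exact: ballxx.
have hx : q x <= h (p x).
  rewrite leNgt; apply/negP => hq; apply: nDx.
  by apply/(Hrho x) => //; exact: ballxx.
(* Within [dl] of y the height and the graph change by at most 2 dl + 2 L dl <= t, too little to
   come back above the graph. *)
pose dl := Num.min t (t / (2 * L + 2)).
have L2 : 0 < 2 * L + 2 by rewrite addr_gt0// mulr_gt0.
have dl0 : 0 < dl by rewrite lt_min t0 divr_gt0.
have [z [Dz yz]] := cy _ (nbhsx_ballx y _ dl0).
have zx : ball x rho z.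
  apply: (@le_ball _ _ x m); first by rewrite ge_min lexx.
  by apply: xm; apply: le_ball yz; rewrite ge_min lexx.
have hz := (Hrho z zx).1 Dz; rewrite -/(p z) -/(q z) in hz.
have dlt : dl * (2 * L + 2) <= t by rewrite -ler_pdivlMr// ge_min lexx orbT.
move: yz => [/= y1 y2]; rewrite /ball/= in y1 y2.
have pz : `|p y - p z| <= 2 * dl.
  have -> : p y - p z = c * (y.1 - z.1) + s * (y.2 - z.2) by rewrite /p; ring.
  apply: le_trans (ler_normD _ _) _; rewrite !normrM mulr_natl mulr2n.
  by apply: lerD; rewrite -[leRHS]mul1r; apply: ler_pM => //; exact: ltW.
have qz : `|q y - q z| <= 2 * dl.
  have -> : q y - q z = c * (y.2 - z.2) - s * (y.1 - z.1) by rewrite /q; ring.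
  apply: le_trans (ler_normB _ _) _; rewrite !normrM mulr_natl mulr2n.
  by apply: lerD; rewrite -[leRHS]mul1r; apply: ler_pM => //; exact: ltW.
have hd : `|h (p y) - h (p z)| <= L * (2 * dl).
  by apply: le_trans (HL _ _) _; rewrite ler_pM2l.
move: hd qz; rewrite !ler_norml => /andP[_ hd] /andP[qz _].
rewrite py in hd; rewrite qy in qz.
have : t <= L * (2 * dl) + 2 * dl - (q z - h (p z)) by lra.
have -> : L * (2 * dl) + 2 * dl = dl * (2 * L + 2) by ring.
lra.
Qed.

Lemma open_elt i : open (elt i). Proof. exact: open_open_triangle (mesh_det i). Qed.

Lemma measurable_elt i : measurable (elt i : set mR2).
Proof. by apply: open_measurable_plane; exact: open_elt. Qed.

Lemma elt_sub i : elt i `<=` D.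
Proof.
move=> x xe; apply: lipschitz_interior_closure.
have : nbhs x (elt i) by apply: open_nbhs_nbhs; split => //; exact: open_elt.
apply: filterS => y ye; have [_ _ _ ->] := hT; exists i => //.
rewrite faceE; last exact: mesh_det.
by move: ye; rewrite open_triangleE; [move=> H; split=> [k|k []//]; exact: ltW|exact: mesh_det].
Qed.

(** By conformity a common point lies in the hull of the common vertices. All its barycentric
    coordinates are positive, so every vertex is common, although distinct elements have distinct
    vertex sets. *)
Lemma elt_disjoint i j x : elt i x -> elt j x -> i = j.
Proof.
move=> xi xj; apply: contrapT => /eqP ij; have [_ dr cf _] := hT.
apply: (dr i j ij).
have sub k l y : k != l -> elt k y -> elt l y -> range (T k) `<=` range (T l).
  move=> kl yk yl.
  have : (face (T k) setT `&` face (T l) setT) y.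
    rewrite !faceE; try exact: mesh_det.
    move: yk yl; rewrite !open_triangleE; try exact: mesh_det.
    by move=> H1 H2; split; split=> [m|m []//]; exact: ltW.
  rewrite cf// faceE; last exact: mesh_det.
  move=> [_ H] _ [m _ <-]; apply: contrapT => nm.
  move: yk; rewrite open_triangleE; last exact: mesh_det.
  by move=> /(_ m); rewrite H// ltxx.
by apply/seteqP; split; [exact: (sub i j x)|apply: (sub j i x) => //; rewrite eq_sym].
Qed.

(** A point of the domain in none of the open elements lies on one of the finitely many lines that
    carry the edges. *)
Lemma mesh_cover : ae_in (area R) D (fun x => exists i, elt i x).
Proof.
have H : ae_in (area R) D (fun x => forall ik : 'I_n * 'I_3, bary (T ik.1) ik.2 x != 0).
  apply: ae_forall => ik; have [mZ Z0] := bary_zero_null ik.2 (mesh_det ik.1).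
  exists [set x | bary (T ik.1) ik.2 x = 0]; split => // x /= /not_implyP[_] /negP.
  by rewrite negbK => /eqP.
apply: (ae_mono H) => x Dx nz.
have : closure D x by exact: subset_closure.
have [_ _ _ ->] := hT; move=> [i _]; rewrite faceE; last exact: mesh_det.
move=> [ge0 _]; exists i; rewrite open_triangleE; last exact: mesh_det.
by move=> k; rewrite lt_neqAle ge0 andbT eq_sym; exact: (nz (i, k)).
Qed.

Lemma Rintegral_sum (I : Type) (r : seq I) (F : I -> R2 -> R) :
  (forall i, (area R).-integrable setT (EFin \o F i)) ->
  (area R).-integrable setT (EFin \o (fun x => \sum_(i <- r) F i x)) /\
  (\int[area R]_x (\sum_(i <- r) F i x) = \sum_(i <- r) \int[area R]_x F i x)%R.
Proof.
move=> iF; elim: r => [|i r [IH1 IH2]].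
  rewrite big_nil; under eq_fun do rewrite big_nil; split; first exact: integrable0.
  by rewrite /Rintegral integral0.
rewrite big_cons -IH2 -RintegralD//; split.
  have := integrableD measurableT (iF i) IH1; apply: eq_integrable => // x _ /=.
  by rewrite big_cons EFinD.
by apply: eq_Rintegral => x _; rewrite big_cons.
Qed.

Lemma mesh_integral (F : R2 -> R) : (area R).-integrable D (EFin \o F) ->
  (\int[area R]_(x in D) F x = \sum_i \int[area R]_(x in elt i) F x)%R.
Proof.
move=> iF;
have iFe i : (area R).-integrable setT (EFin \o (F \_ (elt i))).
  have := integrable_mkcond (mu := area R) (EFin \o F) (measurable_elt i); rewrite restrict_EFin => -[-> //].
  apply: integrableS iF => //; [exact: measurable_elt|exact: elt_sub].
transitivity (\int[area R]_(x in D) (\sum_i (F \_ (elt i)) x))%R.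
  apply: ae_eq_Rintegral_any; apply: (ae_mono mesh_cover) => x _ [i xi].
  rewrite (bigD1 i)//= patchE mem_set// big1 ?addr0// => j ji.
  by rewrite patchE memNset// => xj; move/eqP: ji; apply; exact: elt_disjoint xj xi.
rewrite Rintegral_mkcond.
transitivity (\int[area R]_x (\sum_i (F \_ (elt i)) x))%R.
  apply: eq_Rintegral => x _; rewrite patchE; case: ifPn => // /negP nD.
  rewrite big1// => i _; rewrite patchE memNset// => xi; apply: nD; rewrite inE.
  exact: elt_sub xi.
rewrite (Rintegral_sum _ iFe).2; apply: eq_bigr => i _.
by rewrite [RHS]Rintegral_mkcond.
Qed.

End MeshGeometry.

(** * The mixed problem *)

Lemma in_L2_sub (R : realType) (d : measure_display) (X : measurableType d)
    (mu : {measure set X -> \bar R}) (A B : set X) (f : X -> R) :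
  measurable A -> measurable B -> A `<=` B -> in_L2 mu B f -> in_L2 mu A f.
Proof.
move=> mA mB AB /(in_L2P mu mB)[mf fi]; apply/in_L2P => //; split; first exact: measurable_funS mf.
apply: le_lt_trans fi; apply: ge0_subset_integral => //.
  exact/measurable_EFinP/measurable_funX.
by move=> x _; rewrite lee_fin sqr_ge0.
Qed.

Lemma ae_in_sub (R : realType) (d : measure_display) (X : measurableType d)
    (mu : {measure set X -> \bar R}) (A B : set X) (P : X -> Prop) :
  A `<=` B -> ae_in mu B P -> ae_in mu A P.
Proof. by rewrite /ae_in => AB; apply: filterS => x H /AB. Qed.

Lemma Rintegral_sub (R : realType) (d : measure_display) (X : measurableType d)
    (mu : {measure set X -> \bar R}) (A B : set X) (f : X -> R) :
  A `<=` B -> (forall x, ~ A x -> f x = 0) ->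
  (\int[mu]_(x in A) f x = \int[mu]_(x in B) f x)%R.
Proof.
move=> AB f0; rewrite Rintegral_mkcond [RHS]Rintegral_mkcond; congr (Rintegral _ _ _).
apply/funext => x; rewrite !patchE; case: ifPn => [/set_mem/AB Bx|/negP nA].
  by rewrite mem_set.
by case: ifP => // _; rewrite f0// => Ax; apply: nA; rewrite inE.
Qed.

(** * The distributional operator div div *)

Section DivDiv.
Variable R : realType.
Local Notation R2 := (R * R)%type.
Local Notation mR2 := (measurableTypeR R * measurableTypeR R)%type.
Variable D : set R2.
Hypotheses (oD : open D) (bD : bounded_set D).
Implicit Types (M Q : R2 -> 'M[R]_2) (g h : R2 -> R).
Let mD : measurable (D : set mR2) := open_measurable_plane oD.

Lemma is_ddiv_unique M g h : is_ddiv D M g -> is_ddiv D M h ->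
  ae_in (area R) D (fun x => g x = h x).
Proof.
move=> [Lg Hg] [Lh Hh]; apply: (ae_eq_0_test oD bD) => // f1 f2 _ _ t.
by rewrite -Hg// Hh.
Qed.

Lemma ddiv_eq M g : is_ddiv D M g -> ae_in (area R) D (fun x => ddiv D M x = g x).
Proof.
move=> H; apply: is_ddiv_unique (H).
exact: (@xgetI _ _ (fun g => is_ddiv D M g) g).
Qed.

Lemma ddiv_L2 M g : is_ddiv D M g -> in_L2 (area R) D (ddiv D M).
Proof. by move=> H; have [] := @xgetI _ (fun=> 0) (fun g => is_ddiv D M g) g H. Qed.

Lemma ae_is_ddiv M M' g : ae_in (area R) D (fun x => M x = M' x) ->
  is_ddiv D M g -> is_ddiv D M' g.
Proof.
move=> MM [Lg Hg]; split => // phi t; rewrite -Hg//.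
apply: ae_eq_tinner; last exact: ae_all.
by apply: (ae_mono MM) => x _ ->.
Qed.

Lemma is_ddiv_sub (G : set R2) M g : open G -> G `<=` D -> is_ddiv D M g -> is_ddiv G M g.
Proof.
move=> oG GD [Lg Hg]; split.
  by apply: in_L2_sub Lg => //; exact: open_measurable_plane.
move=> phi t; have [sphi [K [cK KG phi0]]] := t.
have tD : test_function D phi by split => //; exists K; split => // x /KG/GD.
have clK : closed K by apply: compact_closed => //; exact: norm_hausdorff.
have z s x : ~ G x -> partials s phi x = 0.
  by move=> nG; apply: (partials_out s clK phi0) => /KG.
have := Hg _ tD; rewrite /tinner /inner.
rewrite -(Rintegral_sub (area R) GD) => [|x nG]; last by rewrite ddotE !mxE !z// !mulr0 !addr0.
rewrite -(Rintegral_sub (area R) GD) => // x nG.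
by have := z [::] x nG; rewrite /= => ->; rewrite mulr0.
Qed.

End DivDiv.

(** * Equivalence of the primal and the mixed problem *)

Section MixedProblem.
Variable R : realType.
Local Notation R2 := (R * R)%type.
Local Notation mR2 := (measurableTypeR R * measurableTypeR R)%type.
Variables (D : set R2) (E : seq (R2 * R2)) (C : R2 -> {linear 'M[R]_2 -> 'M[R]_2}).
Hypotheses (oD : open D) (bD : bounded_set D) (lD : lipschitz_boundary D).
Hypothesis frE : frontier D = [set x | exists2 e, e \in E & segment e.1 e.2 x].
Hypothesis hC : elasticity_tensor D C.
Variables (n : nat) (T : 'I_n -> 'I_3 -> R2).
Hypothesis hT : regular_mesh D T.
Implicit Types (u v w g h f : R2 -> R) (M Q : R2 -> 'M[R]_2).
Local Notation L2 := (in_L2 (area R) D).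
Local Notation ip := (inner (area R) D).
Local Notation nm := (norm2 (area R) D).
Local Notation hess := (hessian D).
Local Notation tL2 := (tL2 D).
Local Notation Cf := (cfield C).
Local Notation en := (energy D C).
Local Notation elt i := (open_triangle (T i)).
Let mD : measurable (D : set mR2) := open_measurable_plane oD.

Definition primal f u : Prop := H20 D u /\ forall w, H20 D w -> en u w = ip f w.

Lemma elt_bounded i : bounded_set (elt i).
Proof.
have [M [Mr HM]] := bD; exists M; split => // N MN x Tx.
exact: HM (elt_sub lD hT Tx).
Qed.

Let mE i : measurable (elt i : set mR2). Proof. exact: (measurable_elt hT i). Qed.
Let oE i : open (elt i). Proof. exact: (open_elt hT). Qed.
Let sE i : elt i `<=` D. Proof. exact: (elt_sub lD hT). Qed.

Lemma ae_elt (P : mR2 -> Prop) i : ae_in (area R) D P -> ae_in (area R) (elt i) P.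
Proof. by apply: (@ae_in_sub R _ mR2 (area R)); exact: sE. Qed.

(** The weak derivative of a smooth function with indices i, j is the classical one with the indices
    exchanged; the symmetry of M absorbs the exchange. *)
Lemma tinner_hessian_test M phi : in_L2S D M -> test_function D phi ->
  tinner D M (hess phi) = tinner D M (fun x => \matrix_(i, j) partials [:: i; j] phi x).
Proof.
move=> [sM LM] [sphi _].
have sw := fun s => smooth_is_wderiv oD bD s (polygonal_frontier_in frE)
    (fun e eE _ => polygonal_segment frE eE) sphi.
have H : ae_in (area R) D (fun x => forall ij : 'I_2 * 'I_2,
    wderiv D [:: ij.1; ij.2] phi x = partials [:: ij.2; ij.1] phi x).
  by apply: ae_forall => -[i j]; exact: (wderiv_eq oD bD (sw [:: i; j])).
apply: ae_eq_Rintegral_any; apply: (ae_mono2 sM H) => x _ /is_symP s h.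
have h' i j : wderiv D [:: i; j] phi x = partials [:: j; i] phi x := h (i, j).
rewrite !ddotE !mxE (h' 0 0) (h' 0 1) (h' 1 0) (h' 1 1) s.
move: (partials _ _ _) (partials _ _ _) (partials _ _ _) (partials _ _ _) => p q t' z.
by ring.
Qed.

Lemma H20_L2 v : H20 D v -> L2 v. Proof. by move=> [[]]. Qed.

Lemma ae_hessian v w : L2 v -> L2 w -> ae_in (area R) D (fun x => v x = w x) ->
  hess v = hess w.
Proof.
move=> Lv Lw vw; apply/funext => x; apply/matrixP => i j; rewrite !mxE.
by rewrite (ae_wderiv oD bD _ Lv Lw vw).
Qed.

Section PrimalFlux.
Variables (f u : R2 -> R).
Hypotheses (Lf : L2 f) (Hu : primal f u).

Let Hku : Hk 2 D u. Proof. by have [[]] := Hu. Qed.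

Lemma flux_L2S : in_L2S D (Cf (hess u)).
Proof. exact: (cfield_L2S mD hC (hessian_L2 Hku)). Qed.

(** Test functions belong to [H20], and on them the primal equation is the definition of the
    distributional div div. *)
Lemma flux_ddiv : is_ddiv D (Cf (hess u)) f.
Proof.
split => // phi t; rewrite -(tinner_hessian_test flux_L2S t).
by have [_ H] := Hu; apply: H; exact: (test_H20 oD bD frE).
Qed.

End PrimalFlux.

Lemma L2S_sub M i : in_L2S D M -> in_L2S (elt i) M.
Proof.
move=> [sM LM]; split; first exact: ae_elt.
by move=> k l; apply: in_L2_sub (LM k l) => //; exact: sE.
Qed.

Lemma ddiv_HdDivT M g : in_L2S D M -> is_ddiv D M g -> HdDivT D T M.
Proof.
move=> LM dM; split=> // i; split; first exact: L2S_sub.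
by exists g; exact: (is_ddiv_sub oD (@oE i) (@sE i) dM).
Qed.

Lemma mesh_inner v w : L2 v -> L2 w -> ip v w = \sum_i inner (area R) (elt i) v w.
Proof. by move=> Lv Lw; apply: (mesh_integral oD lD hT); exact: in_L2_integrable_mul. Qed.

Lemma ddiv_elt M g i : is_ddiv D M g -> ae_in (area R) (elt i) (fun x => ddiv (elt i) M x = g x).
Proof.
move=> dM; apply: (ddiv_eq (@oE i) (elt_bounded i)).
exact: (is_ddiv_sub oD (@oE i) (@sE i) dM).
Qed.

Lemma inner_ddivTE M g v : is_ddiv D M g -> L2 v -> inner_ddivT T v M = ip v g.
Proof.
move=> dM Lv; have [Lg _] := dM; rewrite mesh_inner//; apply: eq_bigr => i _.
apply: ae_eq_Rintegral_any.
by apply: (ae_mono (ddiv_elt i dM)) => x _ ->.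
Qed.

Lemma flux_trace f u v : L2 f -> primal f u -> H20 D v ->
  trace_pairing D T v (Cf (hess u)) = 0.
Proof.
move=> Lf Hu Hv; have dM := flux_ddiv Lf Hu.
rewrite /trace_pairing (inner_ddivTE dM (H20_L2 Hv)) tinnerC.
have [_ H] := Hu; rewrite -/(en u v) H// innerC subrr//.
Qed.

Lemma flux_Hnn f u : L2 f -> primal f u -> Hnn D T (Cf (hess u)).
Proof.
move=> Lf Hu; split; first exact: (ddiv_HdDivT (flux_L2S Hu) (flux_ddiv Lf Hu)).
by move=> v Hv _; exact: (flux_trace Lf Hu Hv).
Qed.

Lemma ae_sym_inverse_flux u : Hk 2 D u ->
  ae_in (area R) D (fun x => sym_inverse (C x) (Cf (hess u) x) = hess u x).
Proof. by move=> Hu; apply: sym_inverse_cfield => //; have [] := hessian_L2S oD bD Hu. Qed.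

Lemma primal_mixed f u : L2 f -> primal f u ->
  mixed_solution D T C f (Cf (hess u)) u (gamma21 D T u).
Proof.
move=> Lf Hu; have [Hu20 _] := Hu; have Hku := H20_Hk Hu20.
split; [exact: (flux_Hnn Lf Hu)|exact: H20_L2|by exists u| |].
  move=> dM HdM; rewrite (ae_eq_tinner (M' := hess u) (Q' := dM) (ae_sym_inverse_flux Hku)).
    by rewrite /gamma21 /trace_pairing subrr.
  exact: ae_all.
move=> du dpsi Ldu [v Hv vpsi].
rewrite (inner_ddivTE (flux_ddiv Lf Hu) Ldu) vpsi; last exact: (flux_Hnn Lf Hu).
by rewrite /gamma21 (flux_trace Lf Hu Hv) subr0 innerC.
Qed.

Lemma mixed_primal f M u psi : L2 f -> mixed_solution D T C f M u psi ->
  [/\ primal f u, ae_in (area R) D (fun x => M x = Cf (hess u) x) &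
      eq_dual D T psi (gamma21 D T u)].
Proof.
move=> Lf [HM Lu [w Hw wpsi] eq1 eq2].
have [[LSM HdM] _] := HM; have [sM LM] := LSM.
(* B is a square integrable representative of C^-1 M, with which [tinner] is bilinear. *)
have [B [sB LB] HB] := sym_inverse_field mD hC LSM.
have eB Q : tinner D (fun x => sym_inverse (C x) (M x)) Q = tinner D B Q.
  apply: ae_eq_tinner; last exact: ae_all.
  by apply: (ae_mono HB) => x _ [].
have CB : ae_in (area R) D (fun x => Cf B x = M x).
  by apply: (ae_mono2 sB HB) => x _ s [_ cb]; rewrite /cfield symp_id.
(* The choice [du = 0] isolates the trace term of the second equation. *)
have trM v : H20 D v -> trace_pairing D T v M = 0.
  move=> Hv; have Hg : H32_0 D T (gamma21 D T v) by exists v.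
  have e0 : ip f (fun=> 0) = 0 by exact: inner0r.
  have := eq2 (fun=> 0) _ (in_L2_0 (area R) mD) Hg; rewrite e0 oppr0.
  rewrite /inner_ddivT big1 => [|i _]; last by rewrite inner0l.
  by rewrite oppr0 sub0r => /eqP; rewrite oppr_eq0 => /eqP.
have dM du : L2 du -> inner_ddivT T du M = ip f du.
  move=> Ldu; have [v Hv] := H20_nonempty oD bD frE.
  have Hg : H32_0 D T (gamma21 D T v) by exists v.
  have := eq2 _ _ Ldu Hg; rewrite /gamma21 trM// subr0 => /eqP.
  by rewrite eqr_opp => /eqP.
have hM v : H20 D v -> tinner D (hess v) M = ip f v.
  move=> Hv; have := trM v Hv; rewrite /trace_pairing dM; last exact: H20_L2.
  by move=> /eqP; rewrite subr_eq0 => /eqP.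
(* [C] is symmetric, so it can be moved from one factor to the other *)
have swap v : Hk 2 D v -> tinner D B (Cf (hess v)) = tinner D (hess v) M.
  move=> Hv; rewrite [RHS]tinnerC; have [_ _ Cs _] := hC.
  have [sv _] := hessian_L2S oD bD Hv.
  apply: ae_eq_Rintegral_any.
  have h1 := ae_mono2 (Q := fun x : mR2 => Defs.is_sym (B x) /\ Defs.is_sym (hess v x))
    sB sv (fun x _ p q => conj p q).
  have h2 := ae_mono2 (Q := fun x : mR2 => Cf B x = M x /\ (forall A A', Defs.is_sym A -> Defs.is_sym A' ->
    ddot (C x A) A' = ddot A (C x A'))) CB Cs (fun x _ p q => conj p q).
  apply: (ae_mono2 h1 h2) => x _ [p q] [<- cs].
  by rewrite /cfield !symp_id// cs.
have [uf Huf20 Ef] := primal_solution oD bD lD frE hC Lf.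
have Huf : primal f uf by split.
have Luf := H20_L2 Huf20.
have test g z : L2 g -> primal g z -> ip u g = ip f z.
  move=> Lg Hz; have [Hz20 _] := Hz.
  have := eq1 _ (flux_Hnn Lg Hz); rewrite eB (swap _ (H20_Hk Hz20)) hM//.
  rewrite (inner_ddivTE (flux_ddiv Lg Hz) Lu) wpsi; last exact: (flux_Hnn Lg Hz).
  by rewrite /gamma21 (flux_trace Lg Hz Hw) subr0 => /eqP; rewrite subr_eq0 => /eqP.
have uuf : ae_in (area R) D (fun x => uf x = u x).
  have Ld : L2 (fun x => u x - uf x) by exact: in_L2B.
  (* With u - uf itself as datum the two identities combine to |u - uf|^2 = 0. *)
  have [z Hz20 Ez] := primal_solution oD bD lD frE hC Ld.
  have Hz : primal (fun x => u x - uf x) z by split.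
  have t1 := test _ _ Ld Hz.
  have t2 : ip f z = ip uf (fun x => u x - uf x).
    rewrite -Ef// (energyC oD bD hC (H20_Hk Huf20) (H20_Hk Hz20)) Ez//; exact: innerC.
  have d0 : ip (fun x => u x - uf x) (fun x => u x - uf x) = 0.
    by rewrite innerBl// t1 t2 subrr.
  have := norm2_eq0 mD Ld; rewrite /norm2 d0 sqrtr0 => /(_ erefl).
  by move=> H; apply: (ae_mono H) => x _ /eqP; rewrite subr_eq0 => /eqP.
have Hu20 : H20 D u by apply: (ae_H20 oD bD (v := uf)).
have hu : hess u = hess uf by rewrite (ae_hessian Luf Lu uuf).
have Hu : primal f u.
  split; first exact: Hu20.
  by move=> v Hv; have := Ef v Hv; rewrite /energy -hu.
have Hku := H20_Hk Hu20; have Lh := hessian_L2 Hku; have LM0 := cfield_L2 mD hC Lh.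
have e1 : tinner D B M = ip f u.
  have := eq1 _ HM; rewrite eB dM// wpsi// /gamma21 trM// subr0.
  by move=> /eqP; rewrite subr_eq0 => /eqP.
have e2 : tinner D B (Cf (hess u)) = ip f u by rewrite swap// hM.
have e3 : tinner D (hess u) M = ip f u by exact: hM.
have e4 : tinner D (hess u) (Cf (hess u)) = ip f u by rewrite tinnerC; have [_ H] := Hu; exact: H.
(* C applied to Bd is M - C D^2 u. All four products in the expansion of the energy of Bd equal (f,
   u), so they cancel. *)
pose Bd x := 1 *: B x + (-1) *: hess u x.
have LBd : tL2 Bd by exact: tL2_lincomb.
have Bd0 : tinner D (Cf Bd) Bd = 0.
  transitivity (tinner D (fun x => 1 *: M x + (-1) *: Cf (hess u) x) Bd).
    apply: ae_eq_tinner; last exact: ae_all.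
    by apply: (ae_mono CB) => x _ cb; rewrite /Bd cfield_lincomb cb.
  rewrite tinner_lincombl// !tinner_lincombr//.
  by rewrite (tinnerC D M B) (tinnerC D M (hess u)) (tinnerC D _ B) (tinnerC D _ (hess u)) e1 e2 e3 e4; ring.
have [alpha a0 Ha] := coercive_injective hC.
have [sh _] := hessian_L2S oD bD Hku.
have Bz : ae_in (area R) D (fun x => Bd x = 0).
  apply: tinner_eq0 => //; apply/eqP; rewrite eq_le tinner_ge0 andbT.
  rewrite -(pmulr_rle0 _ a0) -Bd0 -[leRHS]mul1r.
  apply: ae_le_tinner => //; first exact: cfield_L2.
  have ss := ae_mono2 (Q := fun x : mR2 => Defs.is_sym (Bd x)) sB sh (fun x _ p q => sym_lincomb 1 (-1) p q).
  by apply: (ae_mono2 ss Ha) => x _ s ha; rewrite mul1r /cfield symp_id//; exact: ha.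
have BE : ae_in (area R) D (fun x => B x = hess u x).
  by apply: (ae_mono Bz) => x _; rewrite /Bd scale1r scaleN1r => /eqP; rewrite subr_eq0 => /eqP.
split => //.
  by apply: (ae_mono2 CB BE) => x _ <- b; rewrite /cfield b.
move=> Q HQ; have := eq1 _ HQ; rewrite eB (ae_eq_tinner (M' := hess u) (Q' := Q) BE) //; last exact: ae_all.
by move=> /eqP; rewrite subr_eq0 => /eqP <-.
Qed.

Lemma primal_unique f u u' : L2 f -> primal f u -> primal f u' ->
  ae_in (area R) D (fun x => u x = u' x).
Proof.
move=> Lf [Hu Eu] [Hu' Eu'].
pose d x := 1 * u x + (-1) * u' x.
have Hd : H20 D d by exact: H20_lincomb.
have Hk_ := H20_Hk Hu; have Hk' := H20_Hk Hu'; have Hkd := H20_Hk Hd.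
have e0 : en d d = 0.
  by rewrite (energy_lincombl oD bD hC 1 (-1) Hk_ Hk' Hkd) Eu// Eu'//; ring.
have [alpha a0 Ha] := energy_coercive oD bD hC.
have [c c0 Hc] := H20_norm_le_hessian oD bD frE.
have t0 : tnorm D (hess d) = 0.
  apply/eqP; rewrite -sqrf_eq0 eq_le sqr_ge0 andbT.
  by rewrite -(pmulr_rle0 _ a0) -e0; exact: Ha.
have n0 : nm d = 0.
  by apply/eqP; rewrite eq_le norm2_ge0 andbT; have := Hc d Hd; rewrite t0 mulr0.
apply: (ae_mono (norm2_eq0 mD (H20_L2 Hd) n0)) => x _.
by rewrite /d mul1r mulN1r => /eqP; rewrite subr_eq0 => /eqP.
Qed.

Lemma mesh_tnorm M : tL2 M -> \sum_i tnorm (elt i) M ^+ 2 = tnorm D M ^+ 2.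
Proof.
move=> LM; rewrite tnorm_sqr /tinner (mesh_integral oD lD hT); last exact: integrable_ddot.
by apply: eq_bigr => i _; rewrite tnorm_sqr.
Qed.

(** The squares of the elementwise norms add up to those on the domain, which is why the bound does
    not depend on the mesh. *)
Lemma normdDivT_flux f u M : L2 f -> primal f u ->
  ae_in (area R) D (fun x => M x = Cf (hess u) x) ->
  normdDivT T M <= tnorm D (Cf (hess u)) + nm f.
Proof.
move=> Lf Hu Mu.
have dM : is_ddiv D M f.
  by apply: ae_is_ddiv (flux_ddiv Lf Hu); apply: (ae_mono Mu) => x _ ->.
have -> : normdDivT T M = Num.sqrt (tnorm D (Cf (hess u)) ^+ 2 + nm f ^+ 2).
  congr Num.sqrt; rewrite big_split /=; congr (_ + _).
    rewrite -mesh_tnorm; last by have [_] := flux_L2S Hu.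
    apply: eq_bigr => i _; congr (_ ^+ 2); apply: ae_eq_tnorm.
    exact: ae_elt.
  rewrite norm2_sqr mesh_inner//; apply: eq_bigr => i _; rewrite norm2_sqr.
  apply: ae_eq_Rintegral_any.
  by apply: (ae_mono (ddiv_elt i dM)) => x _ ->.
have t0 := tnorm_ge0 D (Cf (hess u)); have f0 := norm2_ge0 (area R) D f.
apply: ler_of_sqr; first by rewrite addr_ge0.
rewrite sqr_sqrtr ?addr_ge0 ?sqr_ge0// sqrrD.
by rewrite addrAC lerDl mulrn_wge0// mulr_ge0.
Qed.

(** u itself competes in the infimum, which is taken over a set bounded below by 0. *)
Lemma norm32_le u psi : Hk 2 D u -> eq_dual D T psi (gamma21 D T u) ->
  norm32 D T psi <= nm u + tnorm D (hess u).
Proof.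
move=> Hu pu; apply: le_trans (_ : normH2 D u <= _).
  apply: ge_inf; first by exists 0 => _ [v _ <-]; exact: sqrtr_ge0.
  by exists u => //; split => // Q HQ; rewrite pu.
have u0 := norm2_ge0 (area R) D u; have t0 := tnorm_ge0 D (hess u).
apply: ler_of_sqr; first by rewrite addr_ge0.
rewrite sqr_sqrtr ?addr_ge0 ?sqr_ge0// sqrrD.
by rewrite addrAC lerDl mulrn_wge0// mulr_ge0.
Qed.

Lemma gamma21B u u' Q : H20 D u -> H20 D u' -> Hnn D T Q ->
  gamma21 D T (fun x => 1 * u' x + (-1) * u x) Q = gamma21 D T u' Q - gamma21 D T u Q.
Proof.
move=> Hu Hu' [[[_ LQ] HQ] _]; have Hk_ := H20_Hk Hu; have Hk' := H20_Hk Hu'.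
rewrite /gamma21 /trace_pairing.
rewrite (@ae_eq_tinner _ D _ (fun x => 1 *: hess u' x + (-1) *: hess u x) Q Q).
- rewrite tinner_lincombl//; try exact: hessian_L2.
  have -> : inner_ddivT T (fun x => 1 * u' x + (-1) * u x) Q = inner_ddivT T u' Q - inner_ddivT T u Q.
    rewrite /inner_ddivT -sumrB; apply: eq_bigr => i _.
    have [_ [g dg]] := HQ i; have Ld := ddiv_L2 dg.
    have Lu : in_L2 (area R) (elt i) u :=  (in_L2_sub (@mE i) mD (@sE i) (H20_L2 Hu)).
    have Lu' : in_L2 (area R) (elt i) u' :=  (in_L2_sub (@mE i) mD (@sE i) (H20_L2 Hu')).
    by rewrite inner_lincombl// mul1r mulN1r.
  rewrite mul1r mulN1r.
  by move: (tinner _ _ _) (tinner _ _ _) (inner_ddivT _ _ _) (inner_ddivT _ _ _) => a b c e; ring.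
- exact: hessian_lincomb.
- exact: ae_all.
Qed.

End MixedProblem.

Theorem theorem26 (R : realType) (Omega : set (R * R))
    (C : R * R -> {linear 'M[R]_2 -> 'M[R]_2})
    (hOmega : lipschitz_polygon Omega) (hC : elasticity_tensor Omega C) :
  exists2 K : R, 0 < K &
  forall (kappa : R) (n : nat) (T : 'I_n -> 'I_3 -> R * R),
    regular_mesh Omega T -> shape_regular kappa T ->
  [/\ (* existence *)
      forall f : R * R -> R, in_L2 (area R) Omega f ->
        exists M u psi, mixed_solution Omega T C f M u psi,
      (* uniqueness *)
      forall f : R * R -> R, in_L2 (area R) Omega f ->
      forall M u psi M' u' psi',
        mixed_solution Omega T C f M u psi ->
        mixed_solution Omega T C f M' u' psi' ->
        [/\ ae_in (area R) Omega (fun x : R * R => M x = M' x),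
            ae_in (area R) Omega (fun x : R * R => u x = u' x) &
            eq_dual Omega T psi psi'],
      (* continuous dependence on the datum *)
      forall f : R * R -> R, in_L2 (area R) Omega f ->
      forall M u psi, mixed_solution Omega T C f M u psi ->
      forall eps : R, 0 < eps -> exists2 delta : R, 0 < delta &
        forall (f' : R * R -> R) M' u' psi', in_L2 (area R) Omega f' ->
          mixed_solution Omega T C f' M' u' psi' ->
          norm2 (area R) Omega (fun x : R * R => f' x - f x) < delta ->
          normdDivT T (fun x : R * R => M' x - M x)
            + norm2 (area R) Omega (fun x : R * R => u' x - u x)
            + norm32 Omega T (fun Q => psi' Q - psi Q) < eps,
      (* stability *)
      forall (f : R * R -> R) M u psi, in_L2 (area R) Omega f ->
        mixed_solution Omega T C f M u psi ->
        normdDivT T M + norm2 (area R) Omega u + norm32 Omega T psi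
          <= K * norm2 (area R) Omega f &
      (* regularity and the Kirchhoff-Love problem *)
      forall (f : R * R -> R) M u psi, in_L2 (area R) Omega f ->
        mixed_solution Omega T C f M u psi ->
        [/\ H20 Omega u,
            ae_in (area R) Omega (fun x : R * R => M x = C x (hessian Omega u x)),
            HdDiv Omega M,
            eq_dual Omega T psi (gamma21 Omega T u) &
            kirchhoff_love Omega C f u M]].
Proof.
have [[_ oD _ bD] _ [E frE] lD] := hOmega.
have mD := open_measurable_plane oD.
have [K0 K00 HK0] := primal_stability oD bD frE hC.
(* The flux with its divergence f costs K0 + 1, the deflection K0, and the trace norm 2 K0, for the
   deflection and its Hessian. *)
pose K := 4 * K0 + 1; have K1 : 0 < K by rewrite addr_gt0// mulr_gt0.
exists K => // kappa n T hT _.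
(* Stated for primal solutions and not for mixed ones, so that it also applies to the difference of
   two solutions, which solves the primal problem for the difference of the data. *)
have core f u M psi : in_L2 (area R) Omega f -> primal Omega C f u ->
    ae_in (area R) Omega (fun x => M x = cfield C (hessian Omega u) x) ->
    eq_dual Omega T psi (gamma21 Omega T u) ->
    normdDivT T M + norm2 (area R) Omega u + norm32 Omega T psi <= K * norm2 (area R) Omega f.
  move=> Lf Hu Mu pu; have [Hu20 Eu] := Hu.
  have [b1 b2 b3] := HK0 f u Lf Hu20 Eu.
  have b4 := normdDivT_flux oD bD lD frE hC hT Lf Hu Mu.
  have b5 := norm32_le (H20_Hk Hu20) pu.
  rewrite /K mulrDl mul1r -mulrA; lra.
split.
- move=> f Lf; have [u Hu Eu] := primal_solution oD bD lD frE hC Lf.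
  exists (cfield C (hessian Omega u)), u, (gamma21 Omega T u).
  by apply: (primal_mixed oD bD lD frE hC hT Lf).
- move=> f Lf M u psi M' u' psi' S S'.
  have [Hu Mu pu] := mixed_primal oD bD lD frE hC hT Lf S.
  have [Hu' Mu' pu'] := mixed_primal oD bD lD frE hC hT Lf S'.
  have uu := primal_unique oD bD frE hC Lf Hu Hu'.
  have hh := ae_hessian oD bD (H20_L2 Hu.1) (H20_L2 Hu'.1) uu.
  split => //.
    by rewrite -hh in Mu'; apply: (ae_mono2 Mu Mu') => x _ -> ->.
  move=> Q HQ; rewrite pu// pu'// /gamma21 /trace_pairing hh; congr (_ - _).
  apply: eq_bigr => i _; apply: ae_eq_Rintegral_any.
  by apply: (ae_mono (ae_elt lD hT i uu)) => x _ ->.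
(* By linearity the solution map is Lipschitz continuous with constant K. *)
- move=> f Lf M u psi S eps e0; exists (eps / K); first by rewrite divr_gt0.
  move=> f' M' u' psi' Lf' S'; rewrite ltr_pdivlMr// mulrC; apply: le_lt_trans.
  have [Hu Mu pu] := mixed_primal oD bD lD frE hC hT Lf S.
  have [Hu' Mu' pu'] := mixed_primal oD bD lD frE hC hT Lf' S'.
  have [Hu20 Eu] := Hu; have [Hu20' Eu'] := Hu'.
  have Hk_ := H20_Hk Hu20; have Hk' := H20_Hk Hu20'.
  have lin (g g' : R * R -> R) : (fun x => g' x - g x) = (fun x => 1 * g' x + (-1) * g x).
    by apply/funext => x; rewrite mul1r mulN1r.
  apply: core.
  + exact: in_L2B.
  + rewrite (lin u u'); split; first exact: H20_lincomb.
    move=> w Hw; have Hkw := H20_Hk Hw.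
    rewrite (energy_lincombl oD bD hC 1 (-1) Hk' Hk_ Hkw) Eu// Eu'//.
    by rewrite innerBl ?mul1r ?mulN1r//; exact: H20_L2.
  + rewrite lin; have MM := ae_mono2 (Q := fun x : measurableTypeR R * measurableTypeR R =>
      M x = cfield C (hessian Omega u) x /\ M' x = cfield C (hessian Omega u') x) Mu Mu' (fun x _ p q => conj p q).
    apply: (ae_mono2 MM (hessian_lincomb oD bD 1 (-1) Hk' Hk_)) => x _ [-> ->] hx.
    have := cfield_lincomb C 1 (-1) (hessian Omega u') (hessian Omega u) x.
    by rewrite /cfield hx scale1r scaleN1r => ->; rewrite scale1r scaleN1r.
  + move=> Q HQ; rewrite pu// pu'// lin.
    by rewrite (gamma21B oD bD lD hT Hu20 Hu20' HQ).
- by move=> f M u psi Lf S; have [Hu Mu pu] := mixed_primal oD bD lD frE hC hT Lf S; exact: core.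
- move=> f M u psi Lf S; have [Hu Mu pu] := mixed_primal oD bD lD frE hC hT Lf S.
  have [Hu20 _] := Hu; have Hk_ := H20_Hk Hu20.
  have [[[LM _] _] _ _ _ _] := S.
  have MC : ae_in (area R) Omega (fun x => M x = C x (hessian Omega u x)).
    have [sh _] := hessian_L2S oD bD Hk_.
    by apply: (ae_mono2 Mu (cfield_ae C sh)) => x _ -> ->.
  have dM : is_ddiv Omega M f.
    apply: ae_is_ddiv (flux_ddiv oD bD frE hC Lf Hu).
    by apply: (ae_mono Mu) => x _ ->.
  have HM : HdDiv Omega M by split => //; exists f.
  split => //; split => //.
  exact: (ddiv_eq oD bD dM).
Qed.
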